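(* Let $\rho:\mathbb R^d\to(0,\infty)$ be a density profile, let $k\ge1$, $\mathbf x=(x_1,\dots,x_k)\in(\mathbb Z^d)^k$ and $\phi\in\mathcal S(\mathbb R^d)$. For each $N\ge1$ start the independent random walkers from the non-homogeneous product measure with weakly varying density $\nu_\rho^{N}=\bigotimes_{x\in\mathbb Z^d}\mathrm{Poisson}(\rho(\tfrac xN))$, put $\rho^N_t(x)=\mathbb E_x[\rho(\tfrac{X_t}N)]$, and let $$X_N(\mathbf x,\rho,\phi,t)=\sum_{z\in\mathbb Z^d}\phi\left(\tfrac zN\right)\mathcal D_{\rho^N_{tN^2}}\left(\xi(\hat\tau_z\mathbf x),\eta(N^2t)\right).$$ Then for all $T>0$ there exists $C(T)$ such that for all $N$ big enough $$\frac1{N^d}\int_0^T\int_0^T\mathbb E_{\nu_\rho^N}\left[X_N(\mathbf x,\rho,\phi,t)\,X_N(\mathbf x,\rho,\phi,s)\right]ds\,dt\le C(T)\,N^{-\frac{2(k-1)d}{2+(k-1)d}}.$$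
   Context: Fix $d\ge1$; $\mathbb N=\{0,1,2,\dots\}$; $\mathcal S(\mathbb R^d)$ is the space of (real) Schwartz functions. Let $p(i,j)$, $i,j\in\mathbb Z^d$, be a Markov transition function with $p(i,j)=p(j,i)=p(0,j-i)$, $\sum_jp(i,j)=1$, of finite range ($p(i,j)=0$ for $|i-j|>R$, some $R>0$), and irreducible. Independent random walkers: the Markov process $\{\eta(t):t\ge0\}$ on $\mathbb N^{\mathbb Z^d}$ with generator $\mathcal Lf(\eta)=\sum_{i,j}p(i,j)\eta_i(f(\eta^{ij})-f(\eta))$ on local functions, where $\eta^{ij}$ is $\eta$ with one particle moved from $i$ to $j$; thus each particle independently performs a rate-1 continuous-time random walk with jump kernel $p$. The process is always started from configurations for which it is well defined. $X_t$ denotes one such walk and $\mathbb E_x$ its expectation when started at $x\in\mathbb Z^d$. $\mathbb E_{\nu_\rho^N}$ is expectation for the process with $\eta(0)\sim\nu_\rho^N$. For $r:\mathbb Z^d\to(0,\infty)$ and a configuration $\xi$ with finitely many particles, $\mathcal D_r(\xi,\eta)=\prod_{x\in\mathbb Z^d}\sum_{j=0}^{\xi_x}\binom{\xi_x}j(-r(x))^{\xi_x-j}\frac{\eta_x!}{(\eta_x-j)!}$ (with $\frac{n!}{(n-j)!}=0$ for $j>n$), the product of monic Charlier polynomials, orthogonal with respect to the product of Poisson measures with parameters $r(x)$. For $\mathbf x=(x_1,\dots,x_k)$, $\xi(\mathbf x)=\sum_{i=1}^k\delta_{x_i}$ and $\hat\tau_z\mathbf x=(z+x_1,\dots,z+x_k)$.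 The constant $C(T)$ may depend on the fixed data $\rho,k,\mathbf x,\phi,d,p$, but not on $N$.
   Formalization: The density profile ρ is additionally assumed to grow at most polynomially; for arbitrary positive ρ the claim fails (e.g. d=k=1, ρ(x) the denominator of x at rationals and 1 elsewhere, N prime). *)

(* Defs.v *)
From HB Require Import structures.
From mathcomp Require Import all_boot all_order all_algebra.
From mathcomp Require Import finmap.
From mathcomp Require Import all_classical all_reals all_analysis.

Set Implicit Arguments.
Unset Strict Implicit.
Unset Printing Implicit Defensive.

Import Order.TTheory GRing.Theory Num.Theory.
Import numFieldNormedType.Exports.

Local Open Scope classical_set_scope.
Local Open Scope ring_scope.

Notation Zd d := 'rV[int]_d.

Definition configuration (d : nat) := Zd d -> nat.

(* The point x / N of R^d. *)
Definition rescale (R : realType) (d N : nat) (x : Zd d) : 'rV[R]_d :=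
  N%:R^-1 *: map_mx intr x.

(* Sum of an absolutely summable real family (junk otherwise). *)
Definition tsum (R : realType) (I : choiceType) (f : I -> R) : R :=
  fine (\esum_(i in [set: I]) (Num.max (f i) 0)%:E) -
  fine (\esum_(i in [set: I]) (Num.max (- f i) 0)%:E).

(** Schwartz functions *)

Definition partial_deriv (R : realType) (d : nat) (i : 'I_d)
    (f : 'rV[R]_d -> R) : 'rV[R]_d -> R :=
  fun x => 'D_(delta_mx 0 i) f x.

Definition iter_deriv (R : realType) (d : nat) (s : seq 'I_d)
    (f : 'rV[R]_d -> R) : 'rV[R]_d -> R :=
  foldr (@partial_deriv R d) f s.

(* All iterated partial derivatives are differentiable (that is, phi is smooth)
   and rapidly decreasing. *)
Definition schwartz (R : realType) (d : nat) (phi : 'rV[R]_d -> R) : Prop :=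
  forall s : seq 'I_d,
    (forall x, differentiable (iter_deriv s phi) x) /\
    (forall m : nat, exists C : R,
       forall x, `|x| ^+ m * `|iter_deriv s phi x| <= C).

(** Random walk kernels *)

Fixpoint nstep (R : realType) (d : nat) (p : Zd d -> Zd d -> R)
    (n : nat) (x y : Zd d) : R :=
  if n is n'.+1 then tsum (fun z => p x z * nstep p n' z y)
  else (x == y)%:R.

Record walk_kernel (R : realType) (d : nat)
    (p : Zd d -> Zd d -> R) : Prop := WalkKernel {
  walk_kernel_ge0 : forall i j, 0 <= p i j;
  walk_kernel_sum1 : forall i, \esum_(j in [set: Zd d]) (p i j)%:E = 1%E;
  walk_kernel_sym : forall i j, p i j = p j i;
  walk_kernel_transl : forall i j, p i j = p 0 (j - i);
  walk_kernel_range : exists2 r : R, 0 < r &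
    forall i j, r < `|map_mx intr (i - j) : 'rV[R]_d| -> p i j = 0;
  walk_kernel_irr : forall i j, exists n, 0 < nstep p n i j }.

(* Transition function of the rate-1 continuous-time walk with jump kernel p:
   the semigroup exp(t (p - 1)) of the generator f |-> sum_y p(x,y)(f y - f x). *)
Definition heat (R : realType) (d : nat) (p : Zd d -> Zd d -> R)
    (t : R) (x y : Zd d) : R :=
  expR (- t) *
  limn (series (fun n : nat => t ^+ n / n`!%:R * nstep p n x y)).

(* E_x[f(X_t)] for nonnegative f. *)
Definition walk_expectation (R : realType) (d : nat)
    (p : Zd d -> Zd d -> R) (x : Zd d) (t : R)
    (f : Zd d -> R) : R :=
  fine (\esum_(y in [set: Zd d]) (heat p t x y * f y)%:E).

Fixpoint path_weight (R : realType) (d : nat)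
    (p : Zd d -> Zd d -> R) (t : R) (x : Zd d)
    (s : seq (R * Zd d)) : R :=
  if s is (u, y) :: s' then heat p (u - t) x y * path_weight p u y s' else 1.

(* Y is the continuous-time walk started at x, given by its
   finite-dimensional distributions. *)
Definition random_walk (R : realType) (d : nat)
    (p : Zd d -> Zd d -> R) (disp : measure_display)
    (Omega : measurableType disp) (P : probability Omega R)
    (x : Zd d) (Y : R -> Omega -> Zd d) : Prop :=
  (forall t y, 0 <= t -> measurable [set w | Y t w = y]) /\
  (forall s : seq (R * Zd d), path <=%R 0 (unzip1 s) ->
     P [set w | forall u, u \in s -> Y u.1 w = u.2] =
     (path_weight p 0 x s)%:E).

(** Independent random walkers *)

Definition mutually_independent (R : realType) (disp : measure_display)
    (Omega : measurableType disp) (P : probability Omega R)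
    (I : choiceType) (F : I -> set (set Omega)) : Prop :=
  forall (J : {fset I}) (E : I -> set Omega),
    (forall i, i \in J -> F i (E i)) ->
    P (\bigcap_(i in [set` J]) E i) = (\prod_(i <- J) P (E i))%E.

Definition sigma_config (d : nat) (Omega : Type)
    (eta0 : Omega -> configuration d) : set (set Omega) :=
  <<s [set A | exists x m, A = [set w | eta0 w x = m]] >>.

Definition sigma_path (R : realType) (d : nat) (Omega : Type)
    (Y : R -> Omega -> Zd d) : set (set Omega) :=
  <<s [set A | exists t y, 0 <= t /\ A = [set w | Y t w = y]] >>.

(* eta is a system of independent random walkers with jump kernel p: the
   particles initially at x are labelled (x, n) with n < eta 0 x, particle q
   follows a walk Y q started at q.1, the walks and the initial configuration
   are independent, and eta t counts the particles at each site.  The rate of a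
   jump i -> j is then p i j * eta_i.  The count is only required almost
   surely, and in particular is almost surely finite: this is the requirement
   that the process is well defined from its initial law. *)
Definition independent_walkers (R : realType) (d : nat)
    (p : Zd d -> Zd d -> R) (disp : measure_display)
    (Omega : measurableType disp) (P : probability Omega R)
    (eta : R -> Omega -> configuration d) : Prop :=
  (forall t x m, 0 <= t -> measurable [set w | eta t w x = m]) /\
  exists Y : Zd d * nat -> R -> Omega -> Zd d,
  [/\ forall q, random_walk p P q.1 (Y q),
      mutually_independent P (fun o : option (Zd d * nat) =>
        if o is Some q then sigma_path (Y q) else sigma_config (eta 0)) &
      forall t, 0 <= t -> {ae P, forall w, forall y,
        ([set q | (q.2 < eta 0%R w q.1)%N /\ Y q t w = y]
           #= `I_(eta t w y))%card}].

Definition product_poisson (R : realType) (d : nat) (r : Zd d -> R)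
    (disp : measure_display) (Omega : measurableType disp)
    (P : probability Omega R) (eta0 : Omega -> configuration d) : Prop :=
  (forall x m, P [set w | eta0 w x = m] = (poisson_pmf (r x) m)%:E) /\
  mutually_independent P (fun x =>
    <<s [set A | exists m, A = [set w | eta0 w x = m]] >>).

(* Some growth control is needed for the process started from the Poisson
   measures, and for the fluctuation field, to make sense; at most polynomial
   growth is what pairs with Schwartz functions.  Bounded profiles qualify, and
   no regularity is assumed. *)
Definition density_profile (R : realType) (d : nat) (rho : 'rV[R]_d -> R) :
    Prop :=
  (forall x, 0 < rho x) /\
  exists (C : R) (m : nat), forall x, rho x <= C * (1 + `|x|) ^+ m.

(** Charlier polynomials and the fluctuation field *)

(* n-th monic Charlier polynomial of parameter r at m; m ^_ j is the falling
   factorial m! / (m - j)!, which vanishes for j > m. *)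
Definition charlier (R : realType) (r : R) (n m : nat) : R :=
  \sum_(j < n.+1) 'C(n, j)%:R * (- r) ^+ (n - j) * (m ^_ j)%:R.

(* For finite xi only finitely many factors differ from 1. *)
Definition duality (R : realType) (d : nat) (r : Zd d -> R)
    (xi eta : configuration d) : R :=
  \big[*%R/1]_(x \in [set: Zd d]) charlier (r x) (xi x) (eta x).

Definition config_of (d k : nat) (x : k.-tuple (Zd d)) : configuration d :=
  fun y => count_mem y x.

Definition shift_tuple (d k : nat) (z : Zd d) (x : k.-tuple (Zd d)) :
    k.-tuple (Zd d) :=
  [tuple of [seq z + a | a <- x]].

(* rho^N_t(x) = E_x[rho(X_t / N)] *)
Definition evolved_profile (R : realType) (d : nat)
    (p : Zd d -> Zd d -> R) (rho : 'rV[R]_d -> R) (N : nat) (t : R)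
    (x : Zd d) : R :=
  walk_expectation p x t (fun y => rho (rescale R N y)).

Definition fluct_field (R : realType) (d : nat) (p : Zd d -> Zd d -> R)
    (N k : nat) (x : k.-tuple (Zd d)) (rho phi : 'rV[R]_d -> R)
    (Omega : Type) (eta : R -> Omega -> configuration d) (t : R) (w : Omega) :
    R :=
  tsum (fun z : Zd d =>
    phi (rescale R N z) *
    duality (evolved_profile p rho N (t * N%:R ^+ 2))
      (config_of (shift_tuple z x)) (eta (N%:R ^+ 2 * t) w)).

(* Main.v *)
Require Import Defs.
From HB Require Import structures.
From mathcomp Require Import all_boot all_order all_algebra.
From mathcomp Require Import finmap.
From mathcomp Require Import all_classical all_reals all_analysis.
From mathcomp Require Import measurable_realfun.
From mathcomp Require Import ring lra zify.

Set Implicit Arguments.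
Unset Strict Implicit.
Unset Printing Implicit Defensive.

Import Order.TTheory GRing.Theory Num.Theory.
Import numFieldNormedType.Exports.

Local Open Scope classical_set_scope.
Local Open Scope ring_scope.

(**
  Started from a product of Poisson laws, the particles form a Poisson cloud of
  paths: the expected number of n-tuples of distinct particles whose paths pass
  n prescribed tests is the product of the n intensities (factorial_moment).  A
  product of Charlier polynomials at the sites x_1, ..., x_k is a compensated
  sum over k-tuples of distinct particles (wick_charlier), in other words a
  multiple Poisson integral.  By the Mecke formula, a sum over one particle
  removed from the cloud has the expectation of the whole cloud times an
  intensity; applied k times, it turns the covariance of two such integrals
  into a permanent (wick_covariance).  A particle is common to both factors when
  it sits at y at time s and at x at time t, which has intensity
  rho_s(y) p_(t-s)(y, x), where rho_s is the evolved profile and p_u the heat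
  kernel.  Hence (charlier_covariance), for s <= t,
    E[D(x_1, .., x_k; eta_t) D(y_1, .., y_k; eta_s)]
      = sum over permutations g of prod_i rho_s(y_(g i)) p_(t-s)(y_(g i), x_i).

  Insert this in the double sum over the shifts z and z' of the two fields.
  One heat kernel factor is summed over z', where it has mass at most 1; the
  rapid decrease of phi absorbs the polynomial growth of rho_s, and makes the
  sum over z of order N^d; the other k - 1 heat kernel factors are bounded by
  the supremum of the kernel (covariance_sum_bound).

  This supremum is of order t^(-d/2) (heat_sup_le).  By irreducibility the walk
  jumps along d linearly independent vectors.  The numbers of jumps along them
  are independent Poisson variables, which can be read off the displacement
  that they cause, and a Poisson law of parameter m has no atom larger than
  e / sqrt m (poisson_weight_le).

  At macroscopic times the covariance is thus at most a constant times
  N^d min(1, (N sqrt |t - s|)^(-d))^(k-1).  On the strip |t - s| <= eps it is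
  bounded by N^d, off the strip by its value at |t - s| = eps.  The two
  contributions to the time integral, eps and (N sqrt eps)^(-d(k-1)), are equal
  for eps = N^(-2(k-1)d/(2+(k-1)d)), which is the announced rate.

  The field is an infinite series, so the covariance is first computed for
  partial sums and carried over by dominated convergence
  (expectation_tsum_mul).  The covariance is only bounded from above as a function
  of (s, t); its time integrals are compared with those of an explicit step
  function (le_integral_majorant).
*)

(** * Sums of nonnegative families *)

Section EsumToolbox.
Local Open Scope ereal_scope.
Context {R : realType}.

Lemma seq_le_esum (T : choiceType) (f : T -> \bar R) (s : seq T) :
  uniq s -> (forall i, 0 <= f i) -> \sum_(i <- s) f i <= \esum_(i in [set: T]) f i.
Proof.
move=> us f0; apply: esum_ge; exists [set` s]; last by rewrite fsbig_seq.
by split.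
Qed.

Lemma esum_le_bound (T : choiceType) (f : T -> \bar R) (M : \bar R) :
  (forall s : seq T, uniq s -> \sum_(i <- s) f i <= M) ->
  \esum_(i in [set: T]) f i <= M.
Proof.
move=> h; apply: ge_ereal_sup => /= _ [X [finX _] <-].
by rewrite fsbig_finite //=; apply: h; exact: fset_uniq.
Qed.

Lemma esum_uniq_supp (T : choiceType) (f : T -> \bar R) (s : seq T) :
  uniq s -> (forall i, 0 <= f i) -> (forall i, i \notin s -> f i = 0) ->
  \esum_(i in [set: T]) f i = \sum_(i <- s) f i.
Proof.
move=> us f0 fs; apply/eqP; rewrite eq_le seq_le_esum // andbT.
apply: esum_le_bound => r ur; rewrite (bigID (mem s)) /=.
rewrite [X in _ + X]big1 ?adde0; last by move=> i /fs.
rewrite -big_filter [leRHS](bigID (mem r)) /= -[X in _ <= X + _]big_filter.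
have -> : \sum_(i <- [seq i <- r | i \in s]) f i = \sum_(i <- [seq i <- s | i \in r]) f i.
  apply: perm_big; apply: uniq_perm; rewrite ?filter_uniq // => i.
  by rewrite !mem_filter andbC.
by rewrite leeDl // sume_ge0.
Qed.

Lemma esumZl (T : choiceType) (I : set T) (c : R) (f : T -> \bar R) :
  (0 <= c)%R -> (forall i, 0 <= f i) ->
  \esum_(i in I) (c%:E * f i) = c%:E * \esum_(i in I) f i.
Proof.
move=> c0 f0; rewrite /esum -ereal_supZl //; last first.
  by apply/set0P; exists (\sum_(i \in set0) f i); exists set0 => //; split => //; exact: finite_set0.
congr ereal_sup; apply/seteqP; split => [_ [X XI <-]|_ [_ [X XI <-] <-]].
  by exists (\sum_(i \in X) f i); [exists X|rewrite ge0_mule_fsumr].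
by exists X => //; rewrite ge0_mule_fsumr.
Qed.

Lemma esum_swap (T T' : choiceType) (f : T -> T' -> \bar R) :
  (forall i j, 0 <= f i j) ->
  \esum_(i in [set: T]) \esum_(j in [set: T']) f i j =
  \esum_(j in [set: T']) \esum_(i in [set: T]) f i j.
Proof.
move=> f0; rewrite !esum_esum //.
rewrite (@reindex_esum R _ _ ([set: T] `*`` (fun=> [set: T'])) ([set: T'] `*`` (fun=> [set: T])) (fun k => (k.2, k.1))) //.
split => //; first by move=> [a b] [c d] _ _ [-> ->].
by move=> [a b] _; exists (b, a).
Qed.

Lemma esum_asbool (T : choiceType) (I : set T) (f : T -> \bar R) :
  \esum_(i in I) f i = \esum_(i in [set: T]) if `[< I i >] then f i else 0.
Proof. by rewrite esum_mkcond. Qed.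

(** Peeling off the first entry: sums over tuples are handled as sums over lists
    of a given length, so that they can be computed by induction. *)
Lemma esum_seqS (T : choiceType) n (F : seq T -> \bar R) :
  (forall s, 0 <= F s) ->
  \esum_(s in [set s | size s = n.+1]) F s =
  \esum_(x in [set: T]) \esum_(s in [set s | size s = n]) F (x :: s).
Proof.
move=> F0; rewrite esum_esum //.
rewrite (@reindex_esum R _ _ ([set: T] `*`` (fun=> [set s | size s = n])) _ (fun k => k.1 :: k.2)) //; split.
- by move=> [x s] [_ /= ->].
- by move=> [x s] [y r] _ _ /= [-> ->].
- by move=> [//|x s] [sz]; exists (x, s).
Qed.

Lemma esum_bij (T T' : choiceType) (e : T -> T') (g : T' -> T) (f : T' -> \bar R) :
  cancel e g -> cancel g e ->
  \esum_(i in [set: T]) f (e i) = \esum_(i in [set: T']) f i.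
Proof.
move=> eg ge; symmetry; apply: reindex_esum; split => //.
  by move=> a b _ _ /(can_inj eg).
by move=> b _; exists (g b).
Qed.

Lemma esum_exp (x : R) : (0 <= x)%R ->
  \esum_(n in [set: nat]) (x ^+ n / n`!%:R)%:E = (expR x)%:E.
Proof.
move=> x0; rewrite -nneseries_esumT; last first.
  by move=> n; rewrite lee_fin divr_ge0 // exprn_ge0.
rewrite /expR -EFin_lim; last exact: is_cvg_series_exp_coeff.
apply/congr_lim/funext => n /=; rewrite /series /= -sumEFin.
by [].
Qed.

(** Summation by anti-diagonals; a bijection between the pairs (k, m) and the
    pairs (n, k) with k <= n. *)
Lemma esum_diag (F : nat -> nat -> \bar R) : (forall k m, 0 <= F k m) ->
  \esum_(n in [set: nat]) \sum_(k < n.+1) F k (n - k)%N =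
  \esum_(k in [set: nat]) \esum_(m in [set: nat]) F k m.
Proof.
move=> F0.
transitivity (\esum_(n in [set: nat]) \esum_(k in [set: nat])
   if (k <= n)%N then F k (n - k)%N else 0).
  apply: eq_esum => n _.
  rewrite (@esum_uniq_supp _ _ (iota 0 n.+1)) ?iota_uniq //.
  - rewrite -[iota 0 n.+1]/(index_iota 0 n.+1) big_mkord; apply: eq_bigr => k _.
    by rewrite -ltnS ltn_ord.
  - by move=> k; case: ifP.
  - by move=> k; rewrite mem_iota /= add0n ltnS => /negbTE ->.
rewrite esum_swap; last by move=> n k; case: ifP.
apply: eq_esum => k _.
have -> : \esum_(m in [set: nat]) F k m =
   \esum_(n in [set n | (k <= n)%N]) F k (n - k)%N.
  rewrite (@reindex_esum R _ _ ([set: nat]) ([set n | (k <= n)%N]) (addn^~ k)).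
    by apply: eq_esum => m _; rewrite addnK.
  split; first by move=> m _ /=; rewrite leq_addl.
    by move=> a b _ _ /addIn.
  by move=> n /= kn; exists (n - k)%N => //; rewrite subnK.
rewrite [RHS]esum_asbool; apply: eq_esum => n _ /=.
by case: asboolP => [->|/negP/negbTE ->].
Qed.

(** Numbers that are not codes contribute zero, which gives an enumeration of the
    family even when the index type is finite. *)
Lemma esum_pickle (I : countType) (g : I -> \bar R) : (forall i, 0 <= g i) ->
  \esum_(i in [set: I]) g i =
  \sum_(n <oo) (if @choice.pickle_inv I n is Some i then g i else 0).
Proof.
move=> g0; rewrite nneseries_esumT; last by move=> n; case: choice.pickle_inv.
pose P n := isSome (@choice.pickle_inv I n).
have -> : \esum_(i in [set: I]) g i = \esum_(n in [set n | P n])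
    (if @choice.pickle_inv I n is Some i then g i else 0).
  rewrite (@reindex_esum R I nat [set: I]%classic [set n | P n] (@choice.pickle I)).
    by apply: eq_esum => i _; rewrite choice.pickleK_inv.
  split; first by move=> i _ /=; rewrite /P choice.pickleK_inv.
    by move=> a b _ _ /(pcan_inj (@choice.pickleK I)).
  move=> n /=; rewrite /P; have := @choice.pickle_invK I n.
  by case: (choice.pickle_inv n) => [i /= ein _|//]; exists i.
rewrite esum_asbool; apply: eq_esum => n _; rewrite /P /=.
by case: (choice.pickle_inv n) => [i|]; case: asboolP.
Qed.

(** Tonelli for a countable family: enumerating the index type reduces the
    interchange to that of a series. *)
Lemma integral_esum d (T : measurableType d) (mu : {measure set T -> \bar R})
    (I : countType) (f : I -> T -> \bar R) :
  (forall i, measurable_fun [set: T] (f i)) -> (forall i x, 0 <= f i x) ->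
  \int[mu]_x (\esum_(i in [set: I]) f i x) =
  \esum_(i in [set: I]) \int[mu]_x f i x.
Proof.
move=> mf f0.
rewrite esum_pickle; last by move=> i; exact: integral_ge0.
under eq_integral do rewrite esum_pickle //.
rewrite integral_nneseries //.
- apply: eq_eseriesr => n _; case: choice.pickle_inv => //; exact: integral0.
- by move=> n; case: choice.pickle_inv => // *; exact: measurable_cst.
- by move=> n x _; case: choice.pickle_inv.
Qed.

Lemma measurable_esum d (T : measurableType d) (I : countType)
    (f : I -> T -> \bar R) :
  (forall i, measurable_fun [set: T] (f i)) -> (forall i x, 0 <= f i x) ->
  measurable_fun [set: T] (fun x => \esum_(i in [set: I]) f i x).
Proof.
move=> mf f0; under eq_fun do rewrite esum_pickle //.
apply: (@ge0_emeasurable_sum _ _ _ _ _ xpredT) => n.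
  by move=> x _ _; case: choice.pickle_inv.
by move=> _; case: choice.pickle_inv => // *; exact: measurable_cst.
Qed.

End EsumToolbox.

(** * Convolution powers and their Poissonization *)

Section WalkPowers.
Context {R : realType} {d : nat}.
Implicit Types (V : seq (Zd d)) (a : Zd d -> R) (w : Zd d -> R).

Fixpoint conv_power a V n (z : Zd d) : R :=
  if n is n'.+1 then \sum_(v <- V) a v * conv_power a V n' (z - v)
  else (z == 0)%:R.

Lemma conv_power_ge0 a V n z : (forall v, 0 <= a v) -> 0 <= conv_power a V n z.
Proof.
move=> a0; elim: n z => [|n IH] z /=; first by rewrite ler0n.
by apply: sumr_ge0 => v _; rewrite mulr_ge0.
Qed.

Lemma conv_power_perm a V V' n z : perm_eq V V' ->
  conv_power a V n z = conv_power a V' n z.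
Proof.
move=> pV; elim: n z => [|n IH] z //=.
by rewrite (perm_big _ pV) /=; apply: eq_bigr => v _; rewrite IH.
Qed.

(** Binomial formula: among n jumps, choose the k that go along v. *)
Lemma conv_power_cons a v V n z :
  conv_power a (v :: V) n z =
  \sum_(k < n.+1) 'C(n, k)%:R * a v ^+ k * conv_power a V (n - k) (z - v *+ k).
Proof.
elim: n z => [|n IH] z; first by rewrite big_ord1 /= mulr0n subr0 bin0 expr0 !mul1r.
rewrite [LHS]/= big_cons.
have -> : conv_power a (v :: V) n (z - v) = \sum_(k < n.+1)
    'C(n, k)%:R * a v ^+ k * conv_power a V (n - k) (z - v *+ k.+1).
  by rewrite IH; apply: eq_bigr => k _; rewrite mulrS opprD addrA.
under [X in _ + X]eq_bigr do rewrite IH.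
rewrite mulr_sumr.
have -> : \sum_(j <- V) a j * (\sum_(k < n.+1) 'C(n, k)%:R * a v ^+ k *
      conv_power a V (n - k) (z - j - v *+ k)) =
   \sum_(k < n.+1) 'C(n, k)%:R * a v ^+ k * conv_power a V (n.+1 - k) (z - v *+ k).
  under eq_bigr do rewrite mulr_sumr.
  rewrite exchange_big; apply: eq_bigr => k _ /=.
  rewrite subSn /= ?mulr_sumr; last by rewrite -ltnS.
  apply: eq_bigr => j _; rewrite mulrCA; congr (_ * (_ * conv_power _ _ _ _)).
  by rewrite addrAC.
rewrite [RHS]big_ord_recl [X in _ + X]big_ord_recl /= !bin0.
rewrite addrCA; congr (_ + _).
under [in RHS]eq_bigr do rewrite binS natrD !mulrDl.
rewrite big_split /= addrC; congr (_ + _).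
  rewrite [in RHS]big_ord_recr /= bin_small // !mul0r addr0.
  by apply: eq_bigr => k _; rewrite /bump /= add1n.
by apply: eq_bigr => k _; rewrite /bump /= add1n subSS exprS; ring.
Qed.

Local Open Scope ereal_scope.

(** A multiplicative weight turns convolution into multiplication.  The constant
    weight 1 gives the total mass, exponential weights give exponential moments. *)
Lemma esum_conv_power a V w n : (forall v, 0 <= a v)%R ->
  (forall z, 0 <= w z)%R -> (forall y z, w (y + z) = w y * w z)%R -> (w 0 = 1)%R ->
  \esum_(z in [set: Zd d]) (conv_power a V n z * w z)%:E =
  ((\sum_(v <- V) a v * w v) ^+ n)%:E.
Proof.
move=> a0 w0 wD w1; elim: n => [|n IH] /=.
  rewrite (@esum_uniq_supp _ _ _ [:: 0%R]) //.
  - by rewrite big_seq1 /= eqxx w1 mulr1.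
  - by move=> z; rewrite lee_fin mulr_ge0 ?ler0n.
  - by move=> z; rewrite inE => /negbTE ->; rewrite mul0r.
transitivity (\esum_(z in [set: Zd d]) \sum_(v <- V)
    ((a v * w v)%:E * (conv_power a V n (z - v) * w (z - v))%:E)).
  apply: eq_esum => z _; rewrite mulr_suml -sumEFin; apply: eq_bigr => v _.
  rewrite -EFinM; congr EFin.
  have -> : (w z = w (z - v)%R * w v)%R by rewrite -wD subrK.
  by ring.
rewrite esum_sum; last first.
  by move=> z v _ _; rewrite -EFinM lee_fin !mulr_ge0 // conv_power_ge0.
transitivity (\sum_(v <- V) ((a v * w v)%:E * ((\sum_(v <- V) a v * w v) ^+ n)%:E)).
  apply: eq_bigr => v _; rewrite esumZl ?mulr_ge0 //; last first.
    by move=> z; rewrite lee_fin mulr_ge0 // conv_power_ge0.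
  congr (_ * _); rewrite -IH.
  exact: (@esum_bij _ _ _ (fun z => (z - v)%R) (fun z => (z + v)%R)
    (fun z => (conv_power a V n z * w z)%:E) (subrK v) (addrK v)).
under [LHS]eq_bigr do rewrite -EFinM.
by rewrite sumEFin -mulr_suml exprS.
Qed.

(** The law at time t of the walk that jumps by v at rate a v, for each v in V.
    The rates need not add up to 1, so that jump vectors can be added one by one. *)
Definition jump_heat a V (t : R) z : \bar R :=
  (expR (- (t * \sum_(v <- V) a v)))%:E *
  \esum_(n in [set: nat]) (t ^+ n / n`!%:R * conv_power a V n z)%:E.

Lemma jump_heat_ge0 a V t z : (forall v, 0 <= a v)%R -> (0 <= t)%R ->
  0 <= jump_heat a V t z.
Proof.
move=> a0 t0; rewrite mule_ge0 ?lee_fin ?expR_ge0 // esum_ge0 // => n _.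
by rewrite lee_fin mulr_ge0 ?conv_power_ge0 // divr_ge0 ?exprn_ge0.
Qed.

Lemma esum_jump_heat a V w t : (forall v, 0 <= a v)%R -> (0 <= t)%R ->
  (forall z, 0 <= w z)%R -> (forall y z, w (y + z) = w y * w z)%R -> (w 0 = 1)%R ->
  \esum_(z in [set: Zd d]) (jump_heat a V t z * (w z)%:E) =
  (expR (t * (\sum_(v <- V) a v * w v - \sum_(v <- V) a v)))%:E.
Proof.
move=> a0 t0 w0 wD w1.
have c0 n z : (0 <= t ^+ n / n`!%:R * conv_power a V n z)%R.
  by rewrite mulr_ge0 ?conv_power_ge0 // divr_ge0 ?exprn_ge0.
rewrite /jump_heat.
under eq_esum => z _.
  rewrite -muleA (muleC (esum _ _)) -esumZl //; last by move=> n; rewrite lee_fin.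
  over.
rewrite esumZl ?expR_ge0 //; last first.
  by move=> z; apply: esum_ge0 => n _; rewrite -EFinM lee_fin mulr_ge0.
rewrite esum_swap; last by move=> z n; rewrite -EFinM lee_fin mulr_ge0.
transitivity ((expR (- (t * \sum_(v <- V) a v)))%:E *
  \esum_(n in [set: nat]) (((t * \sum_(v <- V) a v * w v) ^+ n / n`!%:R)%:E)).
  congr (_ * _); apply: eq_esum => n _.
  transitivity (\esum_(z in [set: Zd d]) ((t ^+ n / n`!%:R)%:E * (conv_power a V n z * w z)%:E)).
    by apply: eq_esum => z _; rewrite -!EFinM; congr EFin; rewrite mulrC mulrA.
  rewrite esumZl ?divr_ge0 ?exprn_ge0 //; last first.
    by move=> z; rewrite lee_fin mulr_ge0 ?conv_power_ge0.
  by rewrite esum_conv_power // -EFinM exprMn mulrAC.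
rewrite esum_exp; last by rewrite mulr_ge0 // sumr_ge0 // => v _; rewrite mulr_ge0.
by rewrite -EFinM -expRD; congr (expR _)%:E; ring.
Qed.

(** Jumps along different vectors are independent: the walk is a Poisson number
    of jumps along v followed by an independent walk with the other jumps. *)
Lemma jump_heat_cons a v V t z : (forall v, 0 <= a v)%R -> (0 <= t)%R ->
  jump_heat a (v :: V) t z =
  \esum_(k in [set: nat])
    (((t * a v) ^+ k / k`!%:R * expR (- (t * a v)))%:E * jump_heat a V t (z - v *+ k)).
Proof.
move=> a0 t0; rewrite /jump_heat big_cons.
have c0 n z' : (0 <= t ^+ n / n`!%:R * conv_power a V n z')%R.
  by rewrite mulr_ge0 ?conv_power_ge0 // divr_ge0 ?exprn_ge0.
have d0 k : (0 <= (t * a v) ^+ k / k`!%:R)%R.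
  by rewrite divr_ge0 // exprn_ge0 // mulr_ge0.
transitivity ((expR (- (t * (a v + \sum_(v <- V) a v))))%:E *
  \esum_(n in [set: nat]) \sum_(k < n.+1) (((t * a v) ^+ k / k`!%:R)%:E *
     (t ^+ (n - k) / (n - k)`!%:R * conv_power a V (n - k) (z - v *+ k))%:E)).
  congr (_ * _); apply: eq_esum => n _; rewrite conv_power_cons.
  under [in RHS]eq_bigr do rewrite -EFinM.
  rewrite sumEFin mulr_sumr; congr EFin; apply: eq_bigr => k _.
  have kn : (k <= n)%N by rewrite -ltnS.
  have -> : (t ^+ n = t ^+ k * t ^+ (n - k))%R by rewrite -exprD subnKC.
  have nE : (n`!%:R = 'C(n, k)%:R * (k`!%:R * (n - k)`!%:R) :> R)%R.
    by rewrite -!natrM bin_fact.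
  have h1 : (k`!%:R != 0 :> R)%R by rewrite pnatr_eq0 -lt0n fact_gt0.
  have h2 : ((n - k)`!%:R != 0 :> R)%R by rewrite pnatr_eq0 -lt0n fact_gt0.
  have h3 : ('C(n, k)%:R != 0 :> R)%R by rewrite pnatr_eq0 -lt0n bin_gt0.
  by rewrite nE exprMn; field; rewrite h1 h2 h3.
rewrite (@esum_diag R (fun k m => ((t * a v) ^+ k / k`!%:R)%:E *
     (t ^+ m / m`!%:R * conv_power a V m (z - v *+ k))%:E)); last first.
  by move=> k m; rewrite -EFinM lee_fin mulr_ge0.
rewrite -esumZl ?expR_ge0 //; last first.
  by move=> k; apply: esum_ge0 => m _; rewrite -EFinM lee_fin mulr_ge0.
apply: eq_esum => k _; rewrite esumZl //; last by move=> m; rewrite lee_fin.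
by rewrite !muleA -!EFinM mulrDr opprD expRD; congr (_%:E * _); ring.
Qed.

End WalkPowers.

(** * The largest atom of a Poisson law *)

Section PoissonBound.
Context {R : realType}.

Definition poisson_weight (mu : R) (k : nat) : R := mu ^+ k / k`!%:R * expR (- mu).

Lemma poisson_weight_ge0 mu k : 0 <= mu -> 0 <= poisson_weight mu k.
Proof. by move=> h; rewrite mulr_ge0 ?expR_ge0 // divr_ge0 // exprn_ge0. Qed.

Lemma poisson_weightS mu k : poisson_weight mu k.+1 = poisson_weight mu k * (mu / k.+1%:R).
Proof.
rewrite /poisson_weight exprS factS natrM invfM; ring.
Qed.

Lemma esum_poisson_weight mu : 0 <= mu -> \esum_(k in [set: nat]) (poisson_weight mu k)%:E = 1%E.
Proof.
move=> mu0; rewrite /poisson_weight.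
under eq_esum do rewrite mulrC EFinM.
rewrite esumZl ?expR_ge0 //; last by move=> k; rewrite lee_fin divr_ge0 // exprn_ge0.
by rewrite esum_exp // -EFinM -expRD addNr expR0.
Qed.

(** Up to the mode, a Poisson weight is comparable to the next sqrt mu ones, and
    these have sum at most 1; beyond the mode the weights decrease. *)
Lemma poisson_weight_le mu k : 0 < mu -> Num.sqrt mu * poisson_weight mu k <= expR 1.
Proof.
move=> mu0.
pose m := Num.truncn mu.
have /andP[m1 m2] : m%:R <= mu < m.+1%:R by apply: truncn_itv; exact: ltW.
have p0 j : 0 <= poisson_weight mu j by apply: poisson_weight_ge0; exact: ltW.
(* Beyond the mode m the weights decrease. *)
wlog km : k / (k <= m)%N => [h|].
  have [/h //|/ltnW mk] := leqP k m.
  apply: le_trans (h m (leqnn m)); rewrite ler_wpM2l ?sqrtr_ge0 //.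
  rewrite -(subnKC mk); elim: (k - m)%N => [|i IH]; first by rewrite addn0.
  rewrite addnS poisson_weightS (le_trans _ IH) // ler_piMr // ler_pdivrMr ?ltr0n //.
  rewrite mul1r (le_trans (ltW m2)) // ler_nat; lia.
(* The ratio of consecutive weights is mu / (k + i + 1), at least
   1 / (1 + (i + 1) / mu); the exponents i + 1 add up to at most i ^ 2. *)
have low i : poisson_weight mu k * expR (- (i%:R ^+ 2 / mu)) <= poisson_weight mu (k + i).
  elim: i => [|i IH]; first by rewrite expr0n mul0r oppr0 expR0 mulr1 addn0.
  rewrite addnS poisson_weightS.
  apply: (@le_trans _ _ (poisson_weight mu (k + i) * expR (- (i.+1%:R / mu)))).
    apply: (@le_trans _ _ (poisson_weight mu k * expR (- (i%:R ^+ 2 / mu)) * expR (- (i.+1%:R / mu)))).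
      rewrite -mulrA -expRD ler_wpM2l // ler_expR -opprD lerN2 -mulrDl.
      rewrite ler_pM2r ?invr_gt0 // -natr1; have : 0 <= i%:R :> R by [].
      nra.
    by rewrite ler_wpM2r ?expR_ge0.
  rewrite ler_wpM2l // expRN invf_ple ?posrE ?expR_gt0 ?divr_gt0 ?ltr0n //.
  apply: le_trans (expR_ge1Dx _).
  rewrite invf_div ler_pdivrMr // mulrDl mul1r divfK ?gt_eqF //.
  have : k%:R <= mu by apply: le_trans m1; rewrite ler_nat.
  by rewrite -!natr1 natrD; lra.
pose r := Num.truncn (Num.sqrt mu).
have /andP[r1 r2] : r%:R <= Num.sqrt mu < r.+1%:R
  by apply: truncn_itv; exact: sqrtr_ge0.
have : \sum_(i < r.+1) poisson_weight mu (k + i) <= 1.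
  rewrite -lee_fin -(esum_poisson_weight (ltW mu0)) -sumEFin.
  rewrite -(big_mkord xpredT (fun i => (poisson_weight mu (k + i))%:E)).
  have := @seq_le_esum R _ (fun j => (poisson_weight mu j)%:E) (map (addn k) (iota 0 r.+1)).
  rewrite big_map /index_iota subn0; apply; last by move=> j; rewrite lee_fin.
  by rewrite map_inj_uniq ?iota_uniq // => x y /addnI.
move=> sum1.
have : r.+1%:R * (poisson_weight mu k * expR (-1)) <= 1.
  apply: le_trans sum1; rewrite -[r.+1 in leLHS]card_ord mulr_natl -sumr_const.
  apply: ler_sum => i _; apply: le_trans (low i); rewrite ler_wpM2l // ler_expR lerN2.
  rewrite ler_pdivrMr // mul1r -[leRHS](sqr_sqrtr (ltW mu0)).
  rewrite ler_pXn2r ?nnegrE ?sqrtr_ge0 //; apply: le_trans r1.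
  by rewrite ler_nat -ltnS.
rewrite expRN mulrA ler_pdivrMr ?expR_gt0 // mul1r; apply: le_trans.
by rewrite ler_wpM2r // ltW.
Qed.

End PoissonBound.

(** * Jumps along linearly independent directions *)

Section HeatKernel.
Context {R : realType} {d : nat}.
Implicit Types (V B : seq (Zd d)) (a : Zd d -> R).

(** The displacement after ks_i jumps along the i-th vector of B. *)
Fixpoint lattice_comb B (ks : seq nat) : Zd d :=
  match B, ks with
  | v :: B', k :: ks' => v *+ k + lattice_comb B' ks'
  | _, _ => 0
  end.

Lemma lattice_combE B ks : size ks = size B ->
  lattice_comb B ks = \sum_(i < size B) nth 0 B i *+ nth 0%N ks i.
Proof.
elim: B ks => [|v B IH] [|k ks] //=; first by rewrite big_ord0.
by move=> [/IH ->]; rewrite big_ord_recl.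
Qed.

(** Each direction of B is removed with jump_heat_cons, bounding its Poisson
    weights by their supremum. *)
Lemma jump_heat_cat_le a B V t z : (forall v, 0 <= a v) -> 0 < t ->
  (forall v, v \in B -> 0 < a v) ->
  ((\prod_(v <- B) Num.sqrt (t * a v))%:E * jump_heat a (B ++ V) t z <=
   (expR 1 ^+ size B)%:E *
     \esum_(ks in [set ks | size ks = size B]) jump_heat a V t (z - lattice_comb B ks))%E.
Proof.
move=> a0 t0; have t0' := ltW t0.
have g0 W y : (0 <= jump_heat a W t y)%E by apply: jump_heat_ge0.
elim: B z => [|v B IH] z aB.
  rewrite big_nil !mul1e /=.
  have -> : [set ks : seq nat | size ks = 0%N] = [set [::]].
    by apply/seteqP; split => [ks /size0nil ->|_ ->].
  by rewrite esum_set1 //= subr0.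
have av : 0 < a v by apply: aB; rewrite mem_head.
have {}IH y := IH y (fun v' h => aB v' (@mem_behead _ (v :: B) v' h)).
rewrite /= jump_heat_cons // big_cons.
set P := \prod_(j <- B) _ in IH *.
have P0 : 0 <= P by apply: prodr_ge0 => j _; exact: sqrtr_ge0.
rewrite esum_seqS //.
rewrite -[X in (X <= _)%E]esumZl; last 2 first.
- by rewrite mulr_ge0 ?sqrtr_ge0.
- move=> k; rewrite mule_ge0 // lee_fin poisson_weight_ge0 //; exact: mulr_ge0 (ltW av).
rewrite -[X in (_ <= X)%E]esumZl; last 2 first.
- exact/exprn_ge0/expR_ge0.
- by move=> k; apply: esum_ge0.
apply: le_esum => k _ /=.
rewrite (_ : (_ * (_ * jump_heat a (B ++ V) t (z - v *+ k)) =
  (Num.sqrt (t * a v) * poisson_weight (t * a v) k)%:E *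
    (P%:E * jump_heat a (B ++ V) t (z - v *+ k)))%E); last first.
  by rewrite !muleA -!EFinM /poisson_weight; congr (_%:E * _)%E; ring.
rewrite exprS [X in (_ <= X * _)%E]EFinM -[X in (_ <= X)%E]muleA.
apply: lee_pmul.
- by rewrite lee_fin mulr_ge0 ?sqrtr_ge0 // poisson_weight_ge0 // mulr_ge0 // ltW.
- by rewrite mule_ge0.
- by rewrite lee_fin poisson_weight_le // mulr_gt0.
apply: le_trans (IH _) _; rewrite le_eqVlt; apply/orP; left; apply/eqP.
by congr (_ * _)%E; apply: eq_esum => ks _; rewrite opprD addrA.
Qed.

(** If the displacement determines the numbers of jumps along B, the sum left in
    jump_heat_cat_le runs over distinct points, hence is at most a total mass. *)
Lemma jump_heat_sup a B V t z : (forall v, 0 <= a v) -> 0 < t ->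
  (forall v, v \in B -> 0 < a v) ->
  set_inj [set ks | size ks = size B] (lattice_comb B) ->
  ((\prod_(v <- B) Num.sqrt (t * a v))%:E * jump_heat a (B ++ V) t z <=
   (expR 1 ^+ size B)%:E)%E.
Proof.
move=> a0 t0 aB injB.
have g0 W y : (0 <= jump_heat a W t y)%E by apply: jump_heat_ge0 => //; exact: ltW.
apply: le_trans (jump_heat_cat_le _ _ a0 t0 aB) _.
rewrite -[leRHS]mule1; apply: lee_pmul; rewrite ?lee_fin ?exprn_ge0 ?expR_ge0 //.
  exact: esum_ge0.
have h : \esum_(y in [set: Zd d]) jump_heat a V t y = 1%E.
  have := @esum_jump_heat R d a V (fun=> 1) t a0 (ltW t0).
  under eq_esum do rewrite mule1.
  under eq_bigr do rewrite mulr1.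
  rewrite subrr mulr0 expR0; apply => //.
  by move=> *; rewrite mulr1.
rewrite -h.
have injB' : set_inj [set ks | size ks = size B] (fun ks => z - lattice_comb B ks).
  by move=> x y hx hy /addrI /oppr_inj; exact: injB.
rewrite -(esum_image _ _ _ injB') esum_asbool.
by apply: le_esum => y _; case: asboolP.
Qed.

(** In matrix form, the numbers of jumps are multiplied by an invertible matrix. *)
Lemma lattice_comb_inj B V (f : {ffun 'I_d -> 'I_(size V)}) :
  rowsub f (\matrix_(i < size V) map_mx (intr : int -> R) (nth 0 V i)) \in unitmx ->
  B = [seq nth 0 V (f i) | i <- enum 'I_d] ->
  set_inj [set ks | size ks = size B] (lattice_comb B).
Proof.
move=> fU BE.
have sB : size B = d by rewrite BE size_map size_enum_ord.
have nB (i : 'I_d) : nth 0 B i = nth 0 V (f i).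
  by rewrite BE (nth_map i) ?size_enum_ord // nth_ord_enum.
have E ks : size ks = size B -> map_mx (intr : int -> R) (lattice_comb B ks) =
    (\row_(i < d) (nth 0%N ks i)%:R) *m
      rowsub f (\matrix_(i < size V) map_mx (intr : int -> R) (nth 0 V i)).
  move=> sk; rewrite lattice_combE // mulmx_sum_row raddf_sum /=.
  rewrite -[size B]/(size B); move: (sB) => sB'.
  transitivity (\sum_(i < d) map_mx (intr : int -> R) (nth 0 B i *+ nth 0%N ks i)).
    by rewrite -(big_mkord xpredT (fun i => map_mx (intr : int -> R) (nth 0 B i *+ nth 0%N ks i))) sB big_mkord.
  apply: eq_bigr => i _; rewrite mxE nB row_rowsub rowK.
  by rewrite raddfMn /= scaler_nat.
move=> ks ks'; rewrite !inE => hk hk' /(congr1 (map_mx (intr : int -> R))).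
rewrite !E // => /(congr1 (mulmx^~ (invmx (rowsub f (\matrix_(i < size V) map_mx (intr : int -> R) (nth 0 V i)))))).
rewrite /= !mulmxK // => /rowP e.
apply: (@eq_from_nth _ 0%N); first by rewrite hk hk'.
move=> i; rewrite hk sB => id.
by have := e (Ordinal id); rewrite !mxE /= => /eqP; rewrite eqr_nat => /eqP.
Qed.

(** A point that the walk can reach is a sum of jump vectors. *)
Lemma conv_power_span a V n z : conv_power a V n z != 0 ->
  (map_mx (intr : int -> R) z <= \matrix_(i < size V) map_mx (intr : int -> R) (nth 0 V i))%MS.
Proof.
elim: n z => [|n IH] z /=.
  have [->|_] := eqVneq z 0; last by rewrite eqxx.
  by rewrite (raddf0 (map_mx (intr : int -> R))) sub0mx.
move=> h; have [v vV hv] : exists2 v, v \in V & conv_power a V n (z - v) != 0.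
  apply/not_exists2P => H; move/eqP: h; apply; apply: big1_seq => v /andP[_ vV].
  by have [//|/negP/negPn/eqP ->] := H v; rewrite mulr0.
rewrite -[z](subrK v) (raddfD (map_mx (intr : int -> R))) /= addmx_sub ?(IH (z - v)) //.
have iV : (index v V < size V)%N by rewrite index_mem.
have := row_sub (Ordinal iV) (\matrix_(i < size V) map_mx (intr : int -> R) (nth 0 V i)).
by rewrite rowK /= nth_index.
Qed.

End HeatKernel.

(** * The heat kernel of a walk *)

Section Box.
Context {d : nat}.

(** The centred cube of side 2K + 1.  It is indexed by functions so that a sum of
    products over it factorizes. *)
Definition box (K : nat) : seq (Zd d) :=
  [seq (\row_i ((f i)%:Z - K%:Z)) | f : {ffun 'I_d -> 'I_(K.*2.+1)}].

Lemma box_uniq K : uniq (box K).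
Proof.
rewrite map_inj_uniq ?enum_uniq // => f g /rowP e; apply/ffunP => i.
by have := e i; rewrite !mxE => /addIr [] /val_inj.
Qed.

Lemma mem_box K (v : Zd d) : (forall i, `|v 0 i| <= K%:Z) -> v \in box K.
Proof.
move=> h; have hv i : (absz (v 0%R i + K%:Z)%R < K.*2.+1)%N by have := h i; lia.
apply/mapP; exists [ffun i => Ordinal (hv i)]; first by rewrite mem_enum.
by apply/rowP => i; rewrite !mxE ffunE /=; have := h i; lia.
Qed.

Lemma box_sum (R : comNzRingType) K (g : int -> R) :
  \sum_(v <- box K) \prod_i g (v 0 i) = (\sum_(j < K.*2.+1) g (j%:Z - K%:Z)) ^+ d.
Proof.
rewrite big_map big_enum /=.
rewrite -[d in RHS]card_ord -prodr_const bigA_distr_bigA /=.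
by apply: eq_bigr => f _; apply: eq_bigr => i _; rewrite mxE.
Qed.

Lemma sub_box (s : seq (Zd d)) : exists K, {subset s <= box K}.
Proof.
exists (\max_(v <- s) \max_i absz (v 0%R i))%N => v vs; apply: mem_box => i.
rewrite -abszE lez_nat.
have h1 := @leq_bigmax_seq _ s xpredT (fun v : Zd d => \max_i absz (v 0%R i))%N v vs isT.
have h2 := @leq_bigmax _ (fun i => absz (v 0%R i)) i.
exact: leq_trans h2 h1.
Qed.

End Box.

Section Tsum.
Context {R : realType}.

Lemma tsum_ge0 (I : choiceType) (f : I -> R) : (forall i, 0 <= f i) ->
  tsum f = fine (\esum_(i in [set: I]) (f i)%:E).
Proof.
move=> f0; rewrite /tsum [X in _ - fine X]esum1 ?subr0.
  by congr fine; apply: eq_esum => i _; rewrite max_l.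
by move=> i _; rewrite max_r // oppr_le0.
Qed.

Lemma tsum_uniq_supp (I : choiceType) (f : I -> R) s : uniq s ->
  (forall i, 0 <= f i) -> (forall i, i \notin s -> f i = 0) ->
  tsum f = \sum_(i <- s) f i.
Proof.
move=> us f0 fs; rewrite tsum_ge0 // (esum_uniq_supp us) //.
- by rewrite sumEFin.
- by move=> i /fs ->.
Qed.

Lemma norm_coord d (x : 'rV[R]_d) i : `|x 0 i| <= `|x|.
Proof.
rewrite [leRHS]/Num.norm /= mx_normrE.
by apply/bigmax_geP; right => /=; exists (0, i).
Qed.

Lemma lim_series_esum (u : nat -> R) : (forall n, 0 <= u n) -> cvgn (series u) ->
  (limn (series u))%:E = \esum_(n in [set: nat]) (u n)%:E.
Proof.
move=> u0 cu; rewrite -nneseries_esumT; last by move=> n; rewrite lee_fin.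
rewrite -EFin_lim //; apply/congr_lim/funext => n /=.
by rewrite /series /= -sumEFin.
Qed.

End Tsum.

Section WalkKernel.
Context {R : realType} {d : nat} {p : Zd d -> Zd d -> R} (hp : walk_kernel p).

Local Notation a := (p 0).

Lemma kernel_support : exists V : seq (Zd d), uniq V /\ forall v, v \notin V -> a v = 0.
Proof.
have [r r0 hr] := walk_kernel_range hp.
pose K := (Num.truncn r).+1.
exists (box K); split; first exact: box_uniq.
move=> v vb; apply: hr; rewrite sub0r raddfN normrN ltNge; apply/negP => h.
move/negP: vb; apply; apply: mem_box => i.
have h1 : `|(map_mx intr v : 'rV[R]_d) 0 i| < K%:R.
  by apply: le_lt_trans (norm_coord _ _) (le_lt_trans h _); exact: truncnS_gt.
move: h1; rewrite mxE -intr_norm -[K%:R]/((K%:Z)%:~R) ltr_int => h1.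
exact: ltW.
Qed.

Lemma kernel_ge0 v : 0 <= a v. Proof. exact: walk_kernel_ge0 hp _ _. Qed.

Variable V : seq (Zd d).
Hypotheses (uV : uniq V) (aV : forall v, v \notin V -> a v = 0).

Lemma kernel_mass1 : \sum_(v <- V) a v = 1.
Proof.
have := walk_kernel_sum1 hp 0; rewrite (esum_uniq_supp uV) //.
- by rewrite sumEFin => -[].
- by move=> v; rewrite lee_fin kernel_ge0.
- by move=> v /aV ->.
Qed.

Lemma nstep_conv_power n x y : nstep p n x y = conv_power a V n (y - x).
Proof.
elim: n x => [|n IH] x /=; first by rewrite subr_eq0 eq_sym.
rewrite (@tsum_uniq_supp _ _ _ (map (+%R x) V)).
- rewrite big_map; apply: eq_bigr => v _.
  by rewrite (walk_kernel_transl hp) addrAC subrr add0r IH opprD addrA.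
- by rewrite map_inj_uniq //; exact: addrI.
- by move=> z; rewrite mulr_ge0 ?(walk_kernel_ge0 hp) // IH conv_power_ge0 //; exact: kernel_ge0.
- move=> z hz; rewrite (walk_kernel_transl hp) aV ?mul0r //.
  apply: contra hz => h; apply/mapP; exists (z - x) => //.
  by rewrite addrC subrK.
Qed.

Lemma conv_power_le1 n z : conv_power a V n z <= 1.
Proof.
have h0 m y : 0 <= conv_power a V m y by apply: conv_power_ge0; exact: kernel_ge0.
rewrite -lee_fin.
have := @esum_conv_power R d a V (fun=> 1) n kernel_ge0 (fun=> ler01) (fun _ _ => esym (mulr1 1)) erefl.
under eq_bigr do rewrite mulr1.
rewrite kernel_mass1 expr1n => <-.
have -> : (conv_power a V n z)%:E = \sum_(y <- [:: z]) (conv_power a V n y * 1)%:E.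
  by rewrite big_seq1 mulr1.
by apply: seq_le_esum => // y; rewrite mulr1 lee_fin.
Qed.

Lemma heat_jump_heat t x y : 0 <= t -> (heat p t x y)%:E = jump_heat a V t (y - x).
Proof.
move=> t0; rewrite /heat EFinM /jump_heat kernel_mass1 mulr1; congr (_ * _)%E.
have h0 m z : 0 <= conv_power a V m z by apply: conv_power_ge0; exact: kernel_ge0.
under eq_esum do rewrite -nstep_conv_power.
rewrite lim_series_esum //.
  by move=> n; rewrite nstep_conv_power mulr_ge0 // divr_ge0 // exprn_ge0.
apply: (@series_le_cvg _ _ (exp_coeff t)).
- by move=> n; rewrite nstep_conv_power mulr_ge0 // divr_ge0 // exprn_ge0.
- by move=> n; exact: exp_coeff_ge0.
- by move=> n; rewrite nstep_conv_power ler_piMr ?conv_power_le1 // divr_ge0 // exprn_ge0.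
- exact: is_cvg_series_exp_coeff.
Qed.

End WalkKernel.

Section HeatFacts.
Context {R : realType} {d : nat} {p : Zd d -> Zd d -> R} (hp : walk_kernel p).

Lemma heat_ge0 t x y : 0 <= t -> 0 <= heat p t x y.
Proof.
have [V [uV aV]] := kernel_support hp.
by move=> t0; rewrite -lee_fin (heat_jump_heat hp uV aV) // jump_heat_ge0 // => v; exact: kernel_ge0.
Qed.

Lemma conv_power_sym V n z : uniq V -> (forall v, v \notin V -> p 0 v = 0) ->
  conv_power (p 0) V n (- z) = conv_power (p 0) V n z.
Proof.
move=> uV aV.
have aN v : p 0 (- v) = p 0 v.
  by rewrite (walk_kernel_sym hp) (walk_kernel_transl hp) sub0r opprK.
elim: n z => [|n IH] z /=; first by rewrite oppr_eq0.
have E (f : Zd d -> R) : (forall v, 0 <= f v) ->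
    \sum_(v <- V) p 0 v * f v = tsum (fun v => p 0 v * f v).
  move=> f0; rewrite (tsum_uniq_supp uV) //.
    by move=> v; rewrite mulr_ge0 // kernel_ge0.
  by move=> v /aV ->; rewrite mul0r.
have c0 m y : 0 <= conv_power (p 0) V m y by apply: conv_power_ge0; exact: kernel_ge0.
rewrite E // E // !tsum_ge0; try by move=> v; rewrite mulr_ge0 // kernel_ge0.
congr fine; rewrite -(@esum_bij _ _ _ (@GRing.opp (Zd d)) (@GRing.opp _)); try exact: opprK.
by apply: eq_esum => v _; rewrite aN -opprD IH.
Qed.

Lemma heat_sym t x y : 0 <= t -> heat p t x y = heat p t y x.
Proof.
have [V [uV aV]] := kernel_support hp.
move=> t0; apply/EFin_inj; rewrite !(heat_jump_heat hp uV aV) // /jump_heat.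
congr (_ * _)%E; apply: eq_esum => n _.
by rewrite -[in LHS]opprB conv_power_sym.
Qed.

Lemma esum_heat t x : 0 <= t -> \esum_(y in [set: Zd d]) (heat p t x y)%:E = 1%E.
Proof.
have [V [uV aV]] := kernel_support hp.
move=> t0; under eq_esum do rewrite (heat_jump_heat hp uV aV) //.
rewrite (@esum_bij _ _ _ (fun y => y - x) (fun y => y + x) (fun z => jump_heat (p 0) V t z) (subrK x) (addrK x)).
have := @esum_jump_heat R d (p 0) V (fun=> 1) t (kernel_ge0 hp) t0 (fun=> ler01) (fun _ _ => esym (mulr1 1)) erefl.
under eq_esum do rewrite mule1.
under eq_bigr do rewrite mulr1.
by rewrite subrr mulr0 expR0.
Qed.

Lemma heat_le1 t x y : 0 <= t -> heat p t x y <= 1.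
Proof.
move=> t0; rewrite -lee_fin -(esum_heat x t0).
have -> : (heat p t x y)%:E = \sum_(z <- [:: y]) (heat p t x z)%:E by rewrite big_seq1.
by apply: seq_le_esum => // z; rewrite lee_fin heat_ge0.
Qed.

(** Irreducibility makes the jump vectors span, so d of them are linearly
    independent; each of these contributes a factor of order 1 / sqrt t. *)
Theorem heat_sup_le : exists2 C, 0 < C &
  forall t x y, 0 < t -> heat p t x y * Num.sqrt t ^+ d <= C.
Proof.
have [V0 [uV0 aV0]] := kernel_support hp.
(* Only vectors of positive rate may be used as jump directions. *)
pose V := [seq v <- V0 | p 0 v != 0].
have uV : uniq V by rewrite filter_uniq.
have aV v : v \notin V -> p 0 v = 0.
  by rewrite mem_filter negb_and negbK => /orP[/eqP|/aV0].
have posV v : v \in V -> 0 < p 0 v.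
  by rewrite mem_filter lt_neqAle eq_sym kernel_ge0 // andbT => /andP[].
pose M := \matrix_(i < size V) map_mx (intr : int -> R) (nth 0 V i).
have fullM : row_full M.
  rewrite -sub1mx; apply/row_subP => i; rewrite rowE mulmx1.
  have [n hn] := walk_kernel_irr hp 0 (delta_mx 0 i : Zd d).
  have := @conv_power_span R d (p 0) V n (delta_mx 0 i).
  rewrite -[X in conv_power _ _ _ X]subr0 -(nstep_conv_power hp uV aV) gt_eqF //.
  move=> /(_ isT); congr (_ <= _)%MS.
  by apply/rowP => j; rewrite !mxE; case: eqP => //; case: eqP.
pose f := fullrankfun fullM.
(* The rows selected by f form a basis; the other jumps are kept in V'. *)
pose B := [seq nth 0 V (f i) | i <- enum 'I_d].
have sB : size B = d by rewrite size_map size_enum_ord.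
have BV v : v \in B -> v \in V.
  by case/mapP => i _ ->; rewrite mem_nth.
have uB : uniq B.
  rewrite map_inj_uniq ?enum_uniq // => i j /eqP.
  by rewrite nth_uniq // => /eqP /val_inj /fullrankfun_inj.
pose V' := [seq v <- V | v \notin B].
have pV : perm_eq V (B ++ V').
  apply: uniq_perm => //.
    rewrite cat_uniq uB filter_uniq // andbT; apply/hasPn => v.
    by rewrite mem_filter => /andP[].
  move=> v; rewrite mem_cat [v \in V']mem_filter; case vB: (v \in B) => //=; exact: BV.
have posB v : v \in B -> 0 < p 0 v by move=> /BV/posV.
have inj := lattice_comb_inj (fullrowsub_unit fullM) (erefl B).
pose Q := \prod_(v <- B) Num.sqrt (p 0 v).
have Q0 : 0 < Q.
  rewrite /Q big_seq; apply: prodr_gt0 => v vB; rewrite sqrtr_gt0; exact: posB.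
exists (expR 1 ^+ d / Q); first by rewrite divr_gt0 // exprn_gt0 ?expR_gt0.
move=> t x y t0.
have := @jump_heat_sup R d (p 0) B V' t (y - x) (kernel_ge0 hp) t0 posB inj.
have -> : jump_heat (p 0) (B ++ V') t (y - x) = jump_heat (p 0) V t (y - x).
  rewrite /jump_heat (perm_big _ pV); congr (_ * _)%E.
  by apply: eq_esum => n _; rewrite (conv_power_perm _ _ _ pV).
rewrite -(heat_jump_heat hp uV aV) ?(ltW t0) // -EFinM lee_fin sB.
have -> : \prod_(v <- B) Num.sqrt (t * p 0 v) = Num.sqrt t ^+ d * Q.
  under eq_bigr do rewrite sqrtrM ?(ltW t0) //.
  by rewrite big_split /= big_const_seq count_predT sB /Q iter_mulr_1.
by rewrite ler_pdivlMr // => h; apply: le_trans h; rewrite le_eqVlt; apply/orP; left; apply/eqP; ring.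
Qed.

End HeatFacts.

(** * Growth of the evolved profile *)

Section EvolvedProfile.
Context {R : realType} {d : nat} {p : Zd d -> Zd d -> R} (hp : walk_kernel p).

Lemma cosh_bound (x : R) : expR x + expR (- x) - 2 <= x ^+ 2 * expR `|x|.
Proof.
wlog x0 : x / 0 <= x => [h|].
  have [/h //|/ltW x0] := leP 0 x.
  by have := h (- x); rewrite oppr_ge0 opprK normrN sqrrN addrC [_ + expR x]addrC addrC => /(_ x0).
rewrite ger0_norm //.
have e1 : expR (- x) * expR x = 1 by rewrite -expRD addNr expR0.
have -> : expR x + expR (- x) - 2 = expR (- x) * (expR x - 1) ^+ 2.
  transitivity (expR x * (expR (- x) * expR x) + expR (- x) - 2 * (expR (- x) * expR x)).
    by rewrite e1 !mulr1.
  by ring.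
have -> : x ^+ 2 * expR x = expR (- x) * (x * expR x) ^+ 2.
  transitivity (x ^+ 2 * expR x * (expR (- x) * expR x)); last by ring.
  by rewrite e1 mulr1.
rewrite ler_wpM2l ?expR_ge0 // ler_pXn2r ?nnegrE ?mulr_ge0 ?expR_ge0 //.
  have := expR_ge1Dx (- x); have := expR_gt0 x; nra.
by rewrite subr_ge0 -expR0 ler_expR.
Qed.

Lemma rescaleD N (x y : Zd d) : rescale R N (x + y) = rescale R N x + rescale R N y.
Proof. by rewrite /rescale (raddfD (map_mx (intr : int -> R))) scalerDr. Qed.

Lemma expR_norm_le (x : 'rV[R]_d) (l : R) : (0 < d)%N -> 0 <= l ->
  expR (l * `|x|) <= \sum_(i < d) (expR (l * x 0 i) + expR (- l * x 0 i)).
Proof.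
move=> d0 l0.
have [i hi] : exists i, `|x| = `|x 0 i|.
  have [x0|x0] := eqVneq x 0.
    by exists (Ordinal d0); rewrite x0 mxE !normr0.
  have [|[i j] /= hij] := @mx_norm_neq0 R 1 d x.
    by apply: contra_neq x0 => /mx_norm_eq0.
  have -> : `|x| = mx_norm x by [].
  rewrite hij.
  by exists j; rewrite (ord1 i).
rewrite (bigD1 i) //= hi -[leLHS]addr0; apply: lerD.
  case: (ger0P (x 0 i)) => _; first by rewrite lerDl expR_ge0.
  by rewrite mulrN mulNr lerDr expR_ge0.
by apply: sumr_ge0 => j _; rewrite addr_ge0 ?expR_ge0.
Qed.

(** By symmetry of the kernel, the exponential can be replaced by a hyperbolic
    cosine in the generator, so that the exponent is quadratic in l.  For l of
    order 1 / N this stays bounded up to times of order N^2. *)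
Lemma expo_moment V (i : 'I_d) (l : R) t : uniq V ->
  (forall v, v \notin V -> p 0 v = 0) -> 0 <= t ->
  (\esum_(z in [set: Zd d]) (jump_heat (p 0) V t z * (expR (l * (z 0 i)%:~R))%:E) <=
   (expR (t * (l ^+ 2 * \sum_(v <- V) p 0 v * ((v 0 i)%:~R ^+ 2 * expR (`|l| * `|(v 0 i)%:~R|)))))%:E)%E.
Proof.
move=> uV aV t0.
pose w (z : Zd d) : R := expR (l * (z 0 i)%:~R).
have wD y z : w (y + z) = w y * w z by rewrite /w mxE rmorphD /= mulrDr expRD.
have w1 : w 0 = 1 by rewrite /w mxE mulr0 expR0.
rewrite (esum_jump_heat V (kernel_ge0 hp) t0 (fun z => expR_ge0 _) wD w1).
rewrite lee_fin ler_expR ler_wpM2l //.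
have aN v : p 0 (- v) = p 0 v.
  by rewrite (walk_kernel_sym hp) (walk_kernel_transl hp) sub0r opprK.
have E (f : Zd d -> R) : (forall v, 0 <= f v) ->
    \sum_(v <- V) p 0 v * f v = tsum (fun v => p 0 v * f v).
  move=> f0; rewrite (tsum_uniq_supp uV) //.
    by move=> v; rewrite mulr_ge0 // kernel_ge0.
  by move=> v /aV ->; rewrite mul0r.
have S : \sum_(v <- V) p 0 v * w v = \sum_(v <- V) p 0 v * w (- v).
  rewrite E ?E; try by move=> v; exact: expR_ge0.
  rewrite !tsum_ge0; try by move=> v; rewrite mulr_ge0 ?expR_ge0 ?(kernel_ge0 hp).
  congr fine; rewrite -(@esum_bij _ _ _ (@GRing.opp (Zd d)) (@GRing.opp _)); try exact: opprK.
  by apply: eq_esum => v _; rewrite aN.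
have -> : \sum_(v <- V) p 0 v * w v - \sum_(v <- V) p 0 v =
    2^-1 * \sum_(v <- V) p 0 v * (w v + w (- v) - 2).
  under [in RHS]eq_bigr do rewrite mulrBr mulrDr.
  by rewrite big_split /= big_split /= -S sumrN -mulr_suml; field.
have -> : l ^+ 2 * \sum_(v <- V) p 0 v * ((v 0 i)%:~R ^+ 2 * expR (`|l| * `|(v 0 i)%:~R|)) =
   \sum_(v <- V) p 0 v * ((l * (v 0 i)%:~R) ^+ 2 * expR `|l * (v 0 i)%:~R|).
  by rewrite mulr_sumr; apply: eq_bigr => v _; rewrite normrM; ring.
have h : \sum_(v <- V) p 0 v * (w v + w (- v) - 2) <=
   \sum_(v <- V) p 0 v * ((l * (v 0 i)%:~R) ^+ 2 * expR `|l * (v 0 i)%:~R|).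
  apply: ler_sum => v _; rewrite ler_wpM2l ?(kernel_ge0 hp) //.
  rewrite /w mxE rmorphN /= mulrN; exact: cosh_bound.
have : 0 <= \sum_(v <- V) p 0 v * ((l * (v 0 i)%:~R) ^+ 2 * expR `|l * (v 0 i)%:~R|).
  by apply: sumr_ge0 => v _; rewrite mulr_ge0 ?(kernel_ge0 hp) // mulr_ge0 ?expR_ge0 ?sqr_ge0.
lra.
Qed.

(** In diffusive scaling all moments of the displacement are bounded, so that a
    profile of polynomial growth keeps it, uniformly for t <= T N^2. *)
Lemma evolved_sum_bound (rho : 'rV[R]_d -> R) (T : R) : (0 < d)%N ->
  density_profile rho -> 0 <= T ->
  exists K m, 0 <= K /\ forall N t x, (0 < N)%N -> 0 <= t <= T * N%:R ^+ 2 ->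
  (\esum_(y in [set: Zd d]) (heat p t x y * rho (rescale R N y))%:E <=
   (K * (1 + `|rescale R N x|) ^+ m)%:E)%E.
Proof.
move=> d0 [rho0 [C [m hC]]] T0.
have [V [uV aV]] := kernel_support hp.
have C0 : 0 <= C.
  by have := hC 0; rewrite normr0 addr0 expr1n mulr1; apply: le_trans; exact: ltW.
pose S := \sum_(i < d) m%:R ^+ 2 * \sum_(v <- V) p 0 v * ((v 0 i)%:~R ^+ 2 * expR (m%:R * `|(v 0 i)%:~R|)).
have term0 (i : 'I_d) : 0 <= m%:R ^+ 2 * \sum_(v <- V) p 0 v * ((v 0 i)%:~R ^+ 2 * expR (m%:R * `|(v 0 i)%:~R|)).
  by rewrite mulr_ge0 ?sqr_ge0 // sumr_ge0 // => v _; rewrite mulr_ge0 ?(kernel_ge0 hp) // mulr_ge0 ?expR_ge0 ?sqr_ge0.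
exists (C * (d%:R * (expR (T * S) + expR (T * S)))), m; split.
  by rewrite !mulr_ge0 // addr_ge0 // expR_ge0.
move=> N t x N0 /andP[t0 tT].
have N0' : 0 < N%:R :> R by rewrite ltr0n.
have g0 z : (0 <= jump_heat (p 0) V t z)%E by apply: jump_heat_ge0 => //; exact: kernel_ge0.
(* (1 + |y|) ^ m is bounded by exp (m |y|), and the norm of y is attained at a
   coordinate: 2 d exponential moments suffice. *)
pose l : R := m%:R / N%:R.
have l0 : 0 <= l by rewrite divr_ge0.
have lm : l <= m%:R by rewrite ler_pdivrMr // ler_peMr // ler1n.
have mom (i : 'I_d) l' : `|l'| = l ->
    (\esum_(z in [set: Zd d]) (jump_heat (p 0) V t z * (expR (l' * (z 0 i)%:~R))%:E) <= (expR (T * S))%:E)%E.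
  move=> hl; apply: le_trans (expo_moment i l' uV aV t0) _.
  rewrite lee_fin ler_expR.
  apply: (@le_trans _ _ (T * N%:R ^+ 2 * (l' ^+ 2 * \sum_(v <- V) p 0 v * ((v 0 i)%:~R ^+ 2 * expR (m%:R * `|(v 0 i)%:~R|))))).
    apply: ler_pM => //.
      by rewrite mulr_ge0 ?sqr_ge0 // sumr_ge0 // => v _; rewrite mulr_ge0 ?(kernel_ge0 hp) // mulr_ge0 ?expR_ge0 ?sqr_ge0.
    rewrite ler_wpM2l ?sqr_ge0 //; apply: ler_sum => v _.
    rewrite ler_wpM2l ?(kernel_ge0 hp) // ler_wpM2l ?sqr_ge0 // ler_expR ler_wpM2r // hl //.
  rewrite -mulrA ler_wpM2l //.
  have -> : l' ^+ 2 = m%:R ^+ 2 / N%:R ^+ 2 by rewrite -real_normK ?num_real // hl expr_div_n.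
  have -> (X : R) : N%:R ^+ 2 * (m%:R ^+ 2 / N%:R ^+ 2 * X) = m%:R ^+ 2 * X.
    by field; rewrite gt_eqF.
  rewrite /S (bigD1 i) //= lerDl.
  by apply: sumr_ge0 => j _.
pose W (z : Zd d) : R := \sum_(i < d) (expR (l * (z 0 i)%:~R) + expR (- l * (z 0 i)%:~R)).
pose A := C * (1 + `|rescale R N x|) ^+ m.
have A0 : 0 <= A by rewrite mulr_ge0 // exprn_ge0 // addr_ge0.
have hrho y : rho (rescale R N y) <= A * W (y - x).
  apply: le_trans (hC _) _; rewrite /A -mulrA ler_wpM2l //.
  apply: (@le_trans _ _ ((1 + `|rescale R N x|) ^+ m * (1 + `|rescale R N (y - x)|) ^+ m)).
    rewrite -exprMn lerXn2r ?nnegrE ?mulr_ge0 ?addr_ge0 //.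
    have -> : rescale R N y = rescale R N (y - x) + rescale R N x.
      by rewrite -rescaleD subrK.
    have := ler_normD (rescale R N (y - x)) (rescale R N x).
    have := normr_ge0 (rescale R N x); have := normr_ge0 (rescale R N (y - x)).
    move: (`|rescale R N x|) (`|rescale R N (y - x)|) (`|_ + _|) => b c e.
    nra.
  rewrite ler_wpM2l ?exprn_ge0 ?addr_ge0 //.
  apply: (@le_trans _ _ (expR (m%:R * `|rescale R N (y - x)|))).
    by rewrite expRM_natl lerXn2r ?nnegrE ?addr_ge0 ?expR_ge0 // expR_ge1Dx.
  apply: le_trans (expR_norm_le _ d0 (ler0n _ m)) _.
  apply: ler_sum => i _; rewrite mxE mxE.
  by rewrite /l !mulNr !mulrA.
apply: (@le_trans _ _ (\esum_(y in [set: Zd d]) (jump_heat (p 0) V t (y - x) * (A * W (y - x))%:E))%E).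
  apply: le_esum => y _; rewrite EFinM (heat_jump_heat hp uV aV) // lee_wpmul2l //.
  by rewrite lee_fin.
rewrite (@esum_bij _ _ _ (fun y => y - x) (fun y => y + x) (fun z => jump_heat (p 0) V t z * (A * W z)%:E)%E (subrK x) (addrK x)).
apply: (@le_trans _ _ (A%:E * \sum_(i < d) ((expR (T * S))%:E + (expR (T * S))%:E))%E); last first.
  rewrite sumEFin sumr_const card_ord -EFinM lee_fin /A -mulr_natl.
  by rewrite le_eqVlt; apply/orP; left; apply/eqP; ring.
have e0 l' (i : 'I_d) z : (0 <= jump_heat (p 0) V t z * (expR (l' * (z 0 i)%:~R))%:E)%E.
  by rewrite mule_ge0 // lee_fin expR_ge0.
rewrite (@eq_esum _ _ _ _ (fun z => A%:E * \sum_(i < d)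
   (jump_heat (p 0) V t z * (expR (l * (z 0 i)%:~R))%:E +
    jump_heat (p 0) V t z * (expR (- l * (z 0 i)%:~R))%:E))%E); last first.
  move=> z _; rewrite EFinM muleCA; congr (_ * _)%E.
  rewrite /W -sumEFin ge0_sume_distrr; last first.
    by move=> i _; rewrite lee_fin addr_ge0 ?expR_ge0.
  by apply: eq_bigr => i _; rewrite EFinD ge0_muleDr // lee_fin expR_ge0.
rewrite esumZl //; last by move=> z; apply: sume_ge0 => i _; rewrite adde_ge0.
rewrite lee_wpmul2l ?lee_fin // esum_sum; last by move=> z i _ _; rewrite adde_ge0.
apply: lee_sum => i _; rewrite esumD //.
by apply: leeD; apply: mom; rewrite ?normrN ger0_norm.
Qed.

End EvolvedProfile.

(** * Compensated sums over tuples of particles *)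

Definition delete_nth T (i : nat) (s : seq T) := take i s ++ drop i.+1 s.

(** Expansion along the first row; for lists of different lengths the value is 0. *)
Fixpoint permanent (R : comNzRingType) (S : Type) (M : S -> S -> R)
  (xs ys : seq S) : R :=
  if xs is x :: xs' then
    \sum_(i < size ys) M x (nth x ys i) * permanent M xs' (delete_nth i ys)
  else (size ys == 0)%:R.

Section FactorialFunctionals.
Variables (R : comNzRingType) (E : eqType).
Implicit Types (f g : pred E) (fs gs : seq (pred E)) (S : seq E).
Implicit Types (F G : seq E -> R).

(** The sum over the particles e of S that pass the test f, of F evaluated at the
    remaining particles. *)
Definition create f F S : R := \sum_(e <- S) (f e)%:R * F (rem e S).

(** The number of tuples of distinct particles of S passing the tests fs in order. *)
Definition factorial_sum fs : seq E -> R := foldr create (fun=> 1) fs.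

Variable lam : pred E -> R.

(** The multiple Poisson integral of the product of the tests fs, where lam is the
    intensity: each sum over a particle is compensated by its mean. *)
Definition wick fs : seq E -> R :=
  foldr (fun f F S => create f F S - lam f * F S) (fun=> 1) fs.

Definition perm_invariant F := forall S S', perm_eq S S' -> F S = F S'.

Lemma perm_eq_rem (S S' : seq E) e : perm_eq S S' -> perm_eq (rem e S) (rem e S').
Proof.
move=> pSS'; have [eS|eS] := boolP (e \in S); last first.
  by rewrite !rem_id // -(perm_mem pSS').
have eS' : e \in S' by rewrite -(perm_mem pSS').
rewrite -(perm_cons e) -(permPl (perm_to_rem eS)) (permPl pSS').
exact: perm_to_rem.
Qed.

Lemma create_perm f F : perm_invariant F -> perm_invariant (create f F).
Proof.
move=> pF S S' pSS'; rewrite /create (perm_big _ pSS') /=.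
by apply: eq_bigr => e _; rewrite (pF _ _ (perm_eq_rem e pSS')).
Qed.

Lemma wick_perm fs : perm_invariant (wick fs).
Proof.
elim: fs => [|f fs IH] //= S S' pSS'.
by rewrite (create_perm _ IH pSS') (IH _ _ pSS').
Qed.

Lemma create_cons f F e S : perm_invariant F ->
  create f F (e :: S) =
  (f e)%:R * F S + \sum_(x <- S) (f x)%:R * F (e :: rem x S).
Proof.
move=> pF; rewrite /create big_cons /= eqxx; congr (_ + _).
apply: eq_big_seq => x xS; congr (_ * _); apply: pF.
case: eqP => [->|_] //.
by apply: perm_to_rem.
Qed.

(** The discrete derivative of a multiple integral, for one particle e more. *)
Lemma wick_cons fs e S :
  wick fs (e :: S) = wick fs S +
    \sum_(i < size fs) (nth xpred0 fs i e)%:R * wick (delete_nth i fs) S.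
Proof.
elim: fs S => [|f fs IH] S; first by rewrite /= big_ord0 addr0.
rewrite /= big_ord_recl /= create_cons; last exact: wick_perm.
have -> : delete_nth 0 (f :: fs) = fs by rewrite /delete_nth /= drop0.
under [X in _ + X - _]eq_bigr do rewrite IH mulrDr.
rewrite big_split /= IH.
under [\sum_(x <- S) _ * (\sum_(i < _) _)]eq_bigr do rewrite mulr_sumr.
rewrite exchange_big /=.
set A := \sum_(x <- S) _; set B := \sum_(i < _) \sum_(x <- S) _.
set D := \sum_(i < _) _; set D' := \sum_(i < _) _.
suff -> : D' = B - lam f * D by rewrite -[create f (wick fs) S]/A; ring.
rewrite /D' /B /D mulr_sumr -sumrB; apply: eq_bigr => i _ /=.
rewrite /create -/(delete_nth i fs) mulrBr mulr_sumr; congr (_ - _); last by ring.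
by apply: eq_bigr => x _; rewrite /delete_nth; ring.
Qed.

(** A removed particle is put back in the second factor, which costs the discrete
    derivative of wick_cons. *)
Lemma create_mul_wick f F gs S :
  create f F S * wick gs S =
  create f (fun S' => F S' * wick gs S') S +
  \sum_(i < size gs)
    create (predI f (nth xpred0 gs i)) (fun S' => F S' * wick (delete_nth i gs) S') S.
Proof.
rewrite /create mulr_suml exchange_big /= -big_split /=.
apply: eq_big_seq => x xS.
rewrite (@wick_perm gs _ _ (perm_to_rem xS)) wick_cons mulrDr; congr (_ + _).
  by ring.
rewrite mulr_sumr; apply: eq_bigr => i _.
by case: (f x); case: (nth _ _ _ _) => /=; ring.
Qed.

Variable A : pred E -> Prop.
Hypothesis AI : forall f g, A f -> A (predI f g).

Fixpoint all_in fs : Prop := if fs is f :: fs' then A f /\ all_in fs' else True.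

(** Functionals on which the expectation is determined by the factorial moments. *)
Inductive factorial_span : (seq E -> R) -> Prop :=
| Span_ext F G : factorial_span F -> F =1 G -> factorial_span G
| Span_fact fs : all_in fs -> factorial_span (factorial_sum fs)
| Span_add F G : factorial_span F -> factorial_span G ->
    factorial_span (fun S => F S + G S)
| Span_scale c F : factorial_span F -> factorial_span (fun S => c * F S).

Lemma span_create f F : A f -> factorial_span F -> factorial_span (create f F).
Proof.
move=> Af; elim=> {F} [F G _ IH FG|fs Afs|F G _ IHF _ IHG|c F _ IHF].
- apply: (Span_ext IH) => S; rewrite /create; apply: eq_bigr => e _.
  by rewrite FG.
- by apply: (@Span_fact (f :: fs)).
- apply: (Span_ext (Span_add IHF IHG)) => S; rewrite /create -big_split /=.
  by apply: eq_bigr => e _; ring.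
- apply: (Span_ext (Span_scale c IHF)) => S; rewrite /create mulr_sumr /=.
  by apply: eq_bigr => e _; ring.
Qed.

Lemma span_sum n (F : 'I_n -> seq E -> R) :
  (forall i, factorial_span (F i)) ->
  factorial_span (fun S => \sum_(i < n) F i S).
Proof.
elim: n F => [|n IH] F spF.
  have h : factorial_span (fun S => 0 * factorial_sum [::] S).
    by apply: Span_scale; apply: Span_fact.
  by apply: (Span_ext h) => S; rewrite big_ord0 mul0r.
have h := Span_add (spF ord0) (IH _ (fun i => spF (lift ord0 i))).
by apply: (Span_ext h) => S; rewrite big_ord_recl.
Qed.

Lemma all_in_drop i fs : all_in fs -> all_in (delete_nth i fs).
Proof.
elim: fs i => [|f fs IH] [|i] //=; first by rewrite /delete_nth /= drop0 => -[].
by move=> [Af /(IH i)].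
Qed.

Lemma span_wick fs : all_in fs -> factorial_span (wick fs).
Proof.
elim: fs => [|f fs IH] /=; first by move=> _; apply: (@Span_fact [::]).
move=> [Af /IH h].
apply: (Span_ext (Span_add (span_create Af h) (Span_scale (- lam f) h))) => S.
by rewrite mulNr.
Qed.

Lemma span_wick_mul fs gs : all_in fs -> all_in gs ->
  factorial_span (fun S => wick fs S * wick gs S).
Proof.
elim: fs gs => [|f fs IH] gs /=.
  by move=> _ /span_wick h; apply: (Span_ext h) => S; rewrite mul1r.
move=> [Af Afs] Ags.
have h1 := span_create Af (IH _ Afs Ags).
have h2 := span_sum (fun i : 'I_(size gs) =>
  span_create (AI (nth xpred0 gs i) Af) (IH _ Afs (all_in_drop i Ags))).
have h3 := Span_scale (- lam f) (IH _ Afs Ags).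
apply: (Span_ext (Span_add (Span_add h1 h2) h3)) => S /=.
by rewrite mulrBl create_mul_wick; ring.
Qed.

Variable L : (seq E -> R) -> R.
Hypothesis L_ext : forall F G, F =1 G -> L F = L G.
Hypothesis L_add : forall F G, factorial_span F -> factorial_span G ->
  L (fun S => F S + G S) = L F + L G.
Hypothesis L_scale : forall c F, factorial_span F ->
  L (fun S => c * F S) = c * L F.
Hypothesis L_fact : forall fs, all_in fs ->
  L (factorial_sum fs) = \prod_(f <- fs) lam f.

(** Creation adds one test to a factorial sum, hence one factor to its moment. *)
Lemma mecke f F : A f -> factorial_span F -> L (create f F) = lam f * L F.
Proof.
move=> Af; elim=> {F} [F G spF IH FG|fs Afs|F G spF IHF spG IHG|c F spF IHF].
- rewrite -(L_ext FG) -IH; apply: L_ext => S.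
  by rewrite /create; apply: eq_bigr => e _; rewrite FG.
- by rewrite (L_fact Afs) (@L_fact (f :: fs)) ?big_cons.
- rewrite (L_add spF spG) mulrDr -IHF -IHG.
  rewrite -(L_add (span_create Af spF) (span_create Af spG)).
  by apply: L_ext => S; rewrite /create -big_split; apply: eq_bigr => e _ /=; ring.
- rewrite (L_scale _ spF) mulrCA -IHF -(L_scale _ (span_create Af spF)).
  by apply: L_ext => S; rewrite /create mulr_sumr; apply: eq_bigr => e _ /=; ring.
Qed.

Lemma L_sum n (F : 'I_n -> seq E -> R) :
  (forall i, factorial_span (F i)) ->
  L (fun S => \sum_(i < n) F i S) = \sum_(i < n) L (F i).
Proof.
elim: n F => [|n IH] F spF.
  rewrite big_ord0; transitivity (0 * L (factorial_sum [::])); last exact: mul0r.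
  rewrite -L_scale; last exact: Span_fact.
  by apply: L_ext => S; rewrite big_ord0 mul0r.
rewrite big_ord_recl -IH // -L_add //; last exact: span_sum.
by apply: L_ext => S; rewrite big_ord_recl.
Qed.

(** The compensation cancels the part of create_mul_wick where the particle
    counted by f is not counted by gs. *)
Lemma wick_covariance_cons f fs gs : A f -> all_in fs -> all_in gs ->
  L (fun S => wick (f :: fs) S * wick gs S) =
  \sum_(i < size gs) lam (predI f (nth xpred0 gs i)) *
     L (fun S => wick fs S * wick (delete_nth i gs) S).
Proof.
move=> Af Afs Ags.
have sp := span_wick_mul Afs Ags.
have spi i := span_wick_mul Afs (all_in_drop i Ags).
rewrite (L_ext (G := fun S => (create f (fun S' => wick fs S' * wick gs S') S +
  \sum_(i < size gs) create (predI f (nth xpred0 gs i))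
     (fun S' => wick fs S' * wick (delete_nth i gs) S') S) +
   (- lam f) * (wick fs S * wick gs S))); last first.
  by move=> S /=; rewrite mulrBl create_mul_wick; ring.
have spc i := span_create (AI (nth xpred0 gs i) Af) (spi i).
rewrite L_add; last 2 first.
- by apply: Span_add; [apply: span_create|apply: span_sum].
- exact: Span_scale.
rewrite L_add; last 2 first.
- exact: span_create.
- exact: span_sum.
rewrite L_scale // mecke // L_sum // mulNr addrAC addrN add0r.
by apply: eq_bigr => i _; rewrite mecke //; exact: AI.
Qed.

Lemma wick_mean gs : all_in gs -> (0 < size gs)%N -> L (wick gs) = 0.
Proof.
case: gs => // g gs [Ag Ags] _ /=.
rewrite (L_ext (G := fun S => create g (wick gs) S + (- lam g) * wick gs S));
  last by move=> S; rewrite mulNr.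
have sp := span_wick Ags.
rewrite L_add; [|exact: span_create|exact: Span_scale].
by rewrite L_scale // mecke //; ring.
Qed.

(** Wick's formula for multiple Poisson integrals. *)
Lemma wick_covariance fs gs : all_in fs -> all_in gs ->
  L (fun S => wick fs S * wick gs S) =
  permanent (fun f g => lam (predI f g)) fs gs.
Proof.
elim: fs gs => [|f fs IH] gs Afs Ags.
  rewrite (L_ext (G := wick gs)); last by move=> S; rewrite mul1r.
  case: gs Ags => [|g gs] Ags; last by rewrite wick_mean.
  by rewrite (@L_fact [::]) // big_nil.
case: Afs => Af Afs; rewrite wick_covariance_cons //=.
apply: eq_bigr => i _; rewrite IH //; last exact: all_in_drop.
by rewrite (set_nth_default xpred0).
Qed.

End FactorialFunctionals.


Lemma size_delete_nth T i (s : seq T) : (i < size s)%N ->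
  size (delete_nth i s) = (size s).-1.
Proof.
move=> h; rewrite size_cat size_take size_drop h.
by case: (size s) h => // n h; rewrite subSS subnKC.
Qed.

Lemma delete_nth_map T T' (u : T -> T') i s :
  delete_nth i (map u s) = map u (delete_nth i s).
Proof. by rewrite /delete_nth map_cat map_take map_drop. Qed.

Lemma permanent_map (R : comNzRingType) (S S' : Type) (M : S' -> S' -> R)
    (u v : S -> S') xs ys :
  permanent M (map u xs) (map v ys) = permanent (fun x y => M (u x) (v y)) xs ys.
Proof.
elim: xs ys => [|x xs IH] ys /=; first by rewrite size_map.
rewrite size_map; apply: eq_bigr => i _; rewrite delete_nth_map IH.
by congr (M _ _ * _); rewrite (nth_map x).
Qed.

(** * Charlier polynomials *)

Section Charlier.
Context {R : realType}.

Lemma charlier0 (r : R) m : charlier r 0 m = 1.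
Proof. by rewrite /charlier big_ord1 bin0 subnn expr0 ffactn0 !mulr1. Qed.

(** Follows from Pascal's rule, and matches one step of the recursion of wick. *)
Lemma charlierS (r : R) n m :
  charlier r n.+1 m = m%:R * charlier r n m.-1 - r * charlier r n m.
Proof.
rewrite /charlier big_ord_recl /= bin0 subn0.
under eq_bigr => i _.
  rewrite /bump /= add1n binS natrD !mulrDl subSS.
  over.
rewrite big_split /= addrA addrC; congr (_ + _).
  rewrite mulr_sumr; apply: eq_bigr => i _.
  by rewrite ffactnS natrM; ring.
rewrite [in RHS]big_ord_recl /= bin0 subn0 mulrDr opprD; congr (_ + _).
  by rewrite exprS; ring.
rewrite big_ord_recr /= bin_small // !mul0r addr0 mulr_sumr -sumrN.
apply: eq_bigr => i _; rewrite /bump /= add1n.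
have -> : (n - i = (n - i.+1).+1)%N by have := ltn_ord i; lia.
by rewrite exprS; ring.
Qed.

Context {d : nat}.
Implicit Types (r : Zd d -> R) (xs : seq (Zd d)) (eta : configuration d).

(** The duality polynomial of the configuration with particles at xs. *)
Definition charlier_prod r xs eta : R :=
  \prod_(x <- undup xs) charlier (r x) (count_mem x xs) (eta x).

Lemma dualityE r k (x : k.-tuple (Zd d)) eta :
  duality r (config_of x) eta = charlier_prod r x eta.
Proof.
rewrite /duality (fsbigTE [fset y in (x : seq _)]%fset); last first.
  move=> y; rewrite in_fset => yx; rewrite /config_of.
  by rewrite (count_memPn yx) charlier0.
apply: perm_big; apply: uniq_perm; rewrite ?fset_uniq ?undup_uniq //.
by move=> y; rewrite in_fset mem_undup.
Qed.

Lemma charlier_prod_cons r x xs eta :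
  charlier_prod r (x :: xs) eta =
  (eta x)%:R * charlier_prod r xs (fun y => eta y - (y == x))%N - r x * charlier_prod r xs eta.
Proof.
rewrite /charlier_prod /=; case: (boolP (x \in xs)) => xxs.
  rewrite !(bigD1_seq x) ?undup_uniq ?mem_undup //= eqxx add1n subn1 charlierS.
  set A := \prod_(i <- undup xs | i != x) _.
  set B := \prod_(i <- undup xs | i != x) _.
  set C := \prod_(i <- undup xs | i != x) _.
  have -> : A = C by apply: eq_bigr => y /negbTE yx; rewrite eq_sym yx.
  have -> : B = C by apply: eq_bigr => y /negbTE yx; rewrite yx subn0.
  by ring.
rewrite big_cons eqxx (count_memPn xxs) addn0 charlierS !charlier0 !mulr1.
set A := \prod_(i <- undup xs) _.
set B := \prod_(i <- undup xs) _.
set C := \prod_(i <- undup xs) _.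
have h y : y \in undup xs -> (y == x) = false.
  by rewrite mem_undup; case: eqP => // ->; rewrite (negbTE xxs).
have -> : A = C by apply: eq_big_seq => y /h yx; rewrite eq_sym yx.
have -> : B = C by apply: eq_big_seq => y /h yx; rewrite yx subn0.
by rewrite mulrBl.
Qed.

Lemma charlier_prod_ext r xs eta eta' : (forall x, x \in xs -> eta x = eta' x) ->
  charlier_prod r xs eta = charlier_prod r xs eta'.
Proof.
by move=> h; apply: eq_big_seq => x; rewrite mem_undup => /h ->.
Qed.

(** Charlier polynomials are compensated falling factorials, and the falling
    factorials of occupation numbers count tuples of distinct particles. *)
Lemma wick_charlier (E : eqType) (u : E -> Zd d) (lam : pred E -> R) r xs (S : seq E) :
  (forall x, x \in xs -> lam (fun e => u e == x) = r x) ->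
  wick lam [seq (fun e => u e == x) | x <- xs] S =
  charlier_prod r xs (fun y => count (fun e => u e == y) S).
Proof.
elim: xs S => [|x xs IH] S hl; first by rewrite /charlier_prod big_nil.
have {}IH S' := IH S' (fun y h => hl y (mem_behead (s := x :: xs) h)).
rewrite /= hl ?mem_head // charlier_prod_cons IH; congr (_ - _).
rewrite /create (eq_big_seq (fun e => (u e == x)%:R * charlier_prod r xs
   (fun y => (count (fun e => u e == y) S - (y == x))%N))).
  rewrite -mulr_suml; congr (_ * _).
  by rewrite -natr_sum -sum1_count [in RHS]big_mkcond; congr (_%:R); apply: eq_bigr => e _; case: (_ == _).
move=> e eS; rewrite IH; case: eqP => [ex|_]; last by rewrite !mul0r.
congr (_ * _); apply: charlier_prod_ext => y _.
by rewrite count_rem eS /= ex eq_sym.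
Qed.

End Charlier.

Section FactorialLists.
Context {R : realType}.

Lemma factorial_sum_ge0 (E : eqType) (fs : seq (pred E)) S :
  0 <= factorial_sum R fs S.
Proof.
elim: fs S => [|f fs IH] S /=; first exact: ler01.
by apply: sumr_ge0 => e _; rewrite mulr_ge0.
Qed.

Lemma factorial_sum_perm (E : eqType) (fs : seq (pred E)) :
  perm_invariant (factorial_sum R fs).
Proof. by elim: fs => [|f fs IH] //=; exact: create_perm. Qed.

Lemma factorial_sum_map (Q E : eqType) (u : Q -> E) (fs : seq (pred E)) (L : seq Q) :
  factorial_sum R fs (map u L) =
  factorial_sum R [seq (fun q => f (u q)) | f <- fs] L.
Proof.
elim: fs L => [|f fs IH] L //=.
rewrite /create big_map; apply: eq_big_seq => q qL; congr (_ * _).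
rewrite -IH; apply: factorial_sum_perm.
rewrite -(perm_cons (u q)); apply: (@perm_trans _ (map u L)).
  by rewrite perm_sym perm_to_rem // map_f.
by rewrite -[u q :: _]/(map u (q :: rem q L)); apply/perm_map/perm_to_rem.
Qed.

(** The recursive removal of particles, made into one sum over lists of labels. *)
Lemma esum_factorial_sum (Q : choiceType) (gs : seq (pred Q)) (L : seq Q) : uniq L ->
  \esum_(qs in [set qs | size qs = size gs])
   (uniq qs && (all [in L] qs && all2 (fun g q => g q) gs qs))%:R%:E =
  (factorial_sum R gs L)%:E.
Proof.
elim: gs L => [|g gs IH] L uL.
  have -> : [set xs : seq Q | size xs = size (Nil (pred Q))] = [set [::]].
    by apply/seteqP; split => [ks /size0nil ->|_ ->].
  by rewrite esum_set1.
rewrite [size _]/= esum_seqS //.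
transitivity (\esum_(q in [set: Q]) (((q \in L) && g q)%:R%:E * (factorial_sum R gs (rem q L))%:E)%E).
  apply: eq_esum => q _; rewrite -IH ?rem_uniq // -esumZl //.
  apply: eq_esum => qs _; rewrite -EFinM -natrM mulnb; congr ((nat_of_bool _)%:R%:E) => /=.
  have -> : all [in rem q L] qs = (q \notin qs) && all [in L] qs.
    elim: qs => //= q' qs ->; rewrite mem_rem_uniq // !inE negb_or.
    by rewrite [q' == q]eq_sym andbACA.
  by case: (q \in L); case: (g q); case: (q \notin qs); case: (uniq qs); case: (all _ _); case: (all2 _ _ _).
rewrite (@esum_uniq_supp _ _ _ L) //.
- rewrite -sumEFin /create; apply: eq_big_seq => q qL.
  by rewrite -EFinM qL.
- by move=> q; rewrite -EFinM lee_fin mulr_ge0 // factorial_sum_ge0.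
- by move=> q /negbTE ->; rewrite mul0e.
Qed.

End FactorialLists.

(** * Factorial moments of the initial configuration *)

Section CountableMeasurability.
Context {disp : measure_display} {T : measurableType disp}.

(** All observations below have countably many values, so that measurability need
    only be checked on singletons. *)
Lemma measurable_countable_pre (C : countType) (X : T -> C) :
  (forall c, measurable [set w | X w = c]) ->
  forall Q : C -> Prop, measurable [set w | Q (X w)].
Proof.
move=> mX Q.
have -> : [set w | Q (X w)] = \bigcup_c [set w | X w = c /\ Q c].
  by apply/seteqP; split => [w /= Qw|w [c _ [/= e Qc]]]; [exists (X w)|rewrite /= e].
apply: countable_bigcupT_measurable => // c.
have [Qc|Qc] := pselect (Q c).
  by rewrite [X in measurable X](_ : _ = [set w | X w = c]) //; apply/seteqP; split => w // [].
by rewrite [X in measurable X](_ : _ = set0) //; apply/seteqP; split => w // [].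
Qed.

Lemma measurable_seq_pre (I : Type) (C : countType) (X : I -> T -> C) (s : seq I) :
  (forall i c, measurable [set w | X i w = c]) ->
  forall cs, measurable [set w | [seq X i w | i <- s] = cs].
Proof.
move=> mX; elim: s => [|i s IH] [|c cs] /=.
- by rewrite [X in measurable X](_ : _ = setT) //; apply/seteqP.
- by rewrite [X in measurable X](_ : _ = set0) //; apply/seteqP; split.
- by rewrite [X in measurable X](_ : _ = set0) //; apply/seteqP; split.
- rewrite [X in measurable X](_ : _ = [set w | X i w = c] `&` [set w | [seq X i w | i <- s] = cs]).
    exact: measurableI.
  by apply/seteqP; split => w /= [h1 h2]; [split|rewrite h1 h2].
Qed.

Lemma measurable_fun_countable d' (U : measurableType d') (C : countType)
   (X : T -> C) (F : C -> U) :
  (forall c, measurable [set w | X w = c]) ->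
  measurable_fun [set: T] (fun w => F (X w)).
Proof.
by move=> mX _ B mB; rewrite setTI; exact: (measurable_countable_pre mX (fun c => B (F c))).
Qed.

End CountableMeasurability.

(** Stated for a generated sigma-algebra, since mutual independence is a property
    of these. *)
Lemma sigma_countable_pre (T : pointedType) (G : set (set T)) (I : Type) (C : countType)
    (X : I -> T -> C) (s : seq I) (Q : seq C -> Prop) :
  (forall i c, <<s G >> [set w | X i w = c]) ->
  <<s G >> [set w | Q [seq X i w | i <- s]].
Proof.
move=> h.
have mX i c : @measurable _ (g_sigma_algebraType G) [set w | X i w = c] by exact: h.
exact: (@measurable_countable_pre _ (g_sigma_algebraType G) _ (fun w => [seq X i w | i <- s])
  (fun cs => @measurable_seq_pre _ (g_sigma_algebraType G) _ _ X s mX cs) Q).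
Qed.

Section Independence.
Context {R : realType} {d : nat}.
Context {disp : measure_display} {Omega : measurableType disp}.
Variables (P : probability Omega R) (r : Zd d -> R).
Hypothesis r0 : forall x, 0 < r x.

Variable eta0 : Omega -> configuration d.
Hypothesis meta0 : forall x m, measurable [set w | eta0 w x = m].
Hypothesis poisson_eta0 : product_poisson r P eta0.

Lemma prob_sites (ys : seq (Zd d)) (m : Zd d -> nat) : uniq ys ->
  P [set w | forall y, y \in ys -> eta0 w y = m y] =
  (\prod_(y <- ys) poisson_pmf (r y) (m y))%:E.
Proof.
move=> uy; have [hpmf hind] := poisson_eta0.
have := hind [fset y in ys]%fset (fun y => [set w | eta0 w y = m y]).
have pe : perm_eq (enum_fset [fset y in ys]%fset) ys.
  by apply: uniq_perm; rewrite ?fset_uniq // => y; rewrite in_fset.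
rewrite (perm_big _ pe) /=.
under eq_bigr do rewrite hpmf.
rewrite prodEFin => <-.
  congr (P _); apply/seteqP; split => w /= h y; first by rewrite /= in_fset => /h.
  by move=> yy; apply: h; rewrite /= in_fset.
by move=> y _; apply: sub_sigma_algebra; exists (m y).
Qed.

Lemma esum_ffact (mu : R) c : 0 < mu ->
  \esum_(m in [set: nat]) ((m ^_ c)%:R * poisson_pmf mu m)%:E = (mu ^+ c)%:E.
Proof.
move=> mu0; rewrite /poisson_pmf mu0.
transitivity (\esum_(m in [set m | (c <= m)%N]) ((m ^_ c)%:R * (mu ^+ m * m`!%:R^-1 * expR (- mu)))%:E).
  rewrite [RHS]esum_asbool; apply: eq_esum => m _.
  by case: asboolP => //= /negP; rewrite -ltnNge => h; rewrite ffact_small // mul0r.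
rewrite (@reindex_esum R _ _ [set: nat] [set m | (c <= m)%N] (addn^~ c)); last first.
  split; first by move=> m _ /=; rewrite leq_addl.
    by move=> a b _ _ /addIn.
  by move=> n /= kn; exists (n - c)%N => //; rewrite subnK.
transitivity (\esum_(m in [set: nat]) ((mu ^+ c * expR (- mu))%:E * (mu ^+ m / m`!%:R)%:E)%E).
  apply: eq_esum => m _; rewrite -EFinM; congr EFin.
  have := ffact_fact (leq_addl m c); rewrite addnK => h.
  have h1 : (m`!%:R != 0 :> R) by rewrite pnatr_eq0 -lt0n fact_gt0.
  have h2 : ((m + c) ^_ c)%:R != 0 :> R by rewrite pnatr_eq0 -lt0n ffact_gt0 leq_addl.
  by rewrite -h natrM exprD; field; rewrite h1 h2.
rewrite esumZl; last 2 first.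
- by rewrite mulr_ge0 ?expR_ge0 // exprn_ge0 // ltW.
- by move=> m; rewrite lee_fin divr_ge0 // exprn_ge0 // ltW.
rewrite esum_exp; last exact: ltW.
by rewrite -EFinM -mulrA -expRD addNr expR0 mulr1.
Qed.

Lemma measurable_eta0_fun (xs : seq (Zd d)) d' (U : measurableType d')
    (F : seq nat -> U) :
  measurable_fun [set: Omega] (fun w => F [seq eta0 w x | x <- xs]).
Proof.
apply: (measurable_fun_countable (X := fun w => [seq eta0 w x | x <- xs])).
exact: (measurable_seq_pre (X := fun x w => eta0 w x)).
Qed.

Lemma measurable_sites_term (ys xs : seq (Zd d)) (m c : Zd d -> nat) :
  measurable_fun [set: Omega] (fun w => (all (fun y => eta0 w y == m y) ys)%:R *
     \prod_(x <- xs) ((eta0 w x) ^_ (c x))%:R : R).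
Proof.
pose F := fun cs : seq nat => ((all2 eq_op (take (size ys) cs) [seq m y | y <- ys])%:R *
     \prod_(i < size xs) (nth 0%N (drop (size ys) cs) i ^_ c (nth 0 xs i))%:R) : R.
rewrite (_ : (fun _ => _) = fun w => F [seq eta0 w y | y <- ys ++ xs]).
  exact: measurable_eta0_fun.
apply/funext => w; rewrite /F map_cat.
have sz : size ys = size [seq eta0 w i | i <- ys] by rewrite size_map.
rewrite sz take_size_cat // drop_size_cat //; congr ((nat_of_bool _)%:R * _).
  by elim: (ys) => //= y l <-.
rewrite (big_nth 0) big_mkord; apply: eq_bigr => i _.
by rewrite (nth_map 0).
Qed.

(** The factors are replaced one by one by their expansions over the values of
    eta0, which moves their sites from xs to the list ys of prescribed values. *)
Lemma expect_sites (ys xs : seq (Zd d)) (m c : Zd d -> nat) : uniq (ys ++ xs) ->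
  (\int[P]_w ((all (fun y => eta0 w y == m y) ys)%:R *
     \prod_(x <- xs) ((eta0 w x) ^_ (c x))%:R)%:E =
  (\prod_(y <- ys) poisson_pmf (r y) (m y) * \prod_(x <- xs) r x ^+ c x)%:E)%E.
Proof.
elim: xs ys m => [|x xs IH] ys m uy.
  under eq_integral do rewrite big_nil mulr1.
  rewrite big_nil mulr1 -prob_sites; last by rewrite cats0 in uy.
  rewrite -[X in P X]setIT -integral_indic //; last first.
    rewrite [X in measurable X](_ : _ = [set w | [seq eta0 w y | y <- ys] = [seq m y | y <- ys]]).
      exact: (measurable_seq_pre (X := fun x w => eta0 w x)).
    by apply/seteqP; split => w /= /eq_in_map.
  apply: eq_integral => w _; rewrite indicE; congr ((_ : bool)%:R%:E).
  apply/allP/idP => [h|]; first by rewrite inE => y /h /eqP.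
  by rewrite inE /= => h y /h /eqP.
(* The value at x is now prescribed to be k. *)
pose m' k := fun y => if y == x then k else m y.
have [xys uyx] : x \notin ys /\ uniq (rcons ys x ++ xs).
  rewrite cat_rcons; split => //; move: uy; rewrite cat_uniq => /and3P[_ /hasPn h _].
  by apply: h; rewrite mem_head.
transitivity (\int[P]_w \esum_(k in [set: nat]) ((k ^_ (c x))%:R *
   ((all (fun y => eta0 w y == m' k y) (rcons ys x))%:R *
     \prod_(x <- xs) ((eta0 w x) ^_ (c x))%:R))%:E)%E.
  apply: eq_integral => w _.
  rewrite (@esum_uniq_supp _ _ _ [:: eta0 w x]) //.
  - rewrite big_seq1 big_cons; congr EFin.
    rewrite [in RHS]all_rcons /m' eqxx eqxx /= mulrCA; congr (_ * (_%:R * _)); congr (nat_of_bool _).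
    by apply: eq_in_all => y yy; have [yx|//] := eqVneq y x; case/negP: xys; rewrite -yx.
  - by move=> k; rewrite lee_fin !mulr_ge0 // prodr_ge0.
  - move=> k; rewrite inE all_rcons /m' eqxx eq_sym => /negbTE ->.
    by rewrite mul0r mulr0.
rewrite integral_esum; last 2 first.
- move=> k; apply/measurable_EFinP/measurable_funM => //.
  exact: measurable_sites_term.
- by move=> k w; rewrite lee_fin !mulr_ge0 // prodr_ge0.
transitivity (\esum_(k in [set: nat]) ((\prod_(y <- ys) poisson_pmf (r y) (m y) * \prod_(x <- xs) r x ^+ c x)%:E *
    ((k ^_ c x)%:R * poisson_pmf (r x) k)%:E))%E.
  apply: eq_esum => k _.
  under eq_integral do rewrite EFinM.
  rewrite ge0_integralZl //; last 2 first.
  - exact/measurable_EFinP/measurable_sites_term.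
  - by move=> w _; rewrite lee_fin !mulr_ge0 // prodr_ge0.
  rewrite IH // -!EFinM; congr EFin; rewrite -cats1 big_cat big_seq1 /= {2}/m' eqxx.
  rewrite (@eq_big_seq _ _ _ _ ys _ (fun y => poisson_pmf (r y) (m y))); last first.
    by move=> y yy; rewrite /m'; have [yx|//] := eqVneq y x; case/negP: xys; rewrite -yx.
  by ring.
rewrite esumZl; last 2 first.
- by rewrite mulr_ge0 ?prodr_ge0 // => y _; rewrite ?poisson_pmf_ge0 ?exprn_ge0 // ltW.
- by move=> k; rewrite lee_fin mulr_ge0 // poisson_pmf_ge0.
rewrite esum_ffact // -EFinM big_cons; congr EFin; ring.
Qed.

End Independence.

Section Labels.
Context {R : realType} {d : nat}.
Local Notation Q := (Zd d * nat)%type.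
Variable eta : configuration d.

Definition alive (q : Q) : bool := (q.2 < eta q.1)%N.

(** The labels of the particles of one site are consecutive, so that counting free
    labels means removing those that are in use. *)
Lemma esum_free_labels (x : Zd d) (zs : seq Q) : uniq zs -> all alive zs ->
  \esum_(l in [set: nat]) (alive (x, l) && ((x, l) \notin zs))%:R%:E =
  (eta x - count (fun q => q.1 == x) zs)%:R%:E :> \bar R.
Proof.
move=> uz az.
rewrite (@esum_uniq_supp _ _ _ (iota 0 (eta x))) ?iota_uniq //; last first.
  by move=> l; rewrite mem_iota /= add0n /alive /= => /negbTE ->.
rewrite sumEFin -natr_sum; congr (_%:R%:E).
transitivity (count (fun l => (x, l) \notin zs) (iota 0 (eta x))).
  rewrite -sum1_count [RHS]big_mkcond; apply: eq_big_seq => l.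
  by rewrite mem_iota /= add0n /alive /= => ->; case: (_ \notin _).
have := count_predC (fun l => (x, l) \in zs) (iota 0 (eta x)); rewrite size_iota.
have -> : count (fun l => (x, l) \in zs) (iota 0 (eta x)) = count (fun q => q.1 == x) zs.
  rewrite -!size_filter -(size_map (fun l => (x, l))); apply: perm_size; apply: uniq_perm.
  - by rewrite map_inj_uniq ?filter_uniq ?iota_uniq // => a b [].
  - by rewrite filter_uniq.
  - move=> [y l]; rewrite mem_filter /=; apply/mapP/idP => [[l' + [-> ->]]|].
      by rewrite mem_filter eqxx => /andP[].
    case/andP => /eqP -> h; exists l => //; rewrite mem_filter h mem_iota /= add0n.
    exact: (allP az _ h).
by move=> h; rewrite -[in RHS]h addKn.
Qed.

(** Choosing labels for sites with repetitions gives falling factorials. *)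
Lemma esum_labels (xs : seq (Zd d)) :
  \esum_(ls in [set ls | size ls = size xs])
    (uniq (zip xs ls) && all alive (zip xs ls))%:R%:E =
  (\prod_(x <- undup xs) eta x ^_ (count_mem x xs))%:R%:E :> \bar R.
Proof.
elim: xs => [|x xs IH].
  have -> : [set ls : seq nat | size ls = size (Nil (Zd d))] = [set [::]].
    by apply/seteqP; split => [ks /size0nil ->|_ ->].
  by rewrite esum_set1 //= big_nil.
rewrite [size _]/= esum_seqS //.
rewrite esum_asbool.
transitivity (\esum_(ls in [set ls | size ls = size xs])
  ((uniq (zip xs ls) && all alive (zip xs ls))%:R%:E * (eta x - count_mem x xs)%:R%:E)%E : \bar R).
  transitivity (\esum_(l in [set: nat]) \esum_(ls in [set: seq nat])
     (if `[< [set ls | size ls = size xs] ls >] then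
      ((uniq (zip xs ls) && all alive (zip xs ls))%:R%:E * (alive (x, l) && ((x, l) \notin zip xs ls))%:R%:E)%E else 0) : \bar R).
    apply: eq_esum => l _; rewrite asboolT // esum_asbool; apply: eq_esum => ls _.
    case: asboolP => // _; rewrite /= -EFinM -natrM mulnb; congr ((nat_of_bool _)%:R%:E).
    by do ! case: (_ \in _) => //=; do ! case: (uniq _) => //=; case: (alive _) => //=; rewrite ?andbF ?andbT.
  rewrite esum_swap; last first.
    by move=> l ls; case: ifP => // _; rewrite -EFinM lee_fin mulr_ge0.
  rewrite [RHS]esum_asbool; apply: eq_esum => ls _.
  case: asboolP => [/= sls|_]; last exact: esum1.
  rewrite esumZl //.
  case: (boolP (uniq _ && _)) => [/andP[uz az]|_]; last by rewrite !mul0e.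
  rewrite esum_free_labels // !mul1e; congr ((_ - _)%:R%:E).
  have -> : count (fun q : Q => q.1 == x) (zip xs ls) = count (pred1 x) (unzip1 (zip xs ls)).
    by rewrite count_map.
  by rewrite unzip1_zip // sls.
under eq_esum do rewrite muleC.
rewrite esumZl // IH -EFinM -natrM; congr (_%:R%:E).
rewrite /=; case: (boolP (x \in xs)) => xxs.
  rewrite (bigD1_seq x) ?undup_uniq ?mem_undup //=.
  rewrite [RHS](bigD1_seq x) ?undup_uniq ?mem_undup //= eqxx add1n ffactnSr.
  rewrite mulnA [X in (X * _ = _)%N]mulnC; congr (_ * _)%N.
  by apply: eq_bigr => y /negbTE yx; rewrite eq_sym yx.
rewrite big_cons eqxx (count_memPn xxs) addn0 ffactn1 subn0; congr (_ * _)%N.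
apply: eq_big_seq => y; rewrite mem_undup => yxs.
by case: eqP => // xy; rewrite -xy (negbTE xxs) in yxs.
Qed.

End Labels.

Section AliveMoments.
Context {R : realType} {d : nat}.
Context {disp : measure_display} {Omega : measurableType disp}.
Variables (P : probability Omega R) (r : Zd d -> R).
Hypothesis r0 : forall x, 0 < r x.
Local Notation Q := (Zd d * nat)%type.
Variable eta0 : Omega -> configuration d.
Hypothesis meta0 : forall x m, measurable [set w | eta0 w x = m].
Hypothesis poisson_eta0 : product_poisson r P eta0.

Lemma all_alive_pre (qs : seq Q) :
  [set w | all (alive (eta0 w)) qs] =
  [set w | (fun cs => all2 (fun q c => (q.2 < c)%N) qs cs : Prop) [seq eta0 w q.1 | q <- qs]].
Proof.
apply/funext => w /=; congr is_true.
by elim: qs => //= q qs ->.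
Qed.

Lemma measurable_all_alive (qs : seq Q) : measurable [set w | all (alive (eta0 w)) qs].
Proof.
rewrite all_alive_pre.
apply: (measurable_countable_pre (X := fun w => [seq eta0 w q.1 | q <- qs])
   _ (fun cs => all2 (fun (q : Q) c => (q.2 < c)%N) qs cs)).
exact: (measurable_seq_pre (X := fun (q : Q) w => eta0 w q.1)).
Qed.

Lemma sigma_all_alive (qs : seq Q) : sigma_config eta0 [set w | all (alive (eta0 w)) qs].
Proof.
rewrite all_alive_pre.
apply: (@sigma_countable_pre Omega
  [set A | exists x m, A = [set w | eta0 w x = m]] Q nat (fun q w => eta0 w q.1) qs
  (fun cs => all2 (fun (q : Q) c => (q.2 < c)%N) qs cs)) => q c.
by apply: sub_sigma_algebra; exists q.1, c.
Qed.

(** The mean number of ways to label the sites of xs, which is a factorial moment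
    of the Poisson configuration. *)
Lemma esum_prob_alive (xs : seq (Zd d)) :
  \esum_(ls in [set ls | size ls = size xs])
    ((uniq (zip xs ls))%:R%:E * P [set w | all (alive (eta0 w)) (zip xs ls)])%E =
  (\prod_(x <- xs) r x)%:E.
Proof.
transitivity (\int[P]_w \esum_(ls in [set ls | size ls = size xs])
    (uniq (zip xs ls) && all (alive (eta0 w)) (zip xs ls))%:R%:E)%E.
  under eq_integral do rewrite esum_asbool.
  rewrite integral_esum.
  - rewrite [LHS]esum_asbool; apply: eq_esum => ls _; case: asboolP => _; last first.
      by rewrite integral0.
    case: (uniq _) => /=; last by rewrite mul0e integral0.
    rewrite mul1e -[X in P X]setIT -integral_indic //; last exact: measurable_all_alive.
    apply: eq_integral => w _; rewrite indicE; congr ((_ : bool)%:R%:E).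
    by apply/idP/idP; rewrite inE.
  - move=> ls; case: asboolP => _ //; apply/measurable_EFinP.
    apply: (measurable_fun_countable (X := fun w => all (alive (eta0 w)) (zip xs ls)) (fun b : bool => (uniq (zip xs ls) && b)%:R : R)).
    move=> b; case: b.
      exact: measurable_all_alive.
    rewrite (_ : [set w | _] = ~` [set w | all (alive (eta0 w)) (zip xs ls)]).
      exact/measurableC/measurable_all_alive.
    by apply/seteqP; split => w /=; [move=> ->|move/negP/negbTE].
  - by move=> ls w; case: asboolP.
under eq_integral do rewrite esum_labels.
transitivity ((\prod_(y <- [::]) poisson_pmf (r y) 0%N * \prod_(x <- undup xs) r x ^+ count_mem x xs)%:E).
  rewrite -(expect_sites r0 meta0 poisson_eta0 (fun=> 0%N) (fun x => count_mem x xs)) ?undup_uniq //.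
  by apply: eq_integral => w _; rewrite mul1r natr_prod.
by rewrite big_nil mul1r prodr_undup_exp_count.
Qed.

End AliveMoments.

(** * Factorial moments of the cloud of paths *)

Lemma esum_zip {R : realType} (A B : choiceType) n (F : seq (A * B) -> \bar R) :
  (forall s, (0 <= F s)%E) ->
  \esum_(qs in [set qs | size qs = n]) F qs =
  \esum_(xs in [set xs | size xs = n]) \esum_(ls in [set ls | size ls = n]) F (zip xs ls).
Proof.
move=> F0; rewrite esum_esum //.
rewrite (@reindex_esum R _ _ ([set xs : seq A | size xs = n] `*`` (fun=> [set ls : seq B | size ls = n])) _ (fun k => zip k.1 k.2)) //; split.
- by move=> [xs ls] [/= h1 h2]; rewrite size_zip h1 h2 minnn.
- move=> [xs ls] [xs' ls']; rewrite !inE => -[/= h1 h2] [/= h3 h4] e.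
  congr pair.
    by rewrite -(@unzip1_zip _ _ xs ls) ?h1 ?h2 // e unzip1_zip // h3 h4.
  by rewrite -(@unzip2_zip _ _ xs ls) ?h1 ?h2 // e unzip2_zip // h3 h4.
- move=> qs /= sq; exists (unzip1 qs, unzip2 qs); last exact: zip_unzip.
  by split; rewrite /= size_map.
Qed.

Section ZipIndex.
Variables (A : Type) (B : eqType).

Lemma prod_zip_index (R : comNzRingType) (h : A -> B -> R) f0 (fs : seq A) (qs : seq B) :
  uniq qs -> size fs = size qs ->
  \prod_(q <- qs) h (nth f0 fs (index q qs)) q = \prod_(fq <- zip fs qs) h fq.1 fq.2.
Proof.
move=> uq sq; case: qs uq sq => [|q0 qs0]; first by case: fs => //; rewrite !big_nil.
set qs := q0 :: qs0 => uq sq.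
rewrite (big_nth q0) (big_nth (f0, q0)) size_zip sq minnn !big_mkord.
by apply: eq_bigr => i _; rewrite nth_zip // index_uniq.
Qed.

Lemma all2_index (h : A -> B -> bool) f0 (fs : seq A) (qs : seq B) :
  uniq qs -> size fs = size qs ->
  all (fun q => h (nth f0 fs (index q qs)) q) qs = all2 h fs qs.
Proof.
elim: fs qs => [|f fs IH] [|q qs] //= /andP[qqs uq] [/(IH _ uq) <-].
rewrite eqxx /=; congr (_ && _); apply: eq_in_all => x xqs.
by case: eqP => // qx; rewrite qx xqs in qqs.
Qed.

End ZipIndex.

Section WalkIndependence.
Context {R : realType} {d : nat} {p : Zd d -> Zd d -> R} (hp : walk_kernel p).
Context {disp : measure_display} {Omega : measurableType disp}.
Variables (P : probability Omega R) (r : Zd d -> R).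
Hypothesis r0 : forall x, 0 < r x.
Local Notation Q := (Zd d * nat)%type.
Local Notation E := (Zd d * Zd d)%type.
Variable eta0 : Omega -> configuration d.
Hypothesis meta0 : forall x m, measurable [set w | eta0 w x = m].
Hypothesis poisson_eta0 : product_poisson r P eta0.
Variable Y : Q -> R -> Omega -> Zd d.
Hypothesis hY : forall q, random_walk p P q.1 (Y q).
Hypothesis hI : mutually_independent P (fun o : option Q =>
        if o is Some q then sigma_path (Y q) else sigma_config eta0).
Variables (s t : R).
Hypothesis s0 : 0 <= s.
Hypothesis st : s <= t.

Let t0 : 0 <= t. Proof. exact: le_trans st. Qed.

(** The walks are only observed at the two times s and t. *)
Definition place (q : Q) (w : Omega) : E := (Y q s w, Y q t w).

Lemma measurable_place q e : measurable [set w | place q w = e].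
Proof.
have [mY _] := hY q; case: e => a b.
rewrite (_ : [set w | _] = [set w | Y q s w = a] `&` [set w | Y q t w = b]).
  by apply: measurableI; apply: mY.
by apply/seteqP; split => w /=; [move=> [-> ->]|move=> [h1 h2]; rewrite /place h1 h2].
Qed.

Definition joint_law (x : Zd d) (e : E) : R := heat p s x e.1 * heat p (t - s) e.1 e.2.

Lemma joint_law_ge0 x e : 0 <= joint_law x e.
Proof. by rewrite mulr_ge0 // (heat_ge0 hp) // subr_ge0. Qed.

Lemma prob_place q e : P [set w | place q w = e] = (joint_law q.1 e)%:E.
Proof.
have [_ fdd] := hY q; case: e => a b.
have := fdd [:: (s, a); (t, b)]; rewrite /= s0 st => /(_ isT).
rewrite subr0 mulr1 => <-; congr (P _); apply/seteqP; split => w /=.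
  by move=> [h1 h2] u; rewrite !inE => /orP[] /eqP ->.
move=> h; rewrite /place.
by rewrite (h (s, a)) ?inE ?eqxx // (h (t, b)) ?inE ?eqxx ?orbT.
Qed.

Definition hit_prob (f : pred E) (x : Zd d) : R :=
  fine (\esum_(e in [set: E]) ((f e)%:R * joint_law x e)%:E).

Lemma prob_hit (f : pred E) q : P [set w | f (place q w)] = (hit_prob f q.1)%:E.
Proof.
have mf : measurable [set w | f (place q w)].
  exact: (measurable_countable_pre (measurable_place q) (fun e => f e)).
have PE : P [set w | f (place q w)] = \esum_(e in [set: E]) ((f e)%:R * joint_law q.1 e)%:E.
  rewrite -[X in P X]setIT -integral_indic //.
  transitivity (\int[P]_w \esum_(e in [set: E]) (((f e)%:R)%:E * (\1_[set w | place q w = e] w)%:E))%E.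
    apply: eq_integral => w _.
    rewrite (@esum_uniq_supp _ _ _ [:: place q w]) //.
    - rewrite big_seq1 !indicE [in RHS]mem_set // mule1.
      by congr ((_ : bool)%:R%:E); apply/idP/idP; rewrite inE.
    - move=> e; rewrite inE => /eqP ne; rewrite indicE memNset ?mule0 //= => h.
      exact/ne/esym.
  rewrite integral_esum.
  - apply: eq_esum => e _; rewrite ge0_integralZl //.
    + rewrite integral_indic //; last exact: measurable_place.
      by rewrite setIT EFinM; congr (_ * _)%E; exact: prob_place.
    + apply/measurable_EFinP; exact/measurable_indic/measurable_place.
  - move=> e; apply: emeasurable_funM => //.
    apply/measurable_EFinP; exact/measurable_indic/measurable_place.
  - by move=> e w; rewrite -EFinM lee_fin mulr_ge0.
by rewrite /hit_prob fineK -PE // fin_num_measure.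
Qed.

Lemma hit_prob_ge0 f x : 0 <= hit_prob f x.
Proof.
by apply/fine_ge0/esum_ge0 => e _; rewrite lee_fin mulr_ge0 // joint_law_ge0.
Qed.

Lemma sigma_path_hit (f : pred E) q : sigma_path (Y q) [set w | f (place q w)].
Proof.
pose X (b : bool) w := Y q (if b then t else s) w.
rewrite (_ : [set w | _] = [set w | (fun cs => f (nth 0 cs 0, nth 0 cs 1) : Prop) [seq X b w | b <- [:: false; true]]]) //.
apply: (@sigma_countable_pre Omega [set A | exists t y, 0 <= t /\ A = [set w | Y q t w = y]] bool _ X [:: false; true]
  (fun cs => f (nth 0 cs 0, nth 0 cs 1) : Prop)) => b c.
by apply: sub_sigma_algebra; exists (if b then t else s), c; case: b.
Qed.

(** Independence of the walks and of the initial configuration, for distinct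
    particles. *)
Lemma prob_alive_hit (qs : seq Q) (F : Q -> pred E) : uniq qs ->
  P [set w | all (alive (eta0 w)) qs && all (fun q => F q (place q w)) qs] =
  (P [set w | all (alive (eta0 w)) qs] * (\prod_(q <- qs) hit_prob (F q) q.1)%:E)%E.
Proof.
move=> uq.
pose J := [fset o in None :: map Some qs]%fset.
pose Ev (o : option Q) := if o is Some q then [set w | F q (place q w)]
   else [set w | all (alive (eta0 w)) qs].
have pe : perm_eq (enum_fset J) (None :: map Some qs).
  apply: uniq_perm; rewrite ?fset_uniq //; last by move=> o; rewrite in_fset.
  rewrite /= map_inj_uniq ?uq ?andbT; last by move=> a b [].
  by apply/mapP => -[].
have := hI (J := J) (E := Ev); rewrite (perm_big _ pe) big_cons /= big_map.
under eq_bigr do rewrite prob_hit.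
rewrite prodEFin => <-; last first.
  move=> [q|] _ /=; first exact: sigma_path_hit.
  exact: sigma_all_alive.
congr (P _); apply/seteqP; split => w /=.
  move=> /andP[h1 h2] [q|] /=; last by [].
  by rewrite in_fset inE /= => /mapP[q' qq' [->]]; exact: (allP h2).
move=> h; apply/andP; split; first by apply: (h None); rewrite /= in_fset inE.
by apply/allP => q qq; apply: (h (Some q)); rewrite /= in_fset inE /= map_f.
Qed.

Definition tuple_sum (fs : seq (pred E)) (w : Omega) : \bar R :=
  \esum_(qs in [set qs | size qs = size fs])
   (uniq qs && (all (alive (eta0 w)) qs && all2 (fun f q => f (place q w)) fs qs))%:R%:E.

Definition intensity (f : pred E) : \bar R := \esum_(x in [set: Zd d]) (r x * hit_prob f x)%:E.

Lemma esum_prod_intensity (fs : seq (pred E)) :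
  (forall i, (i < size fs)%N -> intensity (nth xpred0 fs i) \is a fin_num) ->
  \esum_(xs in [set xs | size xs = size fs]) (\prod_(fx <- zip fs xs) (r fx.2 * hit_prob fx.1 fx.2))%:E =
  (\prod_(f <- fs) fine (intensity f))%:E.
Proof.
have h0 (fs' : seq (pred E)) xs : 0 <= \prod_(fx <- zip fs' xs) (r fx.2 * hit_prob fx.1 fx.2).
  by apply: prodr_ge0 => fx _; rewrite mulr_ge0 ?hit_prob_ge0 // ltW.
elim: fs => [|f fs IH] hf.
  have -> : [set xs : seq (Zd d) | size xs = size (Nil (pred E))] = [set [::]].
    by apply/seteqP; split => [ks /size0nil ->|_ ->].
  by rewrite esum_set1 /= ?big_nil // lee_fin.
rewrite [size _]/= esum_seqS //; last by move=> xs; rewrite lee_fin.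
have {}IH := IH (fun i h => hf i.+1 h).
have f_fin := hf 0%N isT.
transitivity (\esum_(x in [set: Zd d]) ((\prod_(f <- fs) fine (intensity f))%:E * (r x * hit_prob f x)%:E)%E).
  apply: eq_esum => x _; rewrite -IH muleC -esumZl; last 2 first.
  - by rewrite mulr_ge0 ?hit_prob_ge0 // ltW.
  - by move=> xs; rewrite lee_fin.
  by apply: eq_esum => xs _; rewrite /= big_cons EFinM.
rewrite esumZl; last 2 first.
- by apply: prodr_ge0 => g _; apply/fine_ge0/esum_ge0 => x _; rewrite lee_fin mulr_ge0 ?hit_prob_ge0 // ltW.
- by move=> x; rewrite lee_fin mulr_ge0 ?hit_prob_ge0 // ltW.
by rewrite -/(intensity f) big_cons EFinM fineK // muleC.
Qed.

Lemma measurable_particles (qs : seq Q) cs :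
  measurable [set w | [seq (eta0 w q.1, place q w) | q <- qs] = cs].
Proof.
apply: (measurable_seq_pre (X := fun q w => (eta0 w q.1, place q w))) => q [m e].
rewrite (_ : [set w | _] = [set w | eta0 w q.1 = m] `&` [set w | place q w = e]).
  by apply: measurableI => //; exact: measurable_place.
by apply/seteqP; split => w /=; [move=> [-> <-]|move=> [-> ->]].
Qed.

Definition tuple_test (fs : seq (pred E)) (qs : seq Q) (cs : seq (nat * E)) : bool :=
  all2 (fun q c => (q.2 < c)%N) qs (unzip1 cs) && all2 (fun f (e : E) => f e) fs (unzip2 cs).

Lemma tuple_testE fs qs w :
  all (alive (eta0 w)) qs && all2 (fun f q => f (place q w)) fs qs =
  tuple_test fs qs [seq (eta0 w q.1, place q w) | q <- qs].
Proof.
rewrite /tuple_test; congr (_ && _).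
  by elim: (qs) => //= q l ->.
by elim: (fs) (qs) => [|f l IH] [|q l'] //=; rewrite IH.
Qed.

Lemma measurable_tuple_event fs qs : measurable
  [set w | all (alive (eta0 w)) qs && all2 (fun f q => f (place q w)) fs qs].
Proof.
under eq_set do rewrite tuple_testE.
exact: (measurable_countable_pre (measurable_particles qs) (fun cs => tuple_test fs qs cs)).
Qed.

Lemma measurable_tuple_term (fs : seq (pred E)) (qs : seq Q) :
  measurable_fun [set: Omega] (fun w => (uniq qs && (all (alive (eta0 w)) qs && all2 (fun f q => f (place q w)) fs qs))%:R%:E : \bar R).
Proof.
apply/measurable_EFinP; under eq_fun do rewrite tuple_testE.
exact: (measurable_fun_countable (fun cs => (uniq qs && tuple_test fs qs cs)%:R : R) (measurable_particles qs)).
Qed.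

(** By independence, the walks contribute the product of their probabilities
    and the labels contribute the densities at the starting sites, as in
    esum_prob_alive; the sum over starting sites then factorizes. *)
Theorem factorial_moment (fs : seq (pred E)) :
  (forall i, (i < size fs)%N -> intensity (nth xpred0 fs i) \is a fin_num) ->
  (\int[P]_w tuple_sum fs w = (\prod_(f <- fs) fine (intensity f))%:E)%E.
Proof.
move=> hf; rewrite /tuple_sum.
under eq_integral do rewrite esum_asbool.
rewrite integral_esum; last 2 first.
- by move=> qs; case: asboolP => // _; exact: measurable_tuple_term.
- by move=> qs w; case: asboolP.
have h0 xs : 0 <= \prod_(fx <- zip fs xs) hit_prob fx.1 fx.2.
  by apply: prodr_ge0 => fx _; rewrite hit_prob_ge0.
transitivity (\esum_(qs in [set qs | size qs = size fs])
   ((uniq qs)%:R%:E * (P [set w | all (alive (eta0 w)) qs] * (\prod_(fx <- zip fs (unzip1 qs)) hit_prob fx.1 fx.2)%:E))%E).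
  rewrite [RHS]esum_asbool; apply: eq_esum => qs _.
  case: asboolP => [/= sq|_]; last by rewrite integral0.
  case: (boolP (uniq qs)) => uq /=; last by rewrite mul0e integral0.
  rewrite mul1e.
  have -> : \prod_(fx <- zip fs (unzip1 qs)) hit_prob fx.1 fx.2 = \prod_(fq <- zip fs qs) hit_prob fq.1 fq.2.1.
    elim: (fs) (qs) => [|f l IH] [|q l'] //=; rewrite ?big_nil // !big_cons.
    by rewrite IH.
  rewrite -(@prod_zip_index _ _ _ (fun f (q : Q) => hit_prob f q.1) xpred0 fs qs uq (esym sq)).
  rewrite -(prob_alive_hit (fun q => nth xpred0 fs (index q qs))) //.
  under eq_set => w.
    rewrite (@all2_index _ _ (fun (f : pred E) q => f (place q w)) xpred0 fs qs uq (esym sq)).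
    over.
  rewrite -[X in P X]setIT -integral_indic //; last exact: measurable_tuple_event.
  apply: eq_integral => w _; rewrite indicE; congr ((_ : bool)%:R%:E).
  by apply/idP/idP; rewrite inE.
rewrite esum_zip; last first.
  by move=> qs; rewrite !mule_ge0 // lee_fin.
rewrite -esum_prod_intensity //; apply: eq_esum => xs /= sx.
transitivity (\esum_(ls in [set ls | size ls = size fs])
   ((\prod_(fx <- zip fs xs) hit_prob fx.1 fx.2)%:E * ((uniq (zip xs ls))%:R%:E * P [set w | all (alive (eta0 w)) (zip xs ls)]))%E).
  by apply: eq_esum => ls /= sl; rewrite unzip1_zip ?sl ?sx // muleA muleC.
rewrite -sx esumZl //; last by move=> ls; rewrite mule_ge0.
rewrite (esum_prob_alive r0 meta0 poisson_eta0) -EFinM; congr EFin.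
have -> : \prod_(x <- xs) r x = \prod_(fx <- zip fs xs) r fx.2.
  by rewrite -[in LHS](@unzip2_zip _ _ fs xs) ?sx // big_map.
by rewrite mulrC -big_split.
Qed.

End WalkIndependence.

(** * Covariance of Charlier products *)

Section Covariance.
Context {R : realType} {d : nat} {p : Zd d -> Zd d -> R} (hp : walk_kernel p).
Context {disp : measure_display} {Omega : measurableType disp}.
Variables (P : probability Omega R) (r : Zd d -> R).
Hypothesis r0 : forall x, 0 < r x.
Local Notation Q := (Zd d * nat)%type.
Local Notation E := (Zd d * Zd d)%type.
Variable eta : R -> Omega -> configuration d.
Hypothesis meta : forall t x m, 0 <= t -> measurable [set w | eta t w x = m].
Hypothesis poisson_eta0 : product_poisson r P (eta 0).
Variable Y : Q -> R -> Omega -> Zd d.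
Hypothesis hY : forall q, random_walk p P q.1 (Y q).
Hypothesis hI : mutually_independent P (fun o : option Q =>
        if o is Some q then sigma_path (Y q) else sigma_config (eta 0)).
Variables (s t : R).
Hypothesis s0 : 0 <= s.
Hypothesis st : s <= t.

Let t0 : 0 <= t. Proof. exact: le_trans st. Qed.
Let meta0 x m : measurable [set w | eta 0 w x = m]. Proof. exact: meta. Qed.

Local Notation place := (place Y s t).
Local Notation intensity := (intensity (p := p) r s t).
Local Notation sums := (tuple_sum (eta 0) Y s t).

Variable Null : set Omega.
Hypothesis mNull : measurable Null.
Hypothesis Null0 : P Null = 0%E.
Hypothesis counts : forall w, ~ Null w -> forall y,
  ([set q | (q.2 < eta 0%R w q.1)%N /\ Y q s w = y] #= `I_(eta s w y))%card /\
  ([set q | (q.2 < eta 0%R w q.1)%N /\ Y q t w = y] #= `I_(eta t w y))%card.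

Variables (Bs As : seq (Zd d)).
(** Only particles seen at a site of Bs at time s or of As at time t matter; almost
    surely there are finitely many, whereas the whole system is infinite. *)
Definition near_site (e : E) : bool := (e.1 \in Bs) || (e.2 \in As).

Definition near_particles (w : Omega) : set Q := [set q | alive (eta 0 w) q && near_site (place q w)].

Lemma finite_near_particles w : ~ Null w -> finite_set (near_particles w).
Proof.
move=> Nw.
apply: (@sub_finite_set _ _ (
  (\bigcup_(y in [set` Bs]) [set q | (q.2 < eta 0%R w q.1)%N /\ Y q s w = y]) `|`
  (\bigcup_(y in [set` As]) [set q | (q.2 < eta 0%R w q.1)%N /\ Y q t w = y]))).
  move=> q /= /andP[aq /orP[h|h]]; [left|right].
    by exists (Y q s w).
  by exists (Y q t w).
rewrite finite_setU; split; apply: bigcup_finite => // y _; apply/finite_setP.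
  by exists (eta s w y); exact: (counts Nw y).1.
by exists (eta t w y); exact: (counts Nw y).2.
Qed.

(** Empty on the null set where the particle counts fail, so that functionals of
    this list are measurable on the whole space. *)
Definition particle_list (w : Omega) : seq Q :=
  if `[< Null w >] then [::] else enum_fset (fset_set (near_particles w)).

Definition particles (w : Omega) : seq E := [seq place q w | q <- particle_list w].

Lemma particle_list_uniq w : uniq (particle_list w).
Proof. by rewrite /particle_list; case: asboolP => // _; exact: fset_uniq. Qed.

Lemma mem_particle_list w q : ~ Null w ->
  (q \in particle_list w) = alive (eta 0 w) q && near_site (place q w).
Proof.
move=> Nw; rewrite /particle_list asboolF //.
rewrite (in_fset_set (finite_near_particles Nw)).
by apply/idP/idP; rewrite inE.
Qed.

(** The occupation numbers at the chosen sites only see the listed particles. *)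
Lemma count_particles (u : R) (v : E -> Zd d) w y : ~ Null w ->
  (forall q, v (place q w) = Y q u w) ->
  ([set q | (q.2 < eta 0%R w q.1)%N /\ Y q u w = y] #= `I_(eta u w y))%card ->
  (forall e, v e = y -> near_site e) ->
  count (fun e => v e == y) (particles w) = eta u w y.
Proof.
move=> Nw vp hc hr.
set A := [set q : Q | _] in hc.
have finA : finite_set A by apply/finite_setP; exists (eta u w y).
have <- : #|` fset_set A| = eta u w y by exact: card_fset_set.
rewrite /particles count_map -size_filter cardfE -cardfE.
apply: perm_size; apply: uniq_perm; rewrite ?filter_uniq ?particle_list_uniq ?fset_uniq //.
move=> q; rewrite mem_filter mem_particle_list // (in_fset_set finA) /= vp.
apply/andP/idP => [[/eqP e /andP[aq _]]|]; first by rewrite inE.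
by rewrite inE => -[aq e]; rewrite e eqxx; split => //; apply/andP; split => //; apply: hr; rewrite vp.
Qed.

Definition observable (f : pred E) : Prop :=
  (forall e, f e -> near_site e) /\ intensity f \is a fin_num.

Lemma observableI f g : observable f -> observable (predI f g).
Proof.
move=> [hr hfin]; split; first by move=> e /andP[/hr].
rewrite ge0_fin_numE; last first.
  by apply: esum_ge0 => x _; rewrite lee_fin mulr_ge0 ?(hit_prob_ge0 hp) // ltW.
apply: le_lt_trans (_ : (_ <= intensity f)%E) _; last by rewrite -ge0_fin_numE // esum_ge0 // => x _; rewrite lee_fin mulr_ge0 ?(hit_prob_ge0 hp) // ltW.
apply: le_esum => x _; rewrite lee_fin ler_wpM2l //; first exact: ltW.
have := prob_hit hY s0 st (predI f g) (x, 0%N).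
have := prob_hit hY s0 st f (x, 0%N); rewrite /= => h1 h2.
rewrite -lee_fin -h1 -h2; apply: le_measure; rewrite ?inE.
- exact: (measurable_countable_pre (measurable_place hY s0 st (x, 0%N)) (fun e => predI f g e)).
- exact: (measurable_countable_pre (measurable_place hY s0 st (x, 0%N)) (fun e => f e)).
- by move=> w /= /andP[].
Qed.

Lemma all_in_nth fs : all_in observable fs ->
  forall i, (i < size fs)%N -> observable (nth xpred0 fs i).
Proof. by elim: fs => [|f fs IH] //= [hf hfs] [|i] //= /(IH hfs). Qed.

Lemma tuple_sum_particles fs w : all_in observable fs -> ~ Null w ->
  sums fs w = (factorial_sum R fs (particles w))%:E.
Proof.
move=> hfs Nw; rewrite factorial_sum_map -esum_factorial_sum ?particle_list_uniq //.
rewrite size_map; apply: eq_esum => qs /= sq; congr ((nat_of_bool (_ && _))%:R%:E).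
elim: fs hfs qs sq => [|f fs IH] /= hfs [|q qs] //= sq.
rewrite mem_particle_list //.
case: hfs => -[hr _] /IH {}IH.
rewrite andbACA [RHS]andbACA IH; last by case: sq.
case: (alive _ _) => //=; congr (_ && _).
by apply/idP/idP => [h|/andP[]] //; rewrite (hr _ h) h.
Qed.

Lemma measurable_tuple_sum fs : measurable_fun [set: Omega] (sums fs).
Proof.
rewrite /tuple_sum; under eq_fun do rewrite esum_asbool.
apply: measurable_esum => [qs|qs w]; last by case: asboolP.
by case: asboolP => // _; exact: (measurable_tuple_term meta0 hY s0 st).
Qed.

Lemma notNull_ae : {ae P, forall w, ~ Null w}.
Proof. by exists Null; split => // w /= /contrapT. Qed.

Lemma measurable_factorial_sum fs : all_in observable fs ->
  measurable_fun [set: Omega] (fun w => (factorial_sum R fs (particles w))%:E).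
Proof.
move=> hfs.
rewrite (_ : (fun _ => _) = fun w => if w \in Null then (factorial_sum R fs [::])%:E else sums fs w).
  apply: measurable_fun_ifT => //; last exact: measurable_tuple_sum.
  by apply: (measurable_fun_bool true); rewrite setTI (_ : _ @^-1` _ = Null) //; apply/seteqP; split => w /=; [move/set_mem|move/mem_set].
apply/funext => w; case: ifPn => [/set_mem Nw|/negP Nw].
  by rewrite /particles /particle_list asboolT.
by rewrite tuple_sum_particles // => h; apply: Nw; exact: mem_set.
Qed.

Lemma integral_factorial_sum fs : all_in observable fs ->
  (\int[P]_w (factorial_sum R fs (particles w))%:E =
   (\prod_(f <- fs) fine (intensity f))%:E)%E.
Proof.
move=> hfs; rewrite -(factorial_moment hp r0 meta0 poisson_eta0 hY hI s0 st); last first.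
  by move=> i /(all_in_nth hfs) [].
apply: ge0_ae_eq_integral => //.
- exact: measurable_factorial_sum.
- exact: measurable_tuple_sum.
- by move=> w _; rewrite lee_fin factorial_sum_ge0.
- by move=> w _; exact: esum_ge0.
- by apply: filterS notNull_ae => w Nw _; rewrite tuple_sum_particles.
Qed.

(** Factorial sums have finite moments; the rest is linearity. *)
Lemma integrable_span F : factorial_span observable F ->
  P.-integrable setT (fun w => (F (particles w))%:E).
Proof.
elim=> {F} [F G _ IH FG|fs hfs|F G _ IHF _ IHG|c F _ IHF].
- by apply: eq_integrable IH => // w _ /=; rewrite FG.
- apply/integrableP; split; first exact: measurable_factorial_sum.
  rewrite (_ : \int[P]_(x in setT) _ = \int[P]_x (factorial_sum R fs (particles x))%:E)%E.
    by rewrite integral_factorial_sum // ltry.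
  by apply: eq_integral => w _; rewrite gee0_abs // lee_fin factorial_sum_ge0.
- have := integrableD measurableT IHF IHG.
  by apply: eq_integrable => // w _ /=.
- have := integrableZl measurableT c IHF.
  by apply: eq_integrable => // w _ /=.
Qed.

Definition particle_expectation (F : seq E -> R) : R := fine (\int[P]_w (F (particles w))%:E).

Lemma particle_expectation_wick fs gs : all_in observable fs -> all_in observable gs ->
  particle_expectation (fun S => wick (fun f => fine (intensity f)) fs S * wick (fun f => fine (intensity f)) gs S) =
  permanent (fun f g => fine (intensity (predI f g))) fs gs.
Proof.
move=> hfs hgs.
apply: (@wick_covariance _ _ _ observable) => //.
- exact: observableI.
- by move=> F G FG; rewrite /particle_expectation; congr fine; apply: eq_integral => w _; rewrite FG.
- move=> F G spF spG; rewrite /particle_expectation -fineD; last 2 first.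
  + exact/integrable_fin_num/integrable_span.
  + exact/integrable_fin_num/integrable_span.
  congr fine; rewrite -integralD //; try exact: integrable_span.
- move=> c F spF; rewrite /particle_expectation -[c in RHS]/(fine c%:E) -fineM //; last first.
    exact/integrable_fin_num/integrable_span.
  congr fine; rewrite -integralZl //; exact: integrable_span.
- by move=> l hl; rewrite /particle_expectation integral_factorial_sum.
Qed.

End Covariance.

Lemma permanent_ext (R : comNzRingType) (S : Type) (M M' : S -> S -> R) xs ys :
  (forall x y, M x y = M' x y) -> permanent M xs ys = permanent M' xs ys.
Proof.
by move=> h; elim: xs ys => //= x xs IH ys; apply: eq_bigr => i _; rewrite h IH.
Qed.

Section CovarianceTheorem.
Context {R : realType} {d : nat} {p : Zd d -> Zd d -> R} (hp : walk_kernel p).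
Context {disp : measure_display} {Omega : measurableType disp}.
Variables (P : probability Omega R) (r : Zd d -> R).
Hypothesis r0 : forall x, 0 < r x.
Local Notation Q := (Zd d * nat)%type.
Local Notation E := (Zd d * Zd d)%type.
Variable eta : R -> Omega -> configuration d.
Hypothesis walkers : independent_walkers p P eta.
Hypothesis poisson_eta0 : product_poisson r P (eta 0).

Lemma measurable_charlier_prod (q : Zd d -> R) xs u : 0 <= u ->
  measurable_fun [set: Omega] (fun w => charlier_prod q xs (eta u w)).
Proof.
move=> u0; apply: measurable_prod => x _.
apply: (measurable_fun_countable (fun m => charlier (q x) (count_mem x xs) m) (X := fun w => eta u w x)) => m.
exact: walkers.1.
Qed.

Definition evolved_rate (u : R) (x : Zd d) : R := walk_expectation p x u r.

Hypothesis evolved_rate_fin : forall u x, 0 <= u ->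
  \esum_(y in [set: Zd d]) (heat p u x y * r y)%:E \is a fin_num.

Lemma evolved_rateE u x : 0 <= u ->
  \esum_(y in [set: Zd d]) (r y * heat p u y x)%:E = (evolved_rate u x)%:E.
Proof.
move=> u0; rewrite /evolved_rate /walk_expectation fineK ?evolved_rate_fin //.
by apply: eq_esum => y _; rewrite mulrC (heat_sym hp).
Qed.

Variables (s t : R).
Hypothesis s0 : 0 <= s.
Hypothesis st : s <= t.

(** The covariance is given by particles common to both factors: at y at time s
    and at x at time t, with intensity rho_s(y) p_(t-s)(y, x). *)
Theorem charlier_covariance (xs ys : seq (Zd d)) :
  P.-integrable setT (fun w => (charlier_prod (evolved_rate t) xs (eta t w) *
      charlier_prod (evolved_rate s) ys (eta s w))%:E) /\
  (\int[P]_w (charlier_prod (evolved_rate t) xs (eta t w) *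
      charlier_prod (evolved_rate s) ys (eta s w))%:E =
  (permanent (fun x y => evolved_rate s y * heat p (t - s) y x) xs ys)%:E)%E.
Proof.
have t0 : 0 <= t := le_trans s0 st.
have ts0 : 0 <= t - s by rewrite subr_ge0.
have [meta [Y [hY hI hcount]]] := walkers.
have [N1 [mN1 N10 sub1]] := hcount s s0.
have [N2 [mN2 N20 sub2]] := hcount t t0.
(* Both particle counts hold outside N. *)
pose N := N1 `|` N2.
have mN : measurable N by exact: measurableU.
have N0 : P N = 0%E.
  apply/eqP; rewrite eq_le measure_ge0 andbT -[X in (_ <= X)%E]adde0.
  by rewrite -{1}N10 -N20; exact: measureU2.
have counts w : ~ N w -> forall y,
  ([set q | (q.2 < eta 0%R w q.1)%N /\ Y q s w = y] #= `I_(eta s w y))%card /\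
  ([set q | (q.2 < eta 0%R w q.1)%N /\ Y q t w = y] #= `I_(eta t w y))%card.
  move=> Nw y; split; apply: contrapT => h; apply: Nw; [left|right].
    by apply: sub1 => /= /(_ y).
  by apply: sub2 => /= /(_ y).
(* A pair e consists of the positions at times s and t. *)
pose f x : pred E := fun e => e.2 == x.
pose g y : pred E := fun e => e.1 == y.
have fdd q := (hY q).2.
have hit_f x z : hit_prob (p := p) s t (f x) z = heat p t z x.
  apply/EFin_inj; rewrite -(prob_hit hY s0 st (f x) (z, 0%N)).
  have := fdd (z, 0%N) [:: (t, x)]; rewrite /= t0 subr0 mulr1 => /(_ isT) <-.
  congr (P _); apply/seteqP; split => w /=.
    by move=> /eqP h u; rewrite inE => /eqP ->.
  by move=> h; apply/eqP/(h (t, x)); rewrite inE.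
have hit_g y z : hit_prob (p := p) s t (g y) z = heat p s z y.
  apply/EFin_inj; rewrite -(prob_hit hY s0 st (g y) (z, 0%N)).
  have := fdd (z, 0%N) [:: (s, y)]; rewrite /= s0 subr0 mulr1 => /(_ isT) <-.
  congr (P _); apply/seteqP; split => w /=.
    by move=> /eqP h u; rewrite inE => /eqP ->.
  by move=> h; apply/eqP/(h (s, y)); rewrite inE.
have hit_fg x y z : hit_prob (p := p) s t (predI (f x) (g y)) z = heat p s z y * heat p (t - s) y x.
  apply/EFin_inj; rewrite -(prob_hit hY s0 st _ (z, 0%N)).
  rewrite -[RHS](prob_place hY s0 st (z, 0%N) (y, x)).
  congr (P _); apply/seteqP; split => w /=.
    by move=> /andP[/eqP h1 /eqP h2]; rewrite /place; congr pair.
  by rewrite /f /g => -> /=; rewrite !eqxx.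
have int_f x : intensity (p := p) r s t (f x) = (evolved_rate t x)%:E.
  by rewrite /intensity; under eq_esum do rewrite hit_f; exact: evolved_rateE.
have int_g y : intensity (p := p) r s t (g y) = (evolved_rate s y)%:E.
  by rewrite /intensity; under eq_esum do rewrite hit_g; exact: evolved_rateE.
have int_fg x y : intensity (p := p) r s t (predI (f x) (g y)) = (evolved_rate s y * heat p (t - s) y x)%:E.
  rewrite /intensity; under eq_esum do rewrite hit_fg mulrA mulrC EFinM.
  rewrite esumZl ?(heat_ge0 hp) //; first by rewrite evolved_rateE // -EFinM mulrC.
  by move=> z; rewrite lee_fin mulr_ge0 ?(heat_ge0 hp) // ltW.
have obs_f l : {subset l <= xs} -> all_in (observable (p := p) r s t ys xs) [seq f x | x <- l].
  elim: l => //= x l IH h; split; last by apply: IH => z zl; apply: h; rewrite inE zl orbT.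
  split; last by rewrite int_f.
  by move=> e /eqP ex; rewrite /near_site ex h ?mem_head // orbT.
have obs_g l : {subset l <= ys} -> all_in (observable (p := p) r s t ys xs) [seq g x | x <- l].
  elim: l => //= x l IH h; split; last by apply: IH => z zl; apply: h; rewrite inE zl orbT.
  split; last by rewrite int_g.
  by move=> e /eqP ex; rewrite /near_site ex h ?mem_head.
have {}obs_f := obs_f xs (fun _ h => h).
have {}obs_g := obs_g ys (fun _ h => h).
pose lam h := fine (intensity (p := p) r s t h).
pose S w := particles eta Y s t N ys xs w.
have Ef w : ~ N w -> wick lam [seq f x | x <- xs] (S w) = charlier_prod (evolved_rate t) xs (eta t w).
  move=> Nw; rewrite (@wick_charlier _ _ _ snd lam (evolved_rate t)).
    apply: charlier_prod_ext => x xxs.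
    apply: (count_particles counts Nw) => //; first exact: (counts w Nw x).2.
    by move=> e ex; rewrite /near_site ex xxs orbT.
  by move=> x _; rewrite /lam int_f.
have Eg w : ~ N w -> wick lam [seq g x | x <- ys] (S w) = charlier_prod (evolved_rate s) ys (eta s w).
  move=> Nw; rewrite (@wick_charlier _ _ _ fst lam (evolved_rate s)).
    apply: charlier_prod_ext => x xxs.
    apply: (count_particles counts Nw) => //; first exact: (counts w Nw x).1.
    by move=> e ex; rewrite /near_site ex xxs.
  by move=> x _; rewrite /lam int_g.
pose F S' := wick lam [seq f x | x <- xs] S' * wick lam [seq g x | x <- ys] S'.
have obsI a b : observable (p := p) r s t ys xs a -> observable (p := p) r s t ys xs (predI a b).
  exact: (observableI hp r0 hY s0 st).
have iF : P.-integrable setT (fun w => (F (S w))%:E).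
  apply: (integrable_span hp r0 meta poisson_eta0 hY hI s0 st mN N0 counts).
  exact: (span_wick_mul lam obsI obs_f obs_g).
have aeE : {ae P, forall w, ~ N w}.
  by exists N; split => // w /= /contrapT.
have mD : measurable_fun setT (fun w => (charlier_prod (evolved_rate t) xs (eta t w) *
      charlier_prod (evolved_rate s) ys (eta s w))%:E).
  by apply/measurable_EFinP/measurable_funM; exact: measurable_charlier_prod.
have [mF fF] := integrableP _ _ _ iF.
split.
  apply/integrableP; split => //.
  rewrite (ge0_ae_eq_integral (g := fun w => `|(F (S w))%:E|%E)) //.
  - by apply: measurableT_comp.
  - by apply: measurableT_comp.
  - by apply: filterS aeE => w Nw _ /=; rewrite /F Ef // Eg.
have := particle_expectation_wick hp r0 meta poisson_eta0 hY hI s0 st mN N0 counts obs_f obs_g.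
rewrite permanent_map /particle_expectation -/lam -/S => h.
transitivity (\int[P]_w (F (S w))%:E)%E.
  apply: ae_eq_integral => //.
  by apply: filterS aeE => w Nw _ /=; rewrite /F Ef // Eg.
rewrite -[LHS]fineK; last exact: integrable_fin_num.
congr EFin; rewrite /F h; apply: permanent_ext => x y.
by rewrite int_fg.
Qed.

End CovarianceTheorem.

(** * Lattice sums of covariances *)

Lemma permanent_ge0 (R : realDomainType) (S : Type) (M : S -> S -> R) xs ys :
  (forall x y, 0 <= M x y) -> 0 <= permanent M xs ys.
Proof.
move=> h; elim: xs ys => [|x xs IH] ys //=.
by apply: sumr_ge0 => i _; rewrite mulr_ge0.
Qed.

Lemma mem_delete_nth (S : eqType) i (s : seq S) y : y \in delete_nth i s -> y \in s.
Proof. by rewrite mem_cat => /orP[/mem_take|/mem_drop]. Qed.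

Lemma permanent_le (R : realDomainType) (S : eqType) (M : S -> S -> R) K xs ys :
  (forall x y, 0 <= M x y) -> 0 <= K ->
  (forall x y, x \in xs -> y \in ys -> M x y <= K) -> size xs = size ys ->
  permanent M xs ys <= (size xs)`!%:R * K ^+ size xs.
Proof.
move=> M0 K0; elim: xs ys => [|x xs IH] ys hM sz /=.
  by rewrite -sz /= fact0 expr0 mulr1.
apply: (@le_trans _ _ (\sum_(i < size ys) K * ((size xs)`!%:R * K ^+ size xs))).
  apply: ler_sum => i _; apply: ler_pM; rewrite ?permanent_ge0 //.
    by apply: hM; rewrite ?mem_head ?mem_nth.
  apply: IH; last by rewrite size_delete_nth // -sz.
  by move=> x' y' hx hy; apply: hM; rewrite ?inE ?hx ?orbT //; exact: mem_delete_nth hy.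
rewrite sumr_const card_ord -sz /= factS natrM exprS -mulr_natl.
by rewrite le_eqVlt; apply/orP; left; apply/eqP; ring.
Qed.

(** One row is kept, the others are bounded entrywise. *)
Lemma permanent_cons_le (R : realDomainType) (S : eqType) (M : S -> S -> R) K x xs ys :
  (forall x y, 0 <= M x y) -> 0 <= K ->
  (forall x y, x \in xs -> y \in ys -> M x y <= K) -> (size xs).+1 = size ys ->
  permanent M (x :: xs) ys <=
  (\sum_(y <- ys) M x y) * ((size xs)`!%:R * K ^+ size xs).
Proof.
move=> M0 K0 hM sz /=; rewrite mulr_suml (big_nth x) big_mkord.
apply: ler_sum => i _; rewrite ler_wpM2l //; apply: permanent_le => //.
  by move=> x' y' hx hy; apply: hM => //; exact: mem_delete_nth hy.
by rewrite size_delete_nth // -sz.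
Qed.

Section LatticeSums.
Context {R : realType} {d : nat}.

(** Comparison with a telescoping sum. *)
Lemma sum_inv_sqr N L : (0 < N)%N ->
  \sum_(n < L) (1 + n.+1%:R / N%:R) ^- 2 <= N%:R :> R.
Proof.
move=> N0; have N0' : 0 < N%:R :> R by rewrite ltr0n.
suff : \sum_(n < L) (1 + n.+1%:R / N%:R) ^- 2 <= N%:R - N%:R ^+ 2 / (N%:R + L%:R) :> R.
  by move=> h; apply: le_trans h _; rewrite lerBlDr lerDl divr_ge0 ?sqr_ge0 ?addr_ge0.
elim: L => [|L IH]; first by rewrite big_ord0 addr0 expr2 mulfK ?subrr ?gt_eqF.
rewrite big_ord_recr /=; apply: le_trans (lerD IH (lexx _)) _.
have a0 : 0 < N%:R + L%:R :> R by rewrite ltr_wpDr.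
have -> : (1 + L.+1%:R / N%:R) ^- 2 = N%:R ^+ 2 / (N%:R + L%:R + 1) ^+ 2 :> R.
  rewrite -natr1 -expr_div_n -exprVn; congr (_ ^+ 2); field.
  by rewrite !gt_eqF // ltr_wpDr.
rewrite -natr1 addrA; set a := N%:R + L%:R in a0 *.
rewrite -subr_ge0.
have -> : N%:R - N%:R ^+ 2 / (a + 1) - (N%:R - N%:R ^+ 2 / a + N%:R ^+ 2 / (a + 1) ^+ 2) =
   N%:R ^+ 2 / (a * (a + 1) ^+ 2).
  by field; rewrite !gt_eqF // addr_gt0.
by rewrite divr_ge0 ?sqr_ge0 // mulr_ge0 ?sqr_ge0 // ltW.
Qed.

Lemma sum_inv_sqr_int N K : (0 < N)%N ->
  \sum_(j < K.*2.+1) (1 + `|(j%:Z - K%:Z)%:~R| / N%:R) ^- 2 <= 3 * N%:R :> R.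
Proof.
move=> N0.
suff -> : \sum_(j < K.*2.+1) (1 + `|(j%:Z - K%:Z)%:~R| / N%:R) ^- 2 =
    1 + (\sum_(n < K) (1 + n.+1%:R / N%:R) ^- 2) *+ 2 :> R.
  have := sum_inv_sqr K N0; have : 1 <= N%:R :> R by rewrite ler1n.
  by rewrite mulr2n; lra.
elim: K => [|K IH].
  by rewrite big_ord1 big_ord0 mul0rn addr0 normr0 mul0r addr0 expr1n invr1.
rewrite doubleS big_ord_recl big_ord_recr /= [in RHS]big_ord_recr /= mulrnDl.
have -> : \sum_(i < K.*2.+1) (1 + `|((lift ord0 (widen_ord (leqnSn K.*2.+1) i))%:Z - K.+1%:Z)%:~R| / N%:R) ^- 2
   = \sum_(j < K.*2.+1) (1 + `|(j%:Z - K%:Z)%:~R| / N%:R) ^- 2 :> R.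
  apply: eq_bigr => i _; congr ((1 + `|_%:~R| / _) ^- 2).
  by rewrite /= /bump /=; lia.
rewrite IH.
have -> : `|(0%:Z - K.+1%:Z)%:~R| = K.+1%:R :> R.
  by rewrite sub0r mulrNz normrN ger0_norm.
have -> : `|((bump 0 K.*2.+1)%:Z - K.+1%:Z)%:~R| = K.+1%:R :> R.
  have -> : (bump 0 K.*2.+1)%:Z - K.+1%:Z = K.+1%:Z :> int by rewrite /bump /=; lia.
  by rewrite ger0_norm.
by ring.
Qed.

(** The norm dominates each coordinate, so that the sum is bounded by a product of
    one-dimensional sums, each of order N. *)
Lemma lattice_sum N (s : seq (Zd d)) : (0 < N)%N -> uniq s ->
  \sum_(z <- s) (1 + `|rescale R N z|) ^- (2 * d) <= (3 * N%:R) ^+ d.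
Proof.
move=> N0 us; have N0' : 0 < N%:R :> R by rewrite ltr0n.
have [K sK] := sub_box s.
pose g (j : int) : R := (1 + `|j%:~R| / N%:R) ^- 2.
have g0 j : 0 <= g j by rewrite invr_ge0 exprn_ge0 // addr_ge0 // divr_ge0.
apply: (@le_trans _ _ (\sum_(z <- s) \prod_i g (z 0 i))).
  apply: ler_sum => z _.
  rewrite -[d in (_ * d)%N]card_ord mulnC exprM -exprVn.
  have -> : (((1 + `|rescale R N z|) ^+ #|'I_d|)^-1) ^+ 2 = \prod_(i < d) (1 + `|rescale R N z|) ^- 2.
    by rewrite prodr_const -!exprVn -!exprM mulnC.
  apply: ler_prod => i _; rewrite invr_ge0 exprn_ge0 ?addr_ge0 //=.
  rewrite /g lef_pV2 ?posrE ?exprn_gt0 ?ltr_wpDr ?divr_ge0 //.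
  rewrite lerXn2r ?nnegrE ?addr_ge0 ?divr_ge0 // lerD2l.
  apply: le_trans (norm_coord _ i).
  by rewrite !mxE normrM mulrC ger0_norm ?invr_ge0.
apply: (@le_trans _ _ (\sum_(z <- @box d K) \prod_i g (z 0 i))).
  rewrite [leRHS](bigID (mem s)) /= -[X in X + _]big_filter.
  rewrite [X in _ <= X + _](perm_big s) /=; last first.
    apply: uniq_perm; rewrite ?filter_uniq ?box_uniq // => z.
    rewrite mem_filter /=; case zs: (z \in s) => //=; exact: sK.
  by rewrite lerDl; apply: sumr_ge0 => z _; apply: prodr_ge0.
rewrite box_sum lerXn2r ?nnegrE ?mulr_ge0 ?sumr_ge0 //.
exact: sum_inv_sqr_int.
Qed.

Lemma schwartz_decay (phi : 'rV[R]_d -> R) (q : nat) : schwartz phi ->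
  exists2 C, 0 <= C & forall x, `|phi x| * (1 + `|x|) ^+ q <= C.
Proof.
move=> /(_ [::]) /= [_ hd].
have [C0 h0] := hd 0%N; have [Cq hq] := hd q.
have p0 : 0 <= C0 by apply: le_trans (h0 0); rewrite mulr_ge0.
have pq : 0 <= Cq by apply: le_trans (hq 0); rewrite mulr_ge0 ?exprn_ge0.
exists (2 ^+ q * (C0 + Cq)); first by rewrite mulr_ge0 ?addr_ge0 ?exprn_ge0.
move=> x; have h : (1 + `|x|) ^+ q <= 2 ^+ q * (1 + `|x| ^+ q).
  have [x1|x1] := leP `|x| 1.
    apply: (@le_trans _ _ (2 ^+ q)).
      by rewrite lerXn2r ?nnegrE ?addr_ge0 //; lra.
    by rewrite ler_peMr ?exprn_ge0 // lerDl exprn_ge0.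
  apply: (@le_trans _ _ ((2 * `|x|) ^+ q)).
    by rewrite lerXn2r ?nnegrE ?addr_ge0 ?mulr_ge0 //; lra.
  by rewrite exprMn ler_wpM2l ?exprn_ge0 // lerDr.
apply: le_trans (ler_wpM2l (normr_ge0 _) h) _.
rewrite mulrCA ler_wpM2l ?exprn_ge0 // mulrDr mulr1 lerD //.
  by have := h0 x; rewrite expr0 mul1r.
by rewrite mulrC; exact: hq.
Qed.

Lemma schwartz_sum (phi : 'rV[R]_d -> R) (q : nat) : schwartz phi ->
  exists2 C, 0 <= C & forall N (s : seq (Zd d)), (0 < N)%N -> uniq s ->
  \sum_(z <- s) `|phi (rescale R N z)| * (1 + `|rescale R N z|) ^+ q <= C * N%:R ^+ d.
Proof.
move=> hphi; have [C C0 hC] := schwartz_decay (q + 2 * d) hphi.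
exists (C * 3 ^+ d); first by rewrite mulr_ge0 // exprn_ge0.
move=> N s N0 us; rewrite -mulrA -exprMn.
apply: le_trans (ler_wpM2l C0 (lattice_sum N0 us)).
rewrite mulr_sumr; apply: ler_sum => z _.
rewrite ler_pdivlMr; last by rewrite exprn_gt0 // ltr_wpDr.
by rewrite -mulrA -exprD.
Qed.

End LatticeSums.

Section CovarianceSum.
Context {R : realType} {d : nat} {p : Zd d -> Zd d -> R} (hp : walk_kernel p).

(** By symmetry the sum over starting points is a sum over end points. *)
Lemma heat_row_sum u (X c : Zd d) (zs : seq (Zd d)) : 0 <= u -> uniq zs ->
  \sum_(z <- zs) heat p u (z + c) X <= 1.
Proof.
move=> u0 uz; under eq_bigr do rewrite (heat_sym hp) //.
rewrite -lee_fin -(esum_heat hp X u0) -sumEFin.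
have := @seq_le_esum R _ (fun y => (heat p u X y)%:E) [seq z + c | z <- zs].
rewrite big_map; apply; first by rewrite map_inj_uniq //; exact: addIr.
by move=> y; rewrite lee_fin (heat_ge0 hp).
Qed.

Lemma rescale_norm N (x : Zd d) : (0 < N)%N ->
  `|rescale R N x| <= `|map_mx intr x : 'rV[R]_d|.
Proof.
move=> N0; rewrite normrZ ger0_norm ?invr_ge0 // ler_piMl // invf_le1 ?ler1n //.
by rewrite ltr0n.
Qed.

(** One heat kernel factor is kept, to be summed later; the others are bounded by
    Theta.  The rates are evaluated at bounded distance from z', so that they grow
    polynomially in z' / N. *)
Lemma permanent_shift_bound (rho : 'rV[R]_d -> R) (T : R) (x0 : Zd d) (xs : seq (Zd d)) :
  (0 < d)%N -> density_profile rho -> 0 <= T ->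
  exists (K : R) (q : nat), 0 <= K /\ forall N s t Theta z z',
  (0 < N)%N -> 0 <= s <= T * N%:R ^+ 2 -> s <= t ->
  (forall x y, heat p (t - s) x y <= Theta) ->
  permanent (fun x y => walk_expectation p y s (fun v => rho (rescale R N v)) * heat p (t - s) y x)
      [seq z + a | a <- x0 :: xs] [seq z' + a | a <- x0 :: xs] <=
  (\sum_(a <- x0 :: xs) heat p (t - s) (z' + a) (z + x0)) *
   (K * Theta ^+ size xs * (1 + `|rescale R N z'|) ^+ q).
Proof.
move=> d0 hrho T0.
have [K [m [K0 hK]]] := evolved_sum_bound hp d0 hrho T0.
(* The sites z' + a are at distance at most b from z', even before rescaling. *)
pose b := \sum_(a <- x0 :: xs) `|map_mx intr a : 'rV[R]_d|.
have b0 : 0 <= b by apply: sumr_ge0.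
have bx a : a \in x0 :: xs -> `|map_mx intr a : 'rV[R]_d| <= b.
  move=> ha; rewrite /b (big_rem a) //= lerDl; exact: sumr_ge0.
pose K2 := K * (1 + b) ^+ m.
have K20 : 0 <= K2 by rewrite mulr_ge0 // exprn_ge0 // addr_ge0.
pose k := (size xs).+1.
exists (K2 ^+ k * (size xs)`!%:R), (m * k)%N; split.
  by apply: mulr_ge0 => //; exact: exprn_ge0.
move=> N s t Theta z z' N0 /andP[s0 sT] st hTheta.
have ts0 : 0 <= t - s by rewrite subr_ge0.
have Th0 : 0 <= Theta by apply: le_trans (hTheta 0 0); exact: (heat_ge0 hp).
set ev := fun y => walk_expectation p y s (fun v => rho (rescale R N v)).
have ev0 y : 0 <= ev y.
  apply/fine_ge0/esum_ge0 => v _; rewrite lee_fin mulr_ge0 ?(heat_ge0 hp) //.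
  by apply: ltW; exact: hrho.1.
pose g (z : Zd d) := 1 + `|rescale R N z|.
have g0 y : 0 <= g y by rewrite addr_ge0.
have evK y : ev y <= K * g y ^+ m.
  have := hK N s y N0; rewrite s0 sT => /(_ isT) h.
  rewrite -lee_fin /ev /walk_expectation fineK //.
  rewrite ge0_fin_numE; first exact: le_lt_trans h (ltry _).
  apply: esum_ge0 => v _; rewrite lee_fin mulr_ge0 ?(heat_ge0 hp) //.
  by apply: ltW; exact: hrho.1.
have evz a : a \in x0 :: xs -> ev (z' + a) <= K2 * g z' ^+ m.
  move=> ha; apply: le_trans (evK _) _; rewrite /K2 -mulrA ler_wpM2l // -exprMn.
  rewrite lerXn2r ?nnegrE ?mulr_ge0 ?addr_ge0 // /g rescaleD.
  have h1 := ler_normD (rescale R N z') (rescale R N a).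
  have h2 := le_trans (rescale_norm a N0) (bx _ ha).
  have h3 := normr_ge0 (rescale R N z').
  have : 0 <= b * `|rescale R N z'| by rewrite mulr_ge0.
  by move: h1 h2 h3; set u := `|_ + _|; set v := `|rescale R N z'|; nra.
set M := fun x y => _ * _.
have M0 x y : 0 <= M x y by rewrite /M mulr_ge0 ?(heat_ge0 hp) //; exact: ev0.
have KT0 : 0 <= K2 * g z' ^+ m * Theta by apply: mulr_ge0 => //; apply: mulr_ge0 => //; apply: exprn_ge0.
apply: le_trans (@permanent_cons_le _ _ M _ (z + x0) [seq z + a | a <- xs]
   [seq z' + a | a <- x0 :: xs] M0 KT0 _ _) _.
- move=> x y /mapP[a ha ->] /mapP[a' ha' ->].
  rewrite /M; apply: ler_pM => //; [exact: ev0|exact: (heat_ge0 hp)|].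
  exact: evz.
- by rewrite /= !size_map.
rewrite big_map size_map.
apply: (@le_trans _ _ ((\sum_(a <- x0 :: xs) K2 * g z' ^+ m * heat p (t - s) (z' + a) (z + x0)) *
   ((size xs)`!%:R * (K2 * g z' ^+ m * Theta) ^+ size xs))).
  rewrite ler_wpM2r ?mulr_ge0 ?exprn_ge0 //.
  rewrite big_seq [leRHS]big_seq; apply: ler_sum => a ha; rewrite /M ler_wpM2r ?(heat_ge0 hp) //.
  exact: evz.
rewrite -mulr_sumr -/(g z') /K2 !exprMn exprM /k !(exprS _ (size xs)).
by rewrite le_eqVlt; apply/orP; left; apply/eqP; ring.
Qed.

(** The kept heat kernel factor is summed over z', and the sum of phi over z gives
    N^d. *)
Lemma covariance_sum_bound (rho phi : 'rV[R]_d -> R) (T : R) (x0 : Zd d) (xs : seq (Zd d)) :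
  (0 < d)%N -> density_profile rho -> schwartz phi -> 0 <= T ->
  exists2 C, 0 <= C & forall N s t Theta (zs : seq (Zd d)),
  (0 < N)%N -> 0 <= s <= T * N%:R ^+ 2 -> s <= t ->
  (forall x y, heat p (t - s) x y <= Theta) -> uniq zs ->
  \sum_(z <- zs) \sum_(z' <- zs) `|phi (rescale R N z)| * `|phi (rescale R N z')| *
    permanent (fun x y => walk_expectation p y s (fun v => rho (rescale R N v)) * heat p (t - s) y x)
      [seq z + a | a <- x0 :: xs] [seq z' + a | a <- x0 :: xs]
  <= C * N%:R ^+ d * Theta ^+ size xs.
Proof.
move=> d0 hrho hphi T0.
have [K [q [K0 key]]] := permanent_shift_bound x0 xs d0 hrho T0.
have [Cp Cp0 hCp] := schwartz_decay q hphi.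
have [Cs Cs0 hCs] := schwartz_sum 0 hphi.
pose k := (size xs).+1.
exists (Cs * (Cp * k%:R * K)); first by rewrite !mulr_ge0.
move=> N s t Theta zs N0 hs st hTheta uz.
have {}key z z' := key N s t Theta z z' N0 hs st hTheta.
have ts0 : 0 <= t - s by rewrite subr_ge0.
have Th0 : 0 <= Theta by apply: le_trans (hTheta 0 0); exact: (heat_ge0 hp).
set A := K * Theta ^+ size xs in key.
have A0 : 0 <= A by rewrite mulr_ge0 ?exprn_ge0.
apply: (@le_trans _ _ (\sum_(z <- zs) `|phi (rescale R N z)| * (Cp * A * k%:R))).
  apply: ler_sum => z _.
  apply: (@le_trans _ _ (`|phi (rescale R N z)| * \sum_(z' <- zs) (Cp * A) *
      \sum_(a <- x0 :: xs) heat p (t - s) (z' + a) (z + x0))).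
    rewrite mulr_sumr; apply: ler_sum => z' _; rewrite -mulrA ler_wpM2l //.
    apply: le_trans (ler_wpM2l (normr_ge0 _) (key z z')) _.
    set H := \sum_(a <- _) _; set G := _ ^+ q.
    have H0 : 0 <= H by apply: sumr_ge0 => a _; exact: (heat_ge0 hp).
    have -> : `|phi (rescale R N z')| * (H * (A * G)) =
       (`|phi (rescale R N z')| * G) * (A * H) by ring.
    rewrite -[leRHS]mulrA; apply: ler_wpM2r; first exact: mulr_ge0.
    exact: hCp.
  rewrite ler_wpM2l // -mulr_sumr; apply: ler_wpM2l; first exact: mulr_ge0.
  rewrite exchange_big /=.
  apply: (@le_trans _ _ (\sum_(a <- x0 :: xs) (1 : R))).
    by apply: ler_sum => a _; exact: heat_row_sum.
  by rewrite big_const_seq count_predT iter_addr_0 /= -/k.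
rewrite -mulr_suml.
have := hCs N zs N0 uz; under eq_bigr do rewrite expr0 mulr1; move=> hs'.
apply: le_trans (ler_wpM2r _ hs') _; first by do 2 (apply: mulr_ge0 => //).
by rewrite /A le_eqVlt; apply/orP; left; apply/eqP; ring.
Qed.

(** Only finiteness matters here: it is what dominated convergence requires. *)
Lemma variance_sum_bound (rho phi : 'rV[R]_d -> R) (T : R) (x0 : Zd d) (xs : seq (Zd d)) :
  (0 < d)%N -> density_profile rho -> schwartz phi -> 0 <= T ->
  exists C, forall N t (zs : seq (Zd d)),
  (0 < N)%N -> 0 <= t <= T * N%:R ^+ 2 -> uniq zs ->
  \sum_(z <- zs) `|phi (rescale R N z)| *
    permanent (fun x y => walk_expectation p y t (fun v => rho (rescale R N v)) * heat p (t - t) y x)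
      [seq z + a | a <- x0 :: xs] [seq z + a | a <- x0 :: xs]
  <= C * N%:R ^+ d.
Proof.
move=> d0 hrho hphi T0.
have [K [q [K0 key]]] := permanent_shift_bound x0 xs d0 hrho T0.
have [Cs Cs0 hCs] := schwartz_sum q hphi.
pose k := (size xs).+1.
exists (k%:R * K * Cs) => N t zs N0 ht uz.
have kK0 : 0 <= k%:R * K by rewrite mulr_ge0.
rewrite -[leRHS]mulrA; apply: le_trans (ler_wpM2l kK0 (hCs N zs N0 uz)).
rewrite mulr_sumr; apply: ler_sum => z _.
rewrite mulrCA; apply: ler_wpM2l => //.
have h1 a c : heat p (t - t) a c <= 1 by rewrite (heat_le1 hp) // subrr.
apply: le_trans (key N t t 1 z z N0 ht (lexx _) h1) _.
rewrite expr1n mulr1 -mulrA; apply: ler_wpM2r.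
  by rewrite mulr_ge0 // exprn_ge0 // addr_ge0.
apply: (@le_trans _ _ (\sum_(a <- x0 :: xs) (1 : R))).
  by apply: ler_sum => a _; exact: h1.
by rewrite big_const_seq count_predT iter_addr_0 /= -/k.
Qed.

End CovarianceSum.

(** * Expectation of a product of two random series *)

Section PartialSums.
Context {R : realType} {I : countType}.

(** The elements with code below n, so that these lists increase to the whole type. *)
Definition initial (n : nat) : seq I := pmap choice.pickle_inv (iota 0 n).

Lemma initial_uniq n : uniq (initial n).
Proof.
apply: (@pmap_uniq _ _ _ (@choice.pickle I)); last exact: iota_uniq.
exact: choice.pickle_invK.
Qed.

Lemma sum_initial (V : nmodType) (f : I -> V) n :
  \sum_(i <- initial n) f i =
  \sum_(0 <= k < n) (if choice.pickle_inv k is Some i then f i else 0).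
Proof.
rewrite /initial /index_iota subn0; elim: (iota 0 n) => [|k l IH] /=; first by rewrite !big_nil.
rewrite [RHS]big_cons -IH; case: (choice.pickle_inv k) => [i|] /=; last by rewrite add0r.
by rewrite big_cons.
Qed.

Lemma sum_initial_le (f : I -> R) n : (forall i, 0 <= f i) ->
  ((\sum_(i <- initial n) f i)%:E <= \esum_(i in [set: I]) (f i)%:E)%E.
Proof.
move=> f0; rewrite -sumEFin; apply: seq_le_esum; first exact: initial_uniq.
by move=> i; rewrite lee_fin.
Qed.

Lemma cvg_sum_initial (f : I -> R) : (forall i, 0 <= f i) ->
  (\esum_(i in [set: I]) (f i)%:E < +oo)%E ->
  (fun n => \sum_(i <- initial n) f i) @ \oo --> fine (\esum_(i in [set: I]) (f i)%:E).
Proof.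
move=> f0 ffin.
have ge0 : (0 <= \esum_(i in [set: I]) (f i)%:E)%E by apply: esum_ge0 => i _; rewrite lee_fin.
rewrite (_ : (fun n => _) = fine \o (fun n => \sum_(0 <= k < n) (if choice.pickle_inv k is Some i then (f i)%:E else 0)%E)); last first.
  by apply/funext => n /=; rewrite -sum_initial sumEFin.
apply: fine_cvg; rewrite fineK; last by rewrite ge0_fin_numE.
rewrite esum_pickle; last by move=> i; rewrite lee_fin.
by apply: is_cvg_nneseries => n _ _; case: choice.pickle_inv.
Qed.

(** Absolutely summable families are limits of their partial sums. *)
Lemma tsum_cvg (f : I -> R) : (\esum_(i in [set: I]) `|f i|%:E < +oo)%E ->
  (fun n => \sum_(i <- initial n) f i) @ \oo --> tsum f.
Proof.
move=> ffin.
rewrite (_ : (fun n => _) = (fun n => \sum_(i <- initial n) Num.max (f i) 0 - \sum_(i <- initial n) Num.max (- f i) 0)).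
  apply: cvgB; apply: cvg_sum_initial; try by move=> i; rewrite le_max lexx orbT.
    apply: le_lt_trans ffin; apply: le_esum => i _; rewrite lee_fin ge_max normr_ge0 andbT.
    exact: ler_norm.
  apply: le_lt_trans ffin; apply: le_esum => i _; rewrite lee_fin ge_max normr_ge0 andbT.
  by rewrite -normrN; exact: ler_norm.
apply/funext => n; rewrite -sumrB; apply: eq_bigr => i _.
by case: (leP 0 (f i)) => h; [rewrite max_r ?subr0 // oppr_le0|rewrite max_l ?sub0r ?opprK // oppr_ge0 ltW].
Qed.

End PartialSums.

Section ProductOfSums.
Context {R : realType} {disp : measure_display} {Omega : measurableType disp}.
Variable P : probability Omega R.
Context {I : countType}.
Variables (a b : I -> Omega -> R) (c A B : I -> R) (V : I -> I -> R) (M M1 M2 : R).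
Hypothesis ma : forall i, measurable_fun [set: Omega] (a i).
Hypothesis mb : forall i, measurable_fun [set: Omega] (b i).
Hypothesis A0 : forall i, 0 <= A i.
Hypothesis B0 : forall i, 0 <= B i.
Hypothesis EA : forall i, (\int[P]_w (a i w ^+ 2)%:E = (A i)%:E)%E.
Hypothesis EB : forall i, (\int[P]_w (b i w ^+ 2)%:E = (B i)%:E)%E.
Hypothesis iV : forall i j, P.-integrable setT (fun w => (a i w * b j w)%:E).
Hypothesis EV : forall i j, (\int[P]_w (a i w * b j w)%:E = (V i j)%:E)%E.
Hypothesis c1 : forall s, uniq s -> \sum_(i <- s) `|c i| <= M1.
Hypothesis cA : forall s, uniq s -> \sum_(i <- s) `|c i| * A i <= M2.
Hypothesis cB : forall s, uniq s -> \sum_(i <- s) `|c i| * B i <= M2.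
Hypothesis cV : forall s, uniq s -> \sum_(i <- s) \sum_(j <- s) c i * c j * V i j <= M.

Let M10 : 0 <= M1.
Proof. by have := c1 (s := [::]) isT; rewrite big_nil. Qed.

Let qa w := \esum_(i in [set: I]) (`|c i| * a i w ^+ 2)%:E.
Let qb w := \esum_(i in [set: I]) (`|c i| * b i w ^+ 2)%:E.

Let measurable_weighted_sqr (e : I -> Omega -> R) :
  (forall i, measurable_fun [set: Omega] (e i)) ->
  measurable_fun [set: Omega] (fun w => \esum_(i in [set: I]) (`|c i| * e i w ^+ 2)%:E).
Proof.
move=> me; apply: measurable_esum => [i|i w]; last by rewrite lee_fin mulr_ge0 ?sqr_ge0.
by apply/measurable_EFinP/measurable_funM => //; exact: measurable_funX.
Qed.

Let integral_weighted_sqr (e : I -> Omega -> R) (D : I -> R) :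
  (forall i, measurable_fun [set: Omega] (e i)) ->
  (forall i, (\int[P]_w (e i w ^+ 2)%:E = (D i)%:E)%E) ->
  (forall s, uniq s -> \sum_(i <- s) `|c i| * D i <= M2) ->
  (\int[P]_w (\esum_(i in [set: I]) (`|c i| * e i w ^+ 2)%:E) <= M2%:E)%E.
Proof.
move=> me ED cD; rewrite integral_esum.
- apply: esum_le_bound => s us.
  rewrite (eq_bigr (fun i => (`|c i| * D i)%:E)).
    by rewrite sumEFin lee_fin cD.
  move=> i _; under eq_integral do rewrite EFinM.
  rewrite ge0_integralZl ?ED //.
  + by apply/measurable_EFinP/measurable_funX.
  + by move=> w _; rewrite lee_fin sqr_ge0.
- by move=> i; apply/measurable_EFinP/measurable_funM => //; exact: measurable_funX.
- by move=> i w; rewrite lee_fin mulr_ge0 ?sqr_ge0.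
Qed.

Let bound w := ((M1 / 2)%:E * (qa w + qb w))%E.

Let qa0 w : (0 <= qa w)%E.
Proof. by apply: esum_ge0 => i _; rewrite lee_fin mulr_ge0 ?sqr_ge0. Qed.
Let qb0 w : (0 <= qb w)%E.
Proof. by apply: esum_ge0 => i _; rewrite lee_fin mulr_ge0 ?sqr_ge0. Qed.

Let integrable_bound : P.-integrable setT bound.
Proof.
have mq := measurable_weighted_sqr.
have mb1 : measurable_fun setT bound.
  by apply: measurable_funeM; apply: emeasurable_funD; exact: mq.
apply/integrableP; split=> //.
apply: (@le_lt_trans _ _ (\int[P]_w bound w)%E).
  rewrite le_eqVlt; apply/orP; left; apply/eqP; apply: eq_integral => w _.
  by rewrite gee0_abs // mule_ge0 ?adde_ge0 // lee_fin divr_ge0.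
rewrite /bound ge0_integralZl //; last 3 first.
- by apply: emeasurable_funD; exact: mq.
- by move=> w _; rewrite adde_ge0.
- by rewrite lee_fin divr_ge0.
rewrite ge0_integralD //; try exact: mq.
apply: (@le_lt_trans _ _ ((M1 / 2)%:E * (M2%:E + M2%:E))%E); last by rewrite -EFinD -EFinM ltry.
rewrite lee_wpmul2l ?lee_fin ?divr_ge0 // leeD //; exact: integral_weighted_sqr.
Qed.

Let esum_c : (\esum_(i in [set: I]) `|c i|%:E <= M1%:E)%E.
Proof. by apply: esum_le_bound => s us; rewrite sumEFin lee_fin c1. Qed.

Let summable_weighted (e : I -> Omega -> R) w :
  (\esum_(i in [set: I]) (`|c i| * e i w ^+ 2)%:E < +oo)%E ->
  (\esum_(i in [set: I]) `|c i * e i w|%:E < +oo)%E.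
Proof.
move=> h.
apply: (@le_lt_trans _ _ (\esum_(i in [set: I]) (`|c i|%:E + (`|c i| * e i w ^+ 2)%:E))%E).
  apply: le_esum => i _; rewrite -EFinD lee_fin normrM -[X in X + _]mulr1 -mulrDr ler_wpM2l //.
  rewrite -(real_normK (num_real (e i w))).
  have := normr_ge0 (e i w); set y := `|e i w|; nra.
rewrite esumD //; last by move=> i _; rewrite lee_fin mulr_ge0 ?sqr_ge0.
apply: lte_add_pinfty => //; apply: le_lt_trans esum_c _; exact: ltry.
Qed.

Let partial_bound n w :
  (`|((\sum_(i <- initial n) c i * a i w) * (\sum_(i <- initial n) c i * b i w))%:E| <= bound w)%E.
Proof.
have un := @initial_uniq I n.
have h : `|(\sum_(i <- initial n) c i * a i w) * (\sum_(i <- initial n) c i * b i w)| <=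
  M1 / 2 * (\sum_(i <- initial n) `|c i| * a i w ^+ 2 + \sum_(i <- initial n) `|c i| * b i w ^+ 2).
  rewrite mulr_suml.
  apply: (@le_trans _ _ (\sum_(i <- initial n) \sum_(j <- initial n)
     `|c i| * `|c j| * (2^-1 * (a i w ^+ 2 + b j w ^+ 2)))).
    apply: le_trans (ler_norm_sum _ _ _) _; apply: ler_sum => i _.
    rewrite mulr_sumr; apply: le_trans (ler_norm_sum _ _ _) _; apply: ler_sum => j _.
    rewrite !normrM mulrACA ler_wpM2l ?mulr_ge0 //.
    rewrite -(real_normK (num_real (a i w))) -(real_normK (num_real (b j w))).
    have := sqr_ge0 (`|a i w| - `|b j w|); nra.
  set C := \sum_(i <- initial n) `|c i|.
  apply: (@le_trans _ _ (C / 2 * (\sum_(i <- initial n) `|c i| * a i w ^+ 2 + \sum_(i <- initial n) `|c i| * b i w ^+ 2))).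
    rewrite le_eqVlt; apply/orP; left; apply/eqP.
    under eq_bigr => i _.
      under eq_bigr do rewrite mulrDr mulrDr.
      rewrite big_split /=.
      rewrite (_ : \sum_(j <- _) _ = `|c i| * a i w ^+ 2 * 2^-1 * C); last first.
        by rewrite mulr_sumr; apply: eq_bigr => j _; ring.
      rewrite (_ : \sum_(j <- initial n) `|c i| * `|c j| * (2^-1 * b j w ^+ 2) = `|c i| * (2^-1 * \sum_(j <- initial n) `|c j| * b j w ^+ 2)); last first.
        by rewrite !mulr_sumr; apply: eq_bigr => j _; ring.
      over.
    rewrite big_split /= -!mulr_suml -/C; ring.
  rewrite ler_wpM2r ?addr_ge0 ?sumr_ge0 //; try by move=> i _; rewrite mulr_ge0 ?sqr_ge0.
  by rewrite ler_wpM2r // c1.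
rewrite [X in (X <= _)%E](_ : _ = `|(\sum_(i <- initial n) c i * a i w) * (\sum_(i <- initial n) c i * b i w)|%:E) //.
apply: (@le_trans _ _ (M1 / 2 * (\sum_(i <- initial n) `|c i| * a i w ^+ 2 + \sum_(i <- initial n) `|c i| * b i w ^+ 2))%:E).
  by rewrite lee_fin.
rewrite EFinM EFinD lee_wpmul2l ?lee_fin ?divr_ge0 //.
by apply: leeD; apply: sum_initial_le => i; rewrite mulr_ge0 ?sqr_ge0.
Qed.

Let measurable_tsum (e : I -> Omega -> R) :
  (forall i, measurable_fun [set: Omega] (e i)) ->
  measurable_fun [set: Omega] (fun w => tsum (fun i => c i * e i w)).
Proof.
move=> me; apply: measurable_funB; apply: (measurableT_comp (f := fine)) => //.
  apply: measurable_esum => [i|i w]; last by rewrite lee_fin le_max lexx orbT.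
  by apply/measurable_EFinP/measurable_maxr => //; exact: measurable_funM.
apply: measurable_esum => [i|i w]; last by rewrite lee_fin le_max lexx orbT.
apply/measurable_EFinP/measurable_maxr => //.
by apply: measurableT_comp => //; exact: measurable_funM.
Qed.

(** The products of partial sums are dominated, by the arithmetic-geometric mean
    inequality, by a multiple of the sum of |c i| (a_i^2 + b_i^2). *)
Theorem expectation_tsum_mul :
  (\int[P]_w (tsum (fun i => c i * a i w) * tsum (fun i => c i * b i w))%:E <= M%:E)%E.
Proof.
pose f_ n w := ((\sum_(i <- initial n) c i * a i w) * (\sum_(i <- initial n) c i * b i w))%:E.
pose f w := (tsum (fun i => c i * a i w) * tsum (fun i => c i * b i w))%:E.
have mf_ n : measurable_fun setT (f_ n).
  by apply/measurable_EFinP/measurable_funM; apply: measurable_sum => i; exact: measurable_funM.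
have mf : measurable_fun setT f.
  by apply/measurable_EFinP/measurable_funM; exact: measurable_tsum.
have cv : {ae P, forall w, setT w -> f_ ^~ w @ \oo --> f w}.
  have := integrable_ae measurableT integrable_bound.
  have ia : P.-integrable setT qa.
    apply/integrableP; split; first exact: measurable_weighted_sqr.
    apply: (@le_lt_trans _ _ M2%:E); last exact: ltry.
    rewrite (_ : \int[P]_(x in setT) _ = \int[P]_x qa x)%E; first exact: integral_weighted_sqr EA cA.
    by apply: eq_integral => w _; rewrite gee0_abs.
  have ib : P.-integrable setT qb.
    apply/integrableP; split; first exact: measurable_weighted_sqr.
    apply: (@le_lt_trans _ _ M2%:E); last exact: ltry.
    rewrite (_ : \int[P]_(x in setT) _ = \int[P]_x qb x)%E; first exact: integral_weighted_sqr EB cB.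
    by apply: eq_integral => w _; rewrite gee0_abs.
  move=> _; apply: filterS2 (integrable_ae measurableT ia) (integrable_ae measurableT ib) => w h1 h2 _.
  have {}h1 : (qa w < +oo)%E by rewrite -ge0_fin_numE //; exact: h1.
  have {}h2 : (qb w < +oo)%E by rewrite -ge0_fin_numE //; exact: h2.
  apply: cvg_EFin; first exact: nearW.
  apply: cvgM; apply: tsum_cvg; exact: summable_weighted.
have [_ _ lim] := dominated_convergence measurableT mf_ mf cv integrable_bound
  (nearW _ (fun w n _ => partial_bound n w)).
apply: (cvge_to_le lim); apply: nearW => n /=.
have un := @initial_uniq I n.
rewrite (_ : \int[P]_(x in setT) f_ n x = (\sum_(i <- initial n) \sum_(j <- initial n) c i * c j * V i j)%:E)%E.
  by rewrite lee_fin cV.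
transitivity (\int[P]_w (\sum_(i <- initial n) \sum_(j <- initial n) ((c i * c j)%:E * (a i w * b j w)%:E)))%E.
  apply: eq_integral => w _; rewrite /f_ mulr_suml -sumEFin; apply: eq_bigr => i _.
  rewrite mulr_sumr -sumEFin; apply: eq_bigr => j _.
  by rewrite -EFinM; congr EFin; ring.
have iVc i j : P.-integrable setT (fun w => (c i * c j)%:E * (a i w * b j w)%:E)%E.
  exact: integrableZl.
rewrite integral_sum //; last first.
  by move=> i; apply: integrable_sum => // j _; exact: iVc.
rewrite -sumEFin; apply: eq_bigr => i _.
rewrite integral_sum // -sumEFin; apply: eq_bigr => j _.
by rewrite integralZl // EV.
Qed.

End ProductOfSums.

(** * The fluctuation field *)

Section FluctuationMoment.
Context {R : realType} {d : nat} {p : Zd d -> Zd d -> R} (hp : walk_kernel p).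

(** Theta bounds the heat kernel at the time lag; only k - 1 of the k heat kernel
    factors are bounded by it. *)
Lemma fluct_second_moment (rho phi : 'rV[R]_d -> R) (T : R) k (x : k.-tuple (Zd d)) :
  (0 < d)%N -> (0 < k)%N -> density_profile rho -> schwartz phi -> 0 <= T ->
  exists2 C, 0 <= C & forall N (disp : measure_display) (Omega : measurableType disp)
    (P : probability Omega R) (eta : R -> Omega -> configuration d),
  (0 < N)%N -> independent_walkers p P eta ->
  product_poisson (fun y => rho (rescale R N y)) P (eta 0) ->
  forall s t Theta, 0 <= s <= t -> t <= T ->
  (forall y z, heat p (N%:R ^+ 2 * (t - s)) y z <= Theta) ->
  (\int[P]_w (fluct_field p N x rho phi eta t w * fluct_field p N x rho phi eta s w)%:E <=
   (C * N%:R ^+ d * Theta ^+ k.-1)%:E)%E.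
Proof.
move=> d0 k0 hrho hphi T0.
have [x0 [xs ex]] : exists x0 xs, (x : seq (Zd d)) = x0 :: xs.
  by case: (x : seq _) (size_tuple x) => [|x0 xs]; [move=> h; rewrite -h in k0|exists x0, xs].
have sxs : size xs = k.-1 by rewrite -(size_tuple x) ex.
have [C C0 hC] := covariance_sum_bound hp x0 xs d0 hrho hphi T0.
have [C2 hC2] := variance_sum_bound hp x0 xs d0 hrho hphi T0.
have [C1 C10 hC1] := schwartz_sum 0 hphi.
exists C => // N disp Omega P eta N0 hw hpois s t Theta /andP[s0 st] tT hTh.
pose r y := rho (rescale R N y).
have r0 y : 0 < r y by exact: hrho.1.
have evf u y : 0 <= u -> \esum_(v in [set: Zd d]) (heat p u y v * r v)%:E \is a fin_num.
  move=> u0; have [K [m [_ hK]]] := evolved_sum_bound hp d0 hrho u0.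
  have h : 0 <= u <= u * N%:R ^+ 2 by rewrite u0 /= ler_peMr // exprn_ege1 // ler1n.
  rewrite ge0_fin_numE; first exact: le_lt_trans (hK N u y N0 h) (ltry _).
  by apply: esum_ge0 => v _; rewrite lee_fin mulr_ge0 ?(heat_ge0 hp) // ltW.
have N20 : 0 <= N%:R ^+ 2 :> R by rewrite exprn_ge0.
pose u := N%:R ^+ 2 * t; pose v := N%:R ^+ 2 * s.
have v0 : 0 <= v by rewrite mulr_ge0.
have vu : v <= u by rewrite ler_wpM2l.
have uT : u <= T * N%:R ^+ 2 by rewrite /u mulrC ler_wpM2r.
have vT : v <= T * N%:R ^+ 2 := le_trans vu uT.
have u0 : 0 <= u := le_trans v0 vu.
have EX t' w : fluct_field p N x rho phi eta t' w =
    tsum (fun z => phi (rescale R N z) *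
      charlier_prod (evolved_rate (p := p) r (N%:R ^+ 2 * t')) [seq z + a | a <- x0 :: xs] (eta (N%:R ^+ 2 * t') w)).
  congr tsum; apply/funext => z; rewrite dualityE /= ex mulrC.
  by rewrite [t' * _]mulrC mulrC.
under eq_integral do rewrite !EX.
pose V u' v' z z' := permanent (fun y y' => evolved_rate (p := p) r v' y' * heat p (u' - v') y' y)
   [seq z + a | a <- x0 :: xs] [seq z' + a | a <- x0 :: xs].
have cov u' v' z z' (h1 : 0 <= v') (h2 : v' <= u') := charlier_covariance hp r0 hw hpois evf h1 h2
   [seq z + a | a <- x0 :: xs] [seq z' + a | a <- x0 :: xs].
have ev0 u' y : 0 <= u' -> 0 <= evolved_rate (p := p) r u' y.
  move=> hu; apply/fine_ge0/esum_ge0 => y' _; rewrite lee_fin mulr_ge0 ?(heat_ge0 hp) //.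
  exact: ltW.
have V0 u' v' z z' : 0 <= v' <= u' -> 0 <= V u' v' z z'.
  move=> /andP[h1 h2]; apply: permanent_ge0 => y y'; rewrite mulr_ge0 ?ev0 ?(heat_ge0 hp) //.
  by rewrite subr_ge0.
have sq u' z : 0 <= u' -> (\int[P]_w (charlier_prod (evolved_rate (p := p) r u') [seq z + a | a <- x0 :: xs] (eta u' w) ^+ 2)%:E = (V u' u' z z)%:E)%E.
  by move=> h; have [_ <-] := cov u' u' z z h (lexx _); apply: eq_integral => w _; rewrite expr2.
apply: (@expectation_tsum_mul _ _ _ P _
  (fun z w => charlier_prod (evolved_rate (p := p) r u) [seq z + a | a <- x0 :: xs] (eta u w))
  (fun z w => charlier_prod (evolved_rate (p := p) r v) [seq z + a | a <- x0 :: xs] (eta v w))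
  (fun z => phi (rescale R N z)) (fun z => V u u z z) (fun z => V v v z z) (fun z z' => V u v z z')
  _ (C1 * N%:R ^+ d) (C2 * N%:R ^+ d)).
- by move=> z; exact: (measurable_charlier_prod hw).
- by move=> z; exact: (measurable_charlier_prod hw).
- by move=> z; exact: sq.
- by move=> z; exact: sq.
- by move=> z z'; exact: (cov u v z z' v0 vu).1.
- by move=> z z'; exact: (cov u v z z' v0 vu).2.
- by move=> zs uz; have := hC1 N zs N0 uz; under eq_bigr do rewrite expr0 mulr1.
- by move=> zs uz; apply: hC2; rewrite ?u0.
- by move=> zs uz; apply: hC2; rewrite ?v0.
- move=> zs uz; rewrite -sxs.
  apply: le_trans (hC N v u Theta zs N0 _ vu _ uz); last 2 first.
  + by rewrite v0.
  + by move=> y z; rewrite /u /v -mulrBr.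
  apply: ler_sum => z _; apply: ler_sum => z' _; apply: ler_wpM2r.
    by apply: V0; rewrite v0.
  by rewrite -normrM ler_norm.
Qed.

End FluctuationMoment.

(** The integral of the positive part is a supremum over the simple functions
    below it, hence monotone for arbitrary functions. *)
Lemma le_integral_majorant {R : realType} {disp : measure_display} {T : measurableType disp}
    (mu : {measure set T -> \bar R}) (D : set T) (f g : T -> \bar R) :
  (forall x, D x -> f x <= g x)%E -> (forall x, D x -> 0 <= g x)%E ->
  (\int[mu]_(x in D) f x <= \int[mu]_(x in D) g x)%E.
Proof.
move=> fg g0; rewrite integralE.
apply: (@le_trans _ _ (\int[mu]_(x in D) f^\+ x)%E).
  by rewrite geeDl // leeNl oppe0; apply: integral_ge0 => x _; exact: funeneg_ge0.
rewrite !ge0_integralE //.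
apply: ereal_sup_le => _ [h hf <-]; exists h => // x.
apply: le_trans (hf x) _; rewrite /patch; case: ifPn => // /set_mem Dx.
by rewrite funeposE ge_max fg ?g0.
Qed.

Section TimeIntegral.
Context {R : realType}.
Local Notation leb := (@lebesgue_measure R).

Lemma measure_segment (a b : R) : a <= b -> leb `[a, b]%classic = (b - a)%:E.
Proof.
move=> ab; rewrite lebesgue_measure_itv /= lte_fin; case: ltP => // ba.
by have -> : a = b by [apply/eqP; rewrite eq_le ab ba]; rewrite subrr.
Qed.

Lemma integral_cst_segment (T A : R) : 0 <= T ->
  (\int[leb]_(s in `[0%R, T]) A%:E = (A * T)%:E)%E.
Proof.
move=> T0; transitivity (A%:E * leb `[0%R, T]%classic)%E; first exact: integral_cst.
by rewrite measure_segment // subr0.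
Qed.

(** The strip of half-width eps meets each line t = constant in length at most
    2 eps. *)
Lemma time_integral_le (F : R -> R -> \bar R) (T eps A B : R) :
  0 <= T -> 0 <= eps -> 0 <= A -> 0 <= B ->
  (forall t s, 0 <= t <= T -> 0 <= s <= T ->
     (F t s <= (B * (`|t - s| <= eps)%R%:R + A)%:E)%E) ->
  (\int[leb]_(t in `[0%R, T]) \int[leb]_(s in `[0%R, T]) F t s <=
   (T * (B * (2 * eps) + A * T))%:E)%E.
Proof.
move=> T0 eps0 A0 B0 hF.
have inner t : 0 <= t <= T ->
   (\int[leb]_(s in `[0%R, T]) F t s <= (B * (2 * eps) + A * T)%:E)%E.
  move=> tT.
  pose S : set R := `[t - eps, t + eps]%classic.
  have mS : measurable S by exact: measurable_itv.
  apply: (@le_trans _ _ (\int[leb]_(s in `[0%R, T]) (B%:E * (\1_S s)%:E + A%:E))%E).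
    apply: le_integral_majorant => s; rewrite /= in_itv /= => sT.
      apply: le_trans (hF t s tT sT) _; rewrite -EFinM -EFinD lee_fin lerD2r ler_wpM2l //.
      rewrite indicE; case: (boolP (_ <= eps)) => // h; rewrite mem_set //.
      rewrite /S /= in_itv /=; move: h; rewrite ler_norml => /andP[h1 h2].
      by apply/andP; split; lra.
    by rewrite -EFinM -EFinD lee_fin addr_ge0 ?mulr_ge0.
  rewrite ge0_integralD //; last first.
  - by apply: emeasurable_funM => //; exact/measurable_EFinP/measurable_indic.
  - by move=> s _; rewrite -EFinM lee_fin mulr_ge0.
  rewrite EFinD; apply: leeD; last by rewrite le_eqVlt; apply/orP; left; apply/eqP; exact: integral_cst_segment.
  rewrite ge0_integralZl //; last first.
    by apply/measurable_EFinP; exact: measurable_indic.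
  rewrite integral_indic // EFinM lee_wpmul2l ?lee_fin //.
  apply: (@le_trans _ _ (leb S)).
    by apply: le_measure; rewrite ?inE //; exact: measurableI.
  by rewrite measure_segment ?lee_fin; lra.
apply: (@le_trans _ _ (\int[leb]_(t in `[0%R, T]) (B * (2 * eps) + A * T)%:E)%E).
  apply: le_integral_majorant => t; rewrite /= in_itv /= => tT; first exact: inner.
  by rewrite lee_fin addr_ge0 ?mulr_ge0.
by rewrite le_eqVlt [T * _]mulrC; apply/orP; left; apply/eqP; exact: integral_cst_segment.
Qed.

End TimeIntegral.

Theorem corollary4p1 (R : realType) (d : nat) (hd : (1 <= d)%N)
    (p : Zd d -> Zd d -> R) (hp : walk_kernel p)
    (rho : 'rV[R]_d -> R) (hrho : density_profile rho)
    (k : nat) (hk : (1 <= k)%N) (x : k.-tuple (Zd d))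
    (phi : 'rV[R]_d -> R) (hphi : schwartz phi) (T : R) (hT : 0 < T) :
  exists C : R, \forall N \near \oo,
  forall (disp : measure_display) (Omega : measurableType disp)
    (P : probability Omega R) (eta : R -> Omega -> configuration d),
  independent_walkers p P eta ->
  product_poisson (fun y => rho (rescale R N y)) P (eta 0) ->
  (((N%:R ^+ d)^-1)%:E *
     \int[lebesgue_measure]_(t in `[0%R, T])
       \int[lebesgue_measure]_(s in `[0%R, T])
         'E_P[fun w => (fluct_field p N x rho phi eta t w *
                        fluct_field p N x rho phi eta s w)%R]
   <= (C * N%:R `^ (- (2 * (k%:R - 1) * d%:R
                        / (2 + (k%:R - 1) * d%:R))))%:E)%E.
Proof.
have T0 : 0 <= T by exact: ltW.
have [C C0 hC] := fluct_second_moment hp x hd hk hrho hphi T0.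
have [Ch Ch0 hCh] := heat_sup_le hp.
pose j := k.-1.
have kj : k%:R - 1 = j%:R :> R by rewrite /j -[in LHS](prednK hk) -natr1 addrK.
rewrite kj; pose D : R := j%:R * d%:R.
have D0 : 0 <= D by rewrite mulr_ge0.
pose a : R := 2 * j%:R * d%:R / (2 + j%:R * d%:R).
exists (T * C * (2 + Ch ^+ j * T)); near=> N.
have N0 : (0 < N)%N by near: N; exact: nbhs_infty_gt.
move=> disp Omega P eta hw hpois.
have N0' : 0 < N%:R :> R by rewrite ltr0n.
rewrite -/a.
pose q : R := 2 / (2 + D).
have aq : 2 - a = q * 2 by rewrite /a /q /D; field; rewrite gt_eqF // ltr_wpDr // -/D.
have qD : q * D = a by rewrite /a /q /D; field; rewrite gt_eqF // ltr_wpDr // -/D.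
(* With delta = N sqrt eps, this choice makes delta ^ (- D) equal to eps. *)
pose eps : R := N%:R `^ (- a).
have eps0 : 0 < eps by exact: powR_gt0.
pose delta : R := N%:R `^ q.
have delta0 : 0 < delta by exact: powR_gt0.
have delta2 : delta ^+ 2 = N%:R ^+ 2 * eps.
  rewrite /delta -powR_mulrn ?powR_ge0 // -powRrM -aq /eps -(powR_mulrn 2) ?ltW //.
  by rewrite -powRD // (gt_eqF N0') implybT.
pose Th : R := Ch / delta ^+ d.
have Th0 : 0 <= Th by rewrite divr_ge0 ?ltW // exprn_gt0.
have heatT tau : eps < tau -> forall y z, heat p (N%:R ^+ 2 * tau) y z <= Th.
  move=> ht y z; have tau0 : 0 < tau by exact: lt_trans ht.
  have Nt : 0 < N%:R ^+ 2 * tau by rewrite mulr_gt0 // exprn_gt0.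
  rewrite /Th ler_pdivlMr ?exprn_gt0 //; apply: le_trans (hCh _ y z Nt).
  apply: ler_wpM2l; first exact/(heat_ge0 hp)/ltW.
  apply: lerXn2r; rewrite ?nnegrE ?sqrtr_ge0 //; first exact: ltW.
  rewrite -[delta]gtr0_norm // -sqrtr_sqr ler_wsqrtr // delta2.
  by apply: ler_wpM2l; [exact/exprn_ge0/ltW|exact: ltW].
have ThE : Th ^+ j = Ch ^+ j * eps.
  rewrite /Th expr_div_n -exprM; congr (_ * _).
  rewrite /delta -powR_mulrn ?powR_ge0 // -powRrM natrM mulrC [d%:R * _]mulrC -/D.
  by rewrite mulrC qD -powRN.
pose B := C * N%:R ^+ d.
have B0 : 0 <= B by rewrite mulr_ge0 // exprn_ge0 // ltW.
(* On the strip the heat kernel is bounded by 1, off the strip by Th. *)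
have half s t : 0 <= s -> s <= t -> t <= T ->
   (\int[P]_w (fluct_field p N x rho phi eta t w * fluct_field p N x rho phi eta s w)%:E <=
    (B * (`|t - s| <= eps)%R%:R + B * Th ^+ j)%:E)%E.
  move=> s0 st tT; rewrite ger0_norm ?subr_ge0 //.
  have ts0 : 0 <= N%:R ^+ 2 * (t - s) by rewrite mulr_ge0 ?exprn_ge0 ?subr_ge0 // ltW.
  have [h|h] := leP (t - s) eps.
    apply: le_trans (hC N _ _ P eta N0 hw hpois s t 1 _ tT _) _.
    - by rewrite s0.
    - by move=> y z; exact: (heat_le1 hp).
    by rewrite lee_fin expr1n !mulr1 lerDl mulr_ge0 // exprn_ge0.
  apply: le_trans (hC N _ _ P eta N0 hw hpois s t Th _ tT _) _.
  - by rewrite s0.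
  - exact: heatT.
  by rewrite lee_fin mulr0 add0r.
apply: (@le_trans _ _ (((N%:R ^+ d)^-1)%:E * (T * (B * (2 * eps) + (B * Th ^+ j) * T))%:E)%E).
  apply: lee_wpmul2l; first by rewrite lee_fin invr_ge0 exprn_ge0 // ltW.
  apply: time_integral_le => //.
  - exact: ltW.
  - by rewrite mulr_ge0 // exprn_ge0.
  move=> t s /andP[t0 tT] /andP[s0 sT]; rewrite unlock.
  have [st|/ltW ts] := leP s t; first exact: half.
  under eq_integral do rewrite mulrC.
  by rewrite distrC; exact: half.
rewrite -EFinM lee_fin ThE /B le_eqVlt; apply/orP; left; apply/eqP.
by rewrite -/eps; field; rewrite gt_eqF // exprn_gt0.
Unshelve. all: by end_near.
Qed.
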